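(* Let $w=(w_1,w_2)$ be a pair of positive real numbers with $w_1+w_2=1$ and $w_1>w_2$. For any $\Lambda\in\mathcal{L}_3$ and any nonempty open subset $U$ of $\mathbb{R}^2$, the Hausdorff dimension of $$\{x\in U:\ \mathcal{A}^+h(x)\Lambda \text{ is divergent}\}$$ is at least $2-\frac{1}{1+w_1}$.
   Context: $\mathcal{L}_3\cong SL_3(\mathbb{R})/SL_3(\mathbb{Z})$ is the space of unimodular lattices in $\mathbb{R}^3$, with $SL_3(\mathbb{R})$ acting by $g\Lambda=\{g\mathbf{v}:\mathbf{v}\in\Lambda\}$. For $t\in\mathbb{R}$ let $a_t=\mathrm{diag}(e^{w_1t},e^{w_2t},e^{-t})$ and let $\mathcal{A}^+=\{a_t:t\ge 0\}$. For $x=(x_1,x_2)\in\mathbb{R}^2$, $$h(x)=\begin{pmatrix}1&0&x_1\\0&1&x_2\\0&0&1\end{pmatrix}.$$ For $\Lambda'\in\mathcal{L}_3$, the trajectory $\mathcal{A}^+\Lambda'$ is divergent if for every compact subset $\mathcal{K}$ of $\mathcal{L}_3$ there exists $T_0>0$ such that $a_t\Lambda'\notin\mathcal{K}$ for all $t\ge T_0$. Hausdorff dimension in $\mathbb{R}^2$ is with respect to the Euclidean metric. *)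

(* Defs.v *)
From HB Require Import structures.
From mathcomp Require Import all_boot all_order all_algebra generic_quotient.
From mathcomp Require Import all_classical all_reals all_analysis.

Set Implicit Arguments.
Unset Strict Implicit.
Unset Printing Implicit Defensive.

Import Order.TTheory GRing.Theory Num.Theory.
Import numFieldNormedType.Exports.

Local Open Scope classical_set_scope.
Local Open Scope ring_scope.

(* [set_type] carries the topology induced from the space of matrices. *)
Definition SL3 (R : realType) : Type :=
  set_type [set g : 'M[R]_3 | \det g = 1].

Definition SL3_mx (R : realType) (g : SL3 R) : 'M[R]_3 := set_val g.

Definition mk_SL3 (R : realType) (g : 'M[R]_3) (hg : \det g = 1) : SL3 R :=
  exist _ g (mem_set hg).

Lemma det_SL3 (R : realType) (g : SL3 R) : \det (SL3_mx g) = 1.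
Proof. exact: (set_mem (svalP g)). Qed.

Definition Zspan (R : realType) (g : 'M[R]_3) : set 'cV[R]_3 :=
  [set g *m map_mx intr z | z in [set: 'cV[int]_3]].

(* The columns of [g] are a basis of the lattice, so [`|\det g|] is its
   covolume. *)
Record lattice (R : realType) := Lattice {
  lattice_set :> set 'cV[R]_3;
  latticeP : exists2 g : 'M[R]_3, `|\det g| = 1 & lattice_set = Zspan g }.

Lemma lattice_eq (R : realType) (L M : lattice R) :
  lattice_set L = lattice_set M -> L = M.
Proof.
by case: L M => [L hL] [M hM] /= e; subst M; rewrite (Prop_irrelevance hL hM).
Qed.

Lemma SL3_lattice_subproof (R : realType) (g : SL3 R) :
  exists2 g' : 'M[R]_3, `|\det g'| = 1 & Zspan (SL3_mx g) = Zspan g'.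
Proof. by exists (SL3_mx g); rewrite // det_SL3 normr1. Qed.

Definition SL3_lattice (R : realType) (g : SL3 R) : lattice R :=
  Lattice (SL3_lattice_subproof g).

Lemma ZspanN (R : realType) (g : 'M[R]_3) : Zspan (- g) = Zspan g.
Proof.
by apply/seteqP; split=> _ [z _ <-]; exists (- z) => //;
  rewrite map_mxN mulmxN ?mulNmx ?opprK.
Qed.

Lemma SL3_lattice_surj (R : realType) (L : lattice R) :
  exists g : SL3 R, SL3_lattice g = L.
Proof.
have [g hg e] := latticeP L.
suff [g' dg' eg'] : exists2 g' : 'M[R]_3, \det g' = 1 & Zspan g' = Zspan g.
  by exists (mk_SL3 dg'); apply: lattice_eq; rewrite /= eg' -e.
have [d0|d0] := lerP 0 (\det g); first by exists g; rewrite // -hg ger0_norm.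
exists (- g); last exact: ZspanN.
by rewrite -scaleN1r detZ -signr_odd /= expr1 mulN1r -ltr0_norm.
Qed.

Definition lattice_repr (R : realType) (L : lattice R) : SL3 R :=
  projT1 (cid (SL3_lattice_surj L)).

Lemma lattice_reprK (R : realType) :
  cancel (@lattice_repr R) (@SL3_lattice R).
Proof. by move=> L; rewrite /lattice_repr; case: cid. Qed.

(* The topology of SL_3(R)/SL_3(Z): the quotient topology along
   g |-> g Z^3. *)
HB.instance Definition _ (R : realType) :=
  isQuotient.Build (SL3 R) (lattice R) (@lattice_reprK R).
HB.instance Definition _ (R : realType) :=
  Topological.copy (lattice R) (quotient_topology (lattice R)).

Lemma open_latticeP (R : realType) (U : set (lattice R)) :
  open U <-> open (@SL3_lattice R @^-1` U).
Proof.
suff -> : @SL3_lattice R @^-1` U =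
  (\pi_(quotient_topology (lattice R))%qT @^-1` U) by [].
by rewrite unlock.
Qed.

Lemma lattice_act_subproof (R : realType) (g : SL3 R) (L : lattice R) :
  exists2 g' : 'M[R]_3, `|\det g'| = 1 &
    [set SL3_mx g *m v | v in (L : set 'cV[R]_3)] = Zspan g'.
Proof.
have [b hb ->] := latticeP L.
exists (SL3_mx g *m b); first by rewrite det_mulmx det_SL3 mul1r.
apply/seteqP; split=> [_ [_ [z _ <-] <-]|_ [z _ <-]].
  by exists z => //; rewrite mulmxA.
by exists (b *m map_mx intr z); [exists z | rewrite mulmxA].
Qed.

Definition lattice_act (R : realType) (g : SL3 R) (L : lattice R) : lattice R :=
  Lattice (lattice_act_subproof g L).

Definition flow_mx (R : realType) (w1 w2 t : R) : 'M[R]_3 :=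
  diag_mx (\row_(j < 3) [:: expR (w1 * t); expR (w2 * t); expR (- t)]`_j).

Lemma det_flow_mx (R : realType) (w1 w2 t : R) :
  w1 + w2 = 1 -> \det (flow_mx w1 w2 t) = 1.
Proof.
move=> hw; rewrite det_diag !big_ord_recl big_ord0 !mxE /= mulr1 -!expRD.
by rewrite addrA -mulrDl hw mul1r subrr expR0.
Qed.

Definition flow (R : realType) (w1 w2 : R) (hw : w1 + w2 = 1) (t : R) : SL3 R :=
  mk_SL3 (det_flow_mx t hw).

Definition horo_mx (R : realType) (x : 'cV[R]_2) : 'M[R]_3 :=
  block_mx (1%:M : 'M[R]_2) x 0 (1%:M : 'M[R]_1).

Lemma det_horo_mx (R : realType) (x : 'cV[R]_2) : \det (horo_mx x) = 1.
Proof. by rewrite /horo_mx (@det_ublock _ 2 1) !det1 mulr1. Qed.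

Definition horo (R : realType) (x : 'cV[R]_2) : SL3 R :=
  mk_SL3 (det_horo_mx x).

Definition divergent (R : realType) (a : R -> SL3 R) (L : lattice R) : Prop :=
  forall K : set (lattice R), compact K ->
    exists2 T0 : R, 0 < T0 &
      forall t : R, T0 <= t -> ~ K (lattice_act (a t) L).

(* The library norm on matrices is the sup norm. *)
Definition euclid_dist (R : realType) n (x y : 'cV[R]_n) : R :=
  Num.sqrt (\sum_(i < n) (x i 0 - y i 0) ^+ 2).

(* Adjoining 0 makes the diameter of the empty set 0 rather than -oo. *)
Definition diameter (R : realType) n (A : set 'cV[R]_n) : \bar R :=
  ereal_sup ([set 0%E] `|` [set (euclid_dist x y)%:E | x in A & y in A]).

(* The empty set has weight 0 even when [s = 0]. *)
Definition hausdorff_weight (R : realType) n (s : R) (A : set 'cV[R]_n) :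
    \bar R :=
  if A == set0 then 0%E else poweR (diameter A) s.

Definition hausdorff_premeasure (R : realType) n (s delta : R)
    (A : set 'cV[R]_n) : \bar R :=
  ereal_inf [set (\sum_(0 <= k <oo) hausdorff_weight s (F k))%E |
    F in [set F : nat -> set 'cV[R]_n |
           (forall k, (diameter (F k) <= delta%:E)%E) /\
           A `<=` \bigcup_k F k]].

Definition hausdorff_measure (R : realType) n (s : R) (A : set 'cV[R]_n) :
    \bar R :=
  ereal_sup [set hausdorff_premeasure s delta A | delta in [set d : R | 0 < d]].

Definition hausdorff_dim (R : realType) n (A : set 'cV[R]_n) : \bar R :=
  ereal_inf [set s%:E | s in [set s : R |
    0 <= s /\ hausdorff_measure s A = 0%E]].

(* Main.v *)
Require Import Defs.
From mathcomp Require Import all_boot all_order all_algebra.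
From mathcomp Require Import ring lra zify.
From mathcomp Require Import all_classical all_reals.
Set Implicit Arguments.
Unset Strict Implicit.
Unset Printing Implicit Defensive.
Import Order.TTheory GRing.Theory Num.Theory.

Local Open Scope ring_scope.

(** Write [den v] for the last coordinate of a lattice vector [v] and
    [center v] for the point [x] of the plane for which the first two
    coordinates of [h(x) v] vanish. If [x] is close to [center v],
    then [a_t h(x) v] is short for the times [t] with [e^t] above [den v] and
    not too large. So the trajectory of [x] diverges as soon as [x] lies in boxes
    around centers of lattice vectors [v_0, v_1, ...] whose windows of good
    times cover a half-line and whose lengths in these windows tend to 0
    ([boxes_divergent]); this is the easy half of Mahler's criterion
    ([compact_lattices_no_short_vector]).

    Such chains of vectors are the branches of a tree. A node is a basis
    [(vert, edge, third)] of the lattice, and carries the box of half-widths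
    [radius] around [center (vert z)]; these half-widths have order
    [1 / (M^w_i q^(1+w_i))] with [q = den (vert z)]. A child has the vertex
    [n vert + a edge + b third], of denominator between [M q] and [2 M q], and
    the edge [- vert]. In coordinates rescaled by [q^w_i] the geometry of a
    node no longer depends on [q], and the integer triples [(a, b, n)] which
    keep the box of the child inside the box of its parent fill a region of
    volume about [M^(w_2) M^(w_1) M = M^2]. The heart of the proof is
    [moves_exist]: up to powers of a slack [l] which is negligible against
    [M], there are [M^2] of them with pairwise separated boxes, and a
    horizontal strip which is as thin as a box meets at most [M^w_1] of these.
    The last property could only fail through rational coincidences among the
    scaled data of the node, and [near_rational_count] shows that these spoil
    a small proportion of the triples.

    Distribute a unit mass evenly along the tree, with [M = l^J] at a level of
    slack [l], and let [G_k] be the product of the slacks of the levels below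
    [k]. At level [k] the boxes have widths about [G_k^(-J(1+w_i))], the first
    one being the smaller. A set of diameter [d] meets one box per level until
    a level [k0] where the first width drops below [d], and then multiplies
    the number of boxes that it meets by [M^w_1] at each level until a level
    [m] where the second width drops below [d]. As a node has [M^2] children,
    the mass of the set is about [G_k0^(-J w_1) G_m^(-J(1+w_2))], which is
    [d^(w_1/(1+w_1) + 1)], up to an error in the exponent which vanishes as
    [J] grows ([mass_scale], [exponent_choice]). The exponent
    [w_1/(1+w_1) + 1] is [2 - 1/(1+w_1)].

    No measure is constructed. If the Hausdorff measure of some exponent
    [s < 2 - 1/(1+w_1)] vanished, the set would have a countable cover of
    total mass below 1; going down the tree and always choosing a child where
    the conditional total mass is not larger than average gives a branch that
    avoids every set of the cover ([branch_avoid]), whereas the nested boxes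
    of this branch contain a divergent point ([branch_point]).
    A tree inside a given open set needs a root of the right shape above it
    ([root_exists]); it is found by steering the center with a move whose
    entry [b] is a large prime, so that coprimality of [a] and [b] is free. *)

(** * Counting integer points *)

Lemma card_union_bound (T : finType) (I : Type) (P : pred T) (s : seq I)
    (Q : I -> pred T) :
  (forall x, P x -> has (fun i => Q i x) s) ->
  (#|P| <= \sum_(i <- s) #|Q i|)%N.
Proof.
move=> hP; have : (#|P| <= #|[pred x | has (fun i => Q i x) s]|)%N.
  by apply: subset_leq_card; apply/fintype.subsetP => x; rewrite !inE; exact: hP.
move=> /leq_trans; apply; elim: s {hP} => [|i s IH].
  by rewrite big_nil leqn0; apply/eqP/eq_card0.
rewrite big_cons; apply: leq_trans (leq_add (leqnn _) IH).
by rewrite -cardUI -[X in (X <= _)%N]addn0 leq_add //; apply: subset_leq_card;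
  apply/fintype.subsetP => x; rewrite !inE.
Qed.

Lemma leq_card_inj_in (T T' : finType) (f : T -> T') (P : pred T) :
  {in P &, injective f} -> (#|P| <= #|T'|)%N.
Proof. by move=> fI; rewrite -(card_in_image fI) max_card. Qed.

Lemma truncn_div (R : archiRealFieldType) (a d : nat) :
  ((a %/ d)%N%:R <= a%:R / d%:R :> R).
Proof.
have [->|d0] := posnP d; first by rewrite divn0 invr0 mulr0.
by rewrite ler_pdivlMr ?ltr0n // -natrM ler_nat leq_trunc_div.
Qed.

Lemma eq_div_mod_ord n d (i j : 'I_n) : (0 < d)%N -> (i %/ d = j %/ d)%N ->
  ((d%:Z) %| (i%:Z - j%:Z))%Z -> i = j.
Proof.
move=> d0 e dv; apply: val_inj => /=.
rewrite (divn_eq i d) (divn_eq j d) e; congr (_ + _)%N.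
have : (i%:Z = j%:Z %[mod d])%Z by apply/eqP; rewrite eqz_mod_dvd.
by rewrite !modz_nat => -[].
Qed.

(** The interval contains at most [W + 1] integers. Each of them is taken at
    most once among [r] consecutive [i], because [p] is invertible modulo [r]
    and so the value determines [i] modulo [r], and then [j]. *)
Lemma strip_count (R : realType) (A M r : nat) (p a0 : int) (n0 : 'I_A -> int)
    (x W : R) : (0 < r)%N -> coprimez p r -> 0 <= W ->
  #|[pred ij : 'I_A * 'I_M |
      x <= (p * (a0 + ij.1%:Z) - r%:Z * (n0 ij.1 + ij.2%:Z))%:~R <= x + W]|%:R
   <= (W + 1) * (A%:R / r%:R + 1).
Proof.
move=> r0 cop W0.
pose v (ij : 'I_A * 'I_M) := p * (a0 + ij.1%:Z) - r%:Z * (n0 ij.1 + ij.2%:Z).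
pose K := (Num.truncn W).+1.
pose f (ij : 'I_A * 'I_M) : 'I_K * 'I_(A %/ r).+1 :=
  (inord `|v ij - Num.ceil x|%N, inord (ij.1 %/ r)%N).
have fI : {in [pred ij : 'I_A * 'I_M | x <= (v ij)%:~R <= x + W] &, injective f}.
  have key ij : x <= (v ij)%:~R <= x + W ->
      0 <= v ij - Num.ceil x /\ (`|v ij - Num.ceil x| < K)%N.
    move=> /andP[h1 h2].
    have c : 0 <= v ij - Num.ceil x by rewrite subr_ge0 ceil_le_int.
    split=> //; rewrite /K ltnS truncn_ge_nat // natr_absz ger0_norm //.
    by rewrite intrB lerBlDr; apply: (le_trans h2); rewrite addrC lerD2l ceil_ge.
  move=> [i j] [i' j']; rewrite !inE => /key[k1 k2] /key[k3 k4] [].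
  move/(congr1 val); rewrite /= !inordK // => e1.
  move/(congr1 val); rewrite /= !inordK ?ltnS ?leq_div2r ?(ltnW (ltn_ord _)) // => e2.
  have e : v (i, j) = v (i', j') by lia.
  have ii : i = i'.
    apply: (eq_div_mod_ord r0 e2).
    rewrite -(@Gauss_dvdzr _ p) 1?coprimez_sym //.
    apply/dvdzP; exists (n0 i + j%:Z - n0 i' - j'%:Z).
    by move: e; rewrite /v /=; lia.
  subst i'; congr pair; apply: val_inj; move: e; rewrite /v /= => e.
  have : r%:Z * (j%:Z - j'%:Z) = 0 by lia.
  by move/eqP; rewrite mulf_eq0; lia.
have := leq_card_inj_in fI; rewrite card_prod !card_ord => h.
apply: (@le_trans _ _ ((K * (A %/ r).+1)%N%:R)); first by rewrite ler_nat.
rewrite natrM; apply: ler_pM => //.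
  by rewrite /K -natr1 lerD2r truncn_le.
by rewrite -natr1 lerD2r truncn_div.
Qed.

(** A union bound over the common divisors [d]: among the pairs with both
    entries divisible by [d], the positions in the two windows are determined
    by their integer parts after division by [d]. *)
Lemma coprime_count (A B : nat) (a0 : nat -> int) :
  (#|[pred x : 'I_B * 'I_A | ~~ coprimez (a0 x.1 + x.2%:Z) (x.1.+1)%:Z]|
   <= \sum_(2 <= d < B.+1) (B %/ d) * (A %/ d).+1)%N.
Proof.
pose Q d := [pred x : 'I_B * 'I_A | (d %| x.1.+1)%N &&
  (d%:Z %| (a0 x.1 + x.2%:Z))%Z].
have h : forall x : 'I_B * 'I_A, ~~ coprimez (a0 x.1 + x.2%:Z) (x.1.+1)%:Z ->
   has (fun d => Q d x) (index_iota 2 B.+1).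
  move=> [i j] /= hc; apply/hasP.
  pose d := gcdn (absz (a0 i + j%:Z)) i.+1.
  have d0 : (0 < d)%N by rewrite gcdn_gt0 orbT.
  exists d; rewrite ?mem_index_iota ?inE /=.
    have d1 : d != 1%N by move: hc; rewrite /coprimez /gcdz /= -/d; lia.
    have : (d <= i.+1)%N by apply: dvdn_leq => //; exact: dvdn_gcdr.
    by have := ltn_ord i; lia.
  by rewrite dvdn_gcdr dvdzE; exact: dvdn_gcdl.
apply: leq_trans (card_union_bound h) _.
rewrite big_seq [leqRHS]big_seq; apply: leq_sum => d; rewrite mem_index_iota => /andP[d2 dB].
have d0 : (0 < d)%N by lia.
have B0 : (0 < B %/ d)%N by rewrite divn_gt0.
have [K eK] : exists K, (B %/ d = K.+1)%N by exists (B %/ d).-1; lia.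
pose f (x : 'I_B * 'I_A) : 'I_K.+1 * 'I_(A %/ d).+1 :=
  (inord (x.1 %/ d)%N, inord (x.2 %/ d)%N).
rewrite eK -[X in (_ <= X * _)%N]card_ord -[X in (_ <= _ * X)%N]card_ord -card_prod.
apply: (@leq_card_inj_in _ _ f).
have key (i : 'I_B) : (d %| i.+1)%N -> (i %/ d < K.+1)%N.
  move=> /dvdnP[c e]; rewrite -eK.
  have ci : (c <= B %/ d)%N by rewrite leq_divRL // -e ltn_ord.
  suff : (i %/ d < c)%N by lia.
  by rewrite ltn_divLR // -e.
move=> [i j] [i' j'] /andP[/= h1 h2] /andP[/= h3 h4] [].
move/(congr1 val); rewrite /= !inordK ?key // => e1.
move/(congr1 val); rewrite /= !inordK ?ltnS ?leq_div2r ?(ltnW (ltn_ord _)) // => e2.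
have ii : i = i'.
  apply: (eq_div_mod_ord d0 e1).
  have -> : i%:Z - i'%:Z = (i.+1)%:Z - (i'.+1)%:Z :> int by rewrite -[i.+1]addn1 -[i'.+1]addn1
    !PoszD; ring.
  by rewrite rpredB.
subst i'; congr pair; apply: (eq_div_mod_ord d0 e2).
have -> : j%:Z - j'%:Z = (a0 i + j%:Z) - (a0 i + j'%:Z) :> int by ring.
by rewrite rpredB.
Qed.

(** An enumeration, by an initial segment of the naturals, of the integers
    in a real interval. *)
Lemma int_window (R : realType) (c w : R) (p : int) : 0 <= w -> `|p%:~R + c| <= w ->
  exists2 k, (k < (Num.truncn (2 * w)).+1)%N & p = Num.ceil (- c - w) + k%:Z.
Proof.
move=> w0; rewrite ler_norml => /andP[h1 h2].
have h : 0 <= p - Num.ceil (- c - w) by rewrite subr_ge0 ceil_le_int; lra.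
exists `|p - Num.ceil (- c - w)|%N; last by lia.
rewrite ltnS truncn_ge_nat ?natr_absz ?ger0_norm //; last lra.
rewrite intrB; have := ceil_ge (- c - w); lra.
Qed.

(** The inner expression is [E (p (a0 + i) - r (n0 + j))] plus a term that
    depends on [p] and [r] alone. Since [|U i| >= u], for given [r] it can be
    small for few integers [p] only, and for given [(p, r)], which may be
    assumed coprime, [strip_count] bounds the pairs [(i, j)]. *)
Lemma near_rational_count (R : realType) (A M Q : nat) (a0 : int) (n0 : 'I_A -> int)
    (E te c1 c2 u T D : R)
    (U := fun i : 'I_A => (a0 + i%:Z)%:~R * E + c1 : R)
    (m := fun (i : 'I_A) (j : 'I_M) => (n0 i + j%:Z)%:~R + (a0 + i%:Z)%:~R * te + c2 : R) :
  E != 0 -> 0 < u -> 0 <= D -> 0 <= T -> (forall i, u <= `|U i|) ->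
  (forall i j, `|m i j| <= T) ->
  #|[pred ij : 'I_A * 'I_M | `[< exists r (p : int), (0 < r < Q)%N /\
     `|U ij.1 * (p%:~R + r%:R * te) - r%:R * E * m ij.1 ij.2| <= D >]]|%:R <=
  \sum_(1 <= r < Q) (2 * ((D + r%:R * `|E| * T) / u) + 1) *
     ((2 * D / `|E| + 1) * (A%:R / r%:R + 1)).
Proof.
move=> E0 u0 D0 T0 hU hm.
have aE0 : 0 < `|E| by rewrite normr_gt0.
pose w r : R := (D + r%:R * `|E| * T) / u.
pose K r := (Num.truncn (2 * w r)).+1.
pose pp r k : int := Num.ceil (- (r%:R * te) - w r) + k%:Z.
pose c r k : R := c1 * ((pp r k)%:~R + r%:R * te) - r%:R * E * c2.
pose X r k : R := - c r k / E - D / `|E|.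
pose S r k := [pred ij : 'I_A * 'I_M | coprimez (pp r k) r%:Z && (X r k <= ((pp r k) * (a0 +
  ij.1%:Z) - r%:Z * (n0 ij.1 + ij.2%:Z))%:~R <= X r k + 2 * D / `|E|)].
pose s := [seq (r, k) | r <- index_iota 1 Q, k <- iota 0 (K r)].
have cov : forall ij : 'I_A * 'I_M, `[< exists r (p : int), (0 < r < Q)%N /\
     `|U ij.1 * (p%:~R + r%:R * te) - r%:R * E * m ij.1 ij.2| <= D >] ->
     has (fun rk => S rk.1 rk.2 ij) s.
  move=> [i j] /asboolP[r0 [p0 [/andP[r00 rQ0] /= hb0]]].
  have [r [p [[/andP[r1 rQ] hb] cop]]] : exists r (p : int), ((0 < r < Q)%N /\
     `|U i * (p%:~R + r%:R * te) - r%:R * E * m i j| <= D) /\ coprimez p r%:Z.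
    (* Dividing (p0, r0) by its gcd only decreases the expression. *)
    pose g := gcdn `|p0|%N r0.
    have g0 : (0 < g)%N by rewrite gcdn_gt0 r00 orbT.
    have /dvdnP[r er] : (g %| r0)%N by exact: dvdn_gcdr.
    have /dvdzP[p ep] : (g%:Z %| p0)%Z by rewrite dvdzE; exact: dvdn_gcdl.
    have cop : coprimez p r%:Z.
      rewrite /coprimez /gcdz /=; apply/eqP; congr Posz.
      have : g = (gcdn `|p|%N r * g)%N.
        by rewrite muln_gcdl -er -[X in gcdn (_ * X) _]absz_nat -abszM -ep.
      by rewrite -[LHS]mul1n => /eqP; rewrite eqn_pmul2r // => /eqP.
    exists r, p; split=> //; split; first by nia.
    have g1 : 1 <= g%:R :> R by rewrite ler1n.
    have : `|g%:R * (U i * (p%:~R + r%:R * te) - r%:R * E * m i j)| <= D.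
      apply: le_trans hb0; rewrite er ep natrM intrM.
      by rewrite le_eqVlt; apply/orP; left; apply/eqP; congr (`| _ |); ring.
    rewrite normrM ger0_norm ?ler0n // => h.
    by apply: le_trans h; rewrite ler_peMl.
  have rR : 1 <= r%:R :> R by rewrite ler1n.
  have hp : `|p%:~R + r%:R * te| <= w r.
    rewrite /w ler_pdivlMr //.
    apply: (@le_trans _ _ (`|U i * (p%:~R + r%:R * te)|)).
      by rewrite normrM mulrC ler_wpM2r.
    have -> : U i * (p%:~R + r%:R * te) = (U i * (p%:~R + r%:R * te) -
      r%:R * E * m i j) + r%:R * E * m i j by ring.
    apply: le_trans (ler_normD _ _) _; apply: lerD => //.
    by rewrite !normrM ger0_norm ?ler0n // ler_wpM2l // mulr_ge0.
  have w0 : 0 <= w r by apply: le_trans hp.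
  have [k kK ek] := int_window w0 hp.
  apply/hasP; exists (r, k).
    by apply/allpairsPdep; exists r, k; rewrite mem_index_iota mem_iota add0n; split; rewrite ?r1.
  rewrite /= /pp -ek cop /=.
  pose z := (p * (a0 + i%:Z) - r%:Z * (n0 i + j%:Z))%:~R : R.
  have ez : U i * (p%:~R + r%:R * te) - r%:R * E * m i j = E * z + c r k.
    by rewrite /U /m /z /c /pp -ek !(intrB, intrM, intrD); ring.
  move: hb; rewrite ez => hb.
  have : `|z + c r k / E| <= D / `|E|.
    rewrite ler_pdivlMr // -normrM; apply: le_trans hb.
    rewrite le_eqVlt; apply/orP; left; apply/eqP; congr (`| _ |).
    by field.
  rewrite ler_norml -/z /X mulNr => /andP[h1 h2].
  set q := D / _ in h1 h2 *.
  have -> : 2 * D / `|E| = 2 * q by rewrite /q mulrA.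
  by apply/andP; split; lra.
have /= h := card_union_bound cov.
apply: (@le_trans _ _ ((\sum_(i <- s) #|S i.1 i.2|)%:R)); first by rewrite ler_nat.
rewrite natr_sum /s big_allpairs_dep /= big_seq [X in _ <= X]big_seq.
apply: ler_sum => r; rewrite mem_index_iota => /andP[r1 rQ].
have W0 : 0 <= 2 * D / `|E| by rewrite divr_ge0 ?mulr_ge0.
have w0 : 0 <= w r by rewrite divr_ge0 ?addr_ge0 ?mulr_ge0 // ltW.
apply: (@le_trans _ _ (\sum_(k <- iota 0 (K r)) ((2 * D / `|E| + 1) * (A%:R / r%:R + 1)))).
  apply: ler_sum => k _.
  have [cop|ncop] := boolP (coprimez (pp r k) r%:Z); last first.
    rewrite eq_card0; first by rewrite mulr_ge0 ?addr_ge0 ?divr_ge0 // mulr_ge0.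
    by move=> ij; rewrite !inE (negbTE ncop).
  have := strip_count M a0 n0 (X r k) r1 cop W0.
  by apply: le_trans; rewrite ler_nat; apply: subset_leq_card; apply/fintype.subsetP => ij;
    rewrite !inE => /andP[].
rewrite big_const_seq count_predT size_iota iter_addr addr0 -[X in X <= _]mulr_natl.
have W1 : 0 <= 2 * D / `|E| + 1 by apply: addr_ge0.
have A1 : 0 <= A%:R / r%:R + 1 :> R by rewrite addr_ge0 ?divr_ge0.
rewrite ler_wpM2r ?(mulr_ge0 W1 A1) //.
by rewrite /K -natr1 lerD2r truncn_le // mulr_ge0.
Qed.

(** * Choosing the children of a node *)

(** The triple [((a, b), n)] stands for the vector
    [n vert + a edge + b third]. *)
Definition move := ((int * int) * int)%type.

Definition lin (R : realType) (E F : R) (t : move) : R :=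
  t.1.1%:~R * E + t.1.2%:~R * F.
Definition ratio (R : realType) (te tf : R) (t : move) : R :=
  t.2%:~R + t.1.1%:~R * te + t.1.2%:~R * tf.

Lemma int_norm_lt1 (R : realType) (z : int) : `|z%:~R : R| < 1 -> z = 0.
Proof. by rewrite -intr_norm ltrz1; lia. Qed.

Lemma truncn_half (R : realType) (x : R) : 1 <= x ->
  [/\ (0 < Num.truncn x)%N, (Num.truncn x)%:R <= x & x <= 2 * (Num.truncn x)%:R].
Proof.
move=> x1; have t0 : (0 < Num.truncn x)%N by rewrite truncn_gt0.
split=> //; first by rewrite truncn_le; lra.
have := truncnS_gt x; rewrite -natr1 => h.
have : 1 <= (Num.truncn x)%:R :> R by rewrite ler1n.
lra.
Qed.

Lemma ceil_lt_add1 (R : realType) (x : R) : (Num.ceil x)%:~R < x + 1.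
Proof. by rewrite -ltrBlDr; have := ceilB1_lt x; rewrite intrB. Qed.

Lemma small_num (R : realType) : 24 * 1 * (64^-1 + 64^-1) < 1 :> R.
Proof. lra. Qed.

Lemma card_fibre (T1 T2 : finType) (P : pred (T1 * T2)) :
  #|P| = (\sum_(k : T1) #|[pred y | P (k, y)]|)%N.
Proof.
rewrite -sum1_card (eq_bigr (fun k => \sum_(y | P (k, y)) 1)%N) => [|k _].
  by rewrite pair_big_dep /=; apply: eq_bigl => -[].
by rewrite -sum1_card.
Qed.

Lemma card_ord_small n m : (#|[pred k : 'I_n | (k < m)%N]| <= m)%N.
Proof.
case: m => [|m]; first by rewrite eq_card0.
rewrite -[X in (_ <= X)%N]card_ord.
apply: (@leq_card_inj_in _ _ (fun k : 'I_n => inord k : 'I_m.+1)) => i j.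
by rewrite !inE => hi hj /(congr1 val); rewrite /= !inordK // => /val_inj.
Qed.

(** The share of the pairs lost to a common factor; what matters is that it
    stays away from 1. *)
Lemma sum_inv_sq (R : realType) n :
  \sum_(2 <= d < n.+1) (d%:R ^+ 2)^-1 <= 3 / 4 :> R.
Proof.
suff : forall m, \sum_(2 <= d < m.+3) (d%:R ^+ 2)^-1 <= 3 / 4 - (m.+2%:R)^-1 :> R.
  case: n => [|[|n]]; [by move=> _; rewrite big_geq //; lra | by move=> _;
    rewrite big_geq //; lra |].
  by move/(_ n)/le_trans; apply; rewrite gerBl invr_ge0.
elim=> [|{}n IH]; first by rewrite big_nat1; lra.
rewrite big_nat_recr //=; apply: le_trans (lerD IH (lexx _)) _.
have n0 : 0 < n.+2%:R :> R by [].
rewrite -[n.+3%:R]natr1; move: (n.+2%:R) n0 => x x0.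
have y0 : 0 < x + 1 by lra.
have h : ((x + 1) ^+ 2)^-1 <= x^-1 - (x + 1)^-1.
  have -> : x^-1 - (x + 1)^-1 = (x * (x + 1))^-1 by field; rewrite !gt_eqF.
  by rewrite lef_pV2 ?posrE ?exprn_gt0 ?mulr_gt0 // expr2 ler_wpM2r ?(ltW y0) //; lra.
by move: ((x + 1)^-1) (x^-1) (((x + 1) ^+ 2)^-1) h => *; lra.
Qed.

(** Bounds the number of integers [p] in [near_rational_count], with its
    parameters specialised as in [degenerate_fibre] below. *)
Lemma arith_window (R : realType) (r P2 P1 l sg E : R) : 1 <= r -> 1 <= P2 -> 0 < P1 ->
  64 <= l -> 1 <= l * sg -> 0 < sg -> 0 <= E <= 1 ->
  2 * ((48 * sg * P1 / P2 + r * E * (2 * (P1 * P2))) / (sg * P1 / 512)) + 1 <= r * P2 * l ^+ 4.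
Proof.
move=> r1 P21 P10 l64 lsg sg0 /andP[E0 E1].
have P20 : 0 < P2 by lra.
have l0 : 0 < l by lra.
have -> : (48 * sg * P1 / P2 + r * E * (2 * (P1 * P2))) / (sg * P1 / 512) =
  48 * 512 / P2 + 1024 * (r * P2) * (E / sg) by field; rewrite !gt_eqF.
have rP : 1 <= r * P2 by rewrite mulr_ege1.
have h1 : 48 * 512 / P2 <= 48 * 512 by rewrite ler_pdivrMr // ler_peMr // mulr_ge0.
have h2 : E / sg <= l by rewrite ler_pdivrMr //; apply: le_trans lsg.
have h3 : 1024 * (r * P2) * (E / sg) <= 1024 * (r * P2) * l.
  by apply: ler_wpM2l => //; rewrite mulr_ge0 // (le_trans _ rP).
have t1 : 64 <= r * P2 * l by apply: le_trans l64 _; rewrite ler_peMl ?(ltW l0).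
have l3 : 64 * 64 * 64 <= l ^+ 3.
  have -> : l ^+ 3 = l * l * l by ring.
  by apply: ler_pM => //; [rewrite mulr_ge0 | apply: ler_pM].
have -> : r * P2 * l ^+ 4 = r * P2 * l * l ^+ 3 by ring.
apply: (@le_trans _ _ (r * P2 * l * (64 * 64 * 64))); last by apply: ler_wpM2l => //;
  apply: le_trans t1.
rewrite -[1024 * (r * P2) * l]mulrA in h3.
move: (r * P2 * l) (48 * 512 / P2) (1024 * (r * P2) * (E / sg)) t1 h1 h3 => t u v; lra.
Qed.

(** With [b] between [B / 16] and [B], the main term of the second coordinate
    dominates its error [y]. *)
Lemma arith_lin2 (R : realType) (X b B y : R) : 64 * 64 * y <= X -> B * 8 <= X ->
  X <= 16 * B -> B <= 16 * b -> b <= B -> X / 512 <= b - y /\ b + y <= X / 4.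
Proof. by move=> *; split; lra. Qed.

(** Bounds the number of values taken in the strip in [near_rational_count]
    by [l^3] times the ratio of the two scales. *)
Lemma arith_strip (R : realType) (P2 P1 l sg s E : R) : P2 <= P1 -> 0 < P2 ->
  64 <= l -> 0 < sg -> sg <= s -> 0 < E -> s <= 2 * 512 * E ->
  2 * (48 * sg * P1 / P2) / E + 1 <= l ^+ 3 * (P1 / P2).
Proof.
move=> P21 P20 l64 sg0 sgs E0 sE.
have w1 : 1 <= P1 / P2 by rewrite ler_pdivlMr ?mul1r.
have e : sg / E <= 2 * 512 by rewrite ler_pdivrMr // (le_trans sgs).
have -> : 2 * (48 * sg * P1 / P2) / E = 2 * 48 * (P1 / P2) * (sg / E).
  by field; rewrite !gt_eqF.
have h : (P1 / P2) * (sg / E) <= (P1 / P2) * (2 * 512).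
  by apply: ler_wpM2l => //; apply: le_trans w1.
have l3 : 64 * 64 * 64 <= l ^+ 3.
  have -> : l ^+ 3 = l * l * l by ring.
  by apply: ler_pM => //; [rewrite mulr_ge0 | apply: ler_pM].
apply: (@le_trans _ _ (64 * 64 * 64 * (P1 / P2))); last first.
  by apply: ler_wpM2r => //; apply: le_trans w1.
rewrite -[2 * 48 * _ * _]mulrA; move: h w1.
by move: ((P1 / P2) * (sg / E)) (P1 / P2) => x y; lra.
Qed.

Section Step.
Variables (R : realType) (P1 P2 l s sg E1 E2 F1 F2 te tf : R) (M : nat).
Hypothesis PM : P1 * P2 = M%:R.
Hypothesis l64 : 64 <= l.
Hypothesis P2l : l ^+ 20 <= P2.
Hypothesis P12 : l ^+ 2 * P2 <= P1.
Hypothesis sg_l : 1 <= l * sg.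
Hypothesis sg_s : sg <= s.
Hypothesis s1 : s <= 1.
Hypothesis E1l : s <= 4 * E1.
Hypothesis E1u : E1 <= s.
Hypothesis E2l : s <= 2 * 512 * `|E2|.
Hypothesis E2u : `|E2| <= s.
Hypothesis harm : forall n : nat, n%:R <= P1 ->
  \sum_(2 <= d < n.+1) (d%:R)^-1 <= l ^+ 2.
Hypothesis detEF : `|E1 * F2 - E2 * F1| = 1.

(** The condition for the child to be a well-shaped node with its box inside
    the box of its parent. Here [P1] and [P2] stand for [M^w_1] and [M^w_2],
    [E1, E2] and [F1, F2] are the scaled coordinates of the edge and of the
    third vector, and [te], [tf] their denominators relative to that of the
    vertex. *)
Definition good_move (t : move) :=
  [/\ coprimez t.1.1 t.1.2, (0 < t.1.2)%R,
      M%:R <= ratio te tf t <= 2 * M%:R,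
      sg * P2 / 2 <= lin E1 F1 t <= sg * P2 &
      sg * P1 / 512 <= `|lin E2 F2 t| <= sg * P1].

Let l0 : 0 < l. Proof. exact: lt_le_trans l64. Qed.
Let P20 : 0 < P2. Proof. by apply: lt_le_trans P2l; rewrite exprn_gt0. Qed.
Let P10 : 0 < P1. Proof. by apply: lt_le_trans P12; rewrite mulr_gt0 ?exprn_gt0. Qed.
Let sg0 : 0 < sg. Proof. by rewrite -(pmulr_rgt0 _ l0); apply: lt_le_trans sg_l. Qed.
Let s0 : 0 < s. Proof. exact: lt_le_trans sg_s. Qed.
Let M0 : 0 < M%:R :> R. Proof. by rewrite -PM mulr_gt0. Qed.
Let l1 : 1 <= l. Proof. by apply: le_trans l64; rewrite ler1n. Qed.
Let E10 : 0 < E1. Proof. by have := s0; have := E1l; lra. Qed.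
Let E20 : 0 < `|E2|. Proof. by have := s0; have := E2l; lra. Qed.

Let pow_l n : 1 <= l ^+ n. Proof. by rewrite exprn_ege1 ?l1. Qed.
Let pow_le n m : (n <= m)%N -> l ^+ n <= l ^+ m.
Proof. by move=> nm; apply: ler_weXn2l. Qed.

(** Two children whose boxes meet a common small set have positions
    [lin / ratio] so close that the determinant of their displacement vectors,
    which is an integer, vanishes. Coprimality then gives equal [(a, b)], and
    the first coordinate of the positions separates different [n]. *)
Lemma move_sep (t t' : move) : good_move t -> good_move t' ->
  `|lin E1 F1 t / ratio te tf t - lin E1 F1 t' / ratio te tf t'|
     <= 6 * sg / (M%:R * P1 ^+ 2) ->
  `|lin E2 F2 t / ratio te tf t - lin E2 F2 t' / ratio te tf t'|
     <= 6 * sg / (M%:R * P2 ^+ 2) ->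
  t = t'.
Proof.
move: t t' => [[a b] n] [[a' b'] n'].
rewrite /good_move /=; set m := ratio _ _ _; set m' := ratio _ _ (_, n').
set U1 := lin E1 _ _; set U2 := lin E2 _ _; set U1' := lin E1 _ (_, n');
  set U2' := lin E2 _ (_, n').
move=> [cop b0 /andP[ml mu] /andP[U1l U1u] /andP[U2l U2u]].
move=> [cop' b'0 /andP[ml' mu'] /andP[U1l' U1u'] /andP[U2l' U2u']] h1 h2.
have m0 : 0 < m by apply: lt_le_trans ml.
have m0' : 0 < m' by apply: lt_le_trans ml'.
have U10 : 0 < U1 by apply: lt_le_trans U1l; rewrite divr_gt0 ?mulr_gt0.
have U10' : 0 < U1' by apply: lt_le_trans U1l'; rewrite divr_gt0 ?mulr_gt0.
have sgle1 : sg <= 1 by apply: le_trans s1.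
have P264 : 64 <= P2.
  by apply: le_trans (le_trans l64 _) P2l; rewrite -[X in X <= _]expr1; exact: pow_le.
have P2P1 : P2 <= P1 by apply: le_trans P12; rewrite ler_peMl ?(ltW P20).
(* The determinant of the two displacement vectors, an integer up to sign. *)
have d1 : `|U1 * (U2' / m' * m') - U2 * (U1' / m' * m')| < 1.
  have -> : U1 * (U2' / m' * m') - U2 * (U1' / m' * m') =
    m * m' * (U2 / m * (U1 / m - U1' / m') - U1 / m * (U2 / m - U2' / m')).
    by field; rewrite !gt_eqF.
  set x := U1 / m - _ in h1 *; set y := U2 / m - _ in h2 *.
  have e1 : `|U1 / m| <= sg * P2 / M%:R.
    rewrite ger0_norm ?divr_ge0 ?(ltW m0) ?(ltW U10) //.
    by apply: ler_pM; rewrite ?(ltW U10) ?invr_ge0 ?(ltW m0) // lef_pV2 ?posrE.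
  have e2 : `|U2 / m| <= sg * P1 / M%:R.
    rewrite normrM normfV (gtr0_norm m0).
    by apply: ler_pM; rewrite ?invr_ge0 ?(ltW m0) // lef_pV2 ?posrE.
  have e3 : `|U2 / m * x - U1 / m * y| <=
     sg * P1 / M%:R * (6 * sg / (M%:R * P1 ^+ 2)) + sg * P2 / M%:R * (6 * sg / (M%:R * P2 ^+ 2)).
    apply: le_trans (ler_normB _ _) _; rewrite !normrM.
    by apply: lerD; apply: ler_pM; rewrite ?normr_ge0 // -?normrM.
  rewrite !normrM (gtr0_norm m0) (gtr0_norm m0').
  apply: (@le_lt_trans _ _ (2 * M%:R * (2 * M%:R) * (sg * P1 / M%:R * (6 * sg / (M%:R *
    P1 ^+ 2)) + sg * P2 / M%:R * (6 * sg / (M%:R * P2 ^+ 2))))).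
    apply: ler_pM => //; first by rewrite mulr_ge0 // ltW.
    by apply: ler_pM => //; apply: ltW.
  have -> : 2 * M%:R * (2 * M%:R) * (sg * P1 / M%:R * (6 * sg / (M%:R * P1 ^+ 2)) +
    sg * P2 / M%:R * (6 * sg / (M%:R * P2 ^+ 2))) = 24 * sg ^+ 2 * (P1^-1 + P2^-1).
    by field; rewrite !gt_eqF.
  have sq : sg ^+ 2 <= 1 by rewrite expr_le1 // ltW.
  have i2 : P2^-1 <= 64^-1 by rewrite lef_pV2 ?posrE.
  have i1 : P1^-1 <= 64^-1 by rewrite lef_pV2 ?posrE // (le_trans P264).
  have i0 : 0 <= P1^-1 + P2^-1 by rewrite addr_ge0 // invr_ge0 ltW.
  apply: (@le_lt_trans _ _ (24 * 1 * (P1^-1 + P2^-1))).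
    by rewrite ler_wpM2r // ler_wpM2l.
  by apply: (@le_lt_trans _ _ (24 * 1 * (64^-1 + 64^-1))); [apply: ler_wpM2l;
    [rewrite mulr1 ler0n | exact: lerD] | exact: small_num].
have ab : a * b' = a' * b.
  move: d1; rewrite !divfK ?gt_eqF // => d1.
  have e : U1 * U2' - U2 * U1' = (a * b' - a' * b)%:~R * (E1 * F2 - E2 * F1).
    by rewrite /U1 /U2 /U1' /U2' /lin /= intrB !intrM; ring.
  by move: d1; rewrite e normrM detEF mulr1 => /int_norm_lt1/eqP; rewrite subr_eq0 => /eqP ->.
have [ea eb] : a = a' /\ b = b'.
  have db : (b %| b')%Z.
    rewrite -(@Gauss_dvdzr _ a) 1?coprimez_sym // ab; exact: dvdz_mull.
  have db' : (b' %| b)%Z.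
    rewrite -(@Gauss_dvdzr _ a') 1?coprimez_sym // -ab; exact: dvdz_mull.
  have eb : b = b'.
    have : (`|b| = `|b'|)%N by apply/eqP; rewrite eqn_dvd -!dvdzE db db'.
    by move/(congr1 Posz); rewrite !gez0_abs ?(ltW b0) ?(ltW b'0).
  split=> //; move: ab; rewrite eb => /eqP; rewrite -subr_eq0 -mulrBl mulf_eq0.
  by rewrite (gt_eqF b'0) orbF subr_eq0 => /eqP.
subst a' b'.
have eU : U1' = U1 by [].
congr (_, _).
have : `|(n' - n)%:~R| < 1 :> R.
  have -> : (n' - n)%:~R = (U1 / m - U1' / m') * (m * m') / U1.
    have -> : (n' - n)%:~R = m' - m :> R by rewrite /m /m' /ratio /= intrB; ring.
    by rewrite eU; field; rewrite !gt_eqF.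
  rewrite !normrM normfV (gtr0_norm m0) (gtr0_norm m0') (gtr0_norm U10).
  apply: (@le_lt_trans _ _ (6 * sg / (M%:R * P1 ^+ 2) * (2 * M%:R * (2 * M%:R)) / (sg * P2 / 2))).
    apply: ler_pM; rewrite ?invr_ge0 ?mulr_ge0 ?(ltW m0) ?(ltW m0') ?(ltW U10) //.
      apply: ler_pM; rewrite ?mulr_ge0 ?(ltW m0) ?(ltW m0') //.
      by apply: ler_pM => //; apply: ltW.
    by rewrite lef_pV2 ?posrE // divr_gt0 ?mulr_gt0.
  have -> : 6 * sg / (M%:R * P1 ^+ 2) * (2 * M%:R * (2 * M%:R)) / (sg * P2 / 2) = 48 / P1.
    by rewrite -PM; field; rewrite !gt_eqF.
  by rewrite ltr_pdivrMr // mul1r; apply: lt_le_trans P2P1; apply: lt_le_trans P264;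
    rewrite ltr_nat.
by move/int_norm_lt1 /eqP; rewrite subr_eq0 => /eqP.
Qed.

Let P2P1 : 64 * 64 * P2 <= P1.
Proof.
apply: le_trans P12; rewrite ler_wpM2r ?(ltW P20) //.
by rewrite expr2; apply: ler_pM.
Qed.
Let pow_P2 n : (n <= 20)%N -> l ^+ n <= P2.
Proof. by move=> h; apply: le_trans P2l; exact: pow_le. Qed.

(** [B] is the number of values of [b], [A] that of [a] for given [b], and [M]
    that of [n] for given [a] and [b]. [Q] is the gap in [a] forced between
    two moves with the same [b] in the same thin strip. *)
Let A := Num.truncn (sg * P2 / (2 * s)).
Let B := Num.truncn (sg * P1 * s / 8).
Let Q := Num.truncn (P2 / l ^+ 8).

Let A_spec : [/\ (0 < A)%N, A%:R * (2 * s) <= sg * P2, P2 <= 4 * l * A%:R & A%:R <= P2].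
Proof.
have h : P2 / (2 * l) <= sg * P2 / (2 * s).
  rewrite ler_pdivrMr ?mulr_gt0 // mulrAC ler_pdivlMr ?mulr_gt0 //.
  have -> : P2 * (2 * s) = (2 * P2) * s by ring.
  have -> : sg * P2 * (2 * l) = (2 * P2) * (l * sg) by ring.
  by rewrite ler_wpM2l ?mulr_ge0 ?(ltW P20) // (le_trans s1).
have h1 : 1 <= P2 / (2 * l).
  rewrite ler_pdivlMr ?mulr_gt0 // mul1r; apply: le_trans (pow_P2 (isT : 2 <= 20)%N).
  by rewrite expr2 ler_wpM2r ?(ltW l0) // (le_trans _ l64) // ler_nat.
have [a0 a1 a2] := truncn_half (le_trans h1 h); rewrite -/A in a0 a1 a2.
split=> //.
- by rewrite -ler_pdivlMr ?mulr_gt0.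
- have := le_trans h a2; rewrite ler_pdivrMr ?mulr_gt0 // => h2.
  by apply: le_trans h2 _; rewrite le_eqVlt; apply/orP; left; apply/eqP; ring.
- apply: le_trans a1 _; rewrite ler_pdivrMr ?mulr_gt0 // mulrC ler_wpM2l ?(ltW P20) //.
  by apply: le_trans sg_s _; rewrite ler_peMl ?(ltW s0) // ler1n.
Qed.

Let B_spec : [/\ (0 < B)%N, B%:R * 8 <= sg * P1 * s, sg * P1 * s <= 16 * B%:R,
  P1 <= 16 * l ^+ 2 * B%:R & B%:R <= P1].
Proof.
have sgs : 1 <= l ^+ 2 * (sg * s).
  have -> : l ^+ 2 * (sg * s) = (l * sg) * (l * s) by ring.
  by rewrite mulr_ege1 // (le_trans sg_l) // ler_wpM2l ?(ltW l0).
have h : P1 / (8 * l ^+ 2) <= sg * P1 * s / 8.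
  rewrite ler_pdivrMr ?mulr_gt0 ?exprn_gt0 // mulrAC ler_pdivlMr //.
  have -> : sg * P1 * s * (8 * l ^+ 2) = (P1 * 8) * (l ^+ 2 * (sg * s)) by ring.
  by rewrite ler_peMr // mulr_ge0 ?(ltW P10).
have h1 : 1 <= P1 / (8 * l ^+ 2).
  rewrite ler_pdivlMr ?mulr_gt0 ?exprn_gt0 // mul1r; apply: le_trans P12; rewrite mulrC.
  rewrite ler_wpM2l ?exprn_ge0 ?(ltW l0) //; apply: le_trans (pow_P2 (isT : 1 <= 20)%N).
  by rewrite expr1 (le_trans _ l64) // ler_nat.
have [b0 b1 b2] := truncn_half (le_trans h1 h); rewrite -/B in b0 b1 b2.
split=> //.
- by rewrite -ler_pdivlMr.
- by move: b2; rewrite ler_pdivrMr // => b2; apply: le_trans b2 _; rewrite le_eqVlt;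
  apply/orP; left; apply/eqP; ring.
- have := le_trans h b2; rewrite ler_pdivrMr ?mulr_gt0 ?exprn_gt0 // => h2.
  by apply: le_trans h2 _; rewrite le_eqVlt; apply/orP; left; apply/eqP; ring.
- apply: le_trans b1 _; rewrite ler_pdivrMr // mulrC mulrA [P1 * 8]mulrC ler_wpM2r ?(ltW P10) //.
  apply: (@le_trans _ _ 1); last by rewrite ler1n.
  by rewrite mulr_ile1 ?(ltW s0) ?(ltW sg0) // (le_trans sg_s).
Qed.

Let Q_spec : [/\ (0 < Q)%N, Q%:R * l ^+ 8 <= P2, P2 <= 2 * l ^+ 8 * Q%:R & (Q <= A)%N].
Proof.
have h1 : 1 <= P2 / l ^+ 8 by rewrite ler_pdivlMr ?exprn_gt0 // mul1r pow_P2.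
have [q0 q1 q2] := truncn_half h1; rewrite -/Q in q0 q1 q2.
have q3 : Q%:R * l ^+ 8 <= P2 by rewrite -ler_pdivlMr ?exprn_gt0.
split=> //.
- move: q2; rewrite ler_pdivrMr ?exprn_gt0 // => q2.
  by apply: le_trans q2 _; rewrite le_eqVlt; apply/orP; left; apply/eqP; ring.
- have [_ _ hA _] := A_spec.
  rewrite -(@ler_nat R) -(@ler_pM2r _ (4 * l)) ?mulr_gt0 // [A%:R * _]mulrC.
  apply: le_trans hA; apply: le_trans q3; rewrite ler_wpM2l //.
  apply: (@le_trans _ _ (l ^+ 2)); last exact: pow_le.
  by rewrite expr2 ler_wpM2r ?(ltW l0) // (le_trans _ l64) // ler_nat.
Qed.

Let a0 (k : nat) : int := Num.ceil ((sg * P2 / 2 - k.+1%:R * F1) / E1).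
Let n0 (k : nat) (i : nat) : int :=
  Num.ceil (M%:R - (a0 k + i%:Z)%:~R * te - k.+1%:R * tf).
Let T := ('I_B * ('I_A * 'I_M))%type.
(** The parametrisation of the moves: [b = k + 1], and the ranges of [a] and
    then of [n] are shifted so that the first coordinate and the ratio fall in
    the windows of [good_move]. *)
Let tr (x : T) : move :=
  ((a0 x.1 + x.2.1%:Z, (x.1.+1)%:Z), n0 x.1 x.2.1 + x.2.2%:Z).

Let tr_inj : injective tr.
Proof.
move=> [k [i j]] [k' [i' j']]; rewrite /tr /= => -[e1 e2 e3].
have ek : k = k' by apply: val_inj.
subst k'; move: e1 => /addrI[] /val_inj ei; subst i'.
by move: e3 => /addrI[] /val_inj ->.
Qed.

Let tr_ratio x : M%:R <= ratio te tf (tr x) <= 2 * M%:R.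
Proof.
move: x => [k [i j]]; rewrite /ratio /tr /=.
set n := n0 k i; set a := (a0 k + i%:Z)%:~R : R.
have jM : j%:R + 1 <= M%:R :> R by rewrite natr1 ler_nat.
have j0 : 0 <= j%:R :> R by [].
have e1 : M%:R - a * te - k.+1%:R * tf <= n%:~R by exact: ceil_ge.
have e2 : n%:~R < M%:R - a * te - k.+1%:R * tf + 1.
  by have := ceil_lt_add1 (M%:R - a * te - k.+1%:R * tf).
have -> : (n + j%:Z)%:~R = n%:~R + j%:R :> R by rewrite intrD.
rewrite -pmulrn; move: jM j0 e1 e2.
by move: (n%:~R) (M%:R) (j%:R) (a * te) (_ * tf) => *; apply/andP; split; lra.
Qed.

Let tr_lin1 x : sg * P2 / 2 <= lin E1 F1 (tr x) <= sg * P2.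
Proof.
move: x => [k [i j]]; rewrite /lin /tr /= -pmulrn intrD -pmulrn.
have [_ hA _ _] := A_spec.
have hA2 : 2 * (A%:R * s) <= sg * P2 by rewrite mulrCA.
have iA : i%:R + 1 <= A%:R :> R by rewrite natr1 ler_nat.
set c := sg * P2 / 2 - k.+1%:R * F1.
have e1 : c <= (a0 k)%:~R * E1 by rewrite -ler_pdivrMr // ceil_ge.
have e2 : (a0 k)%:~R * E1 <= c + E1.
  rewrite -[leRHS](divfK (lt0r_neq0 E10)) ler_wpM2r ?(ltW E10) //.
  by rewrite mulrDl divff ?gt_eqF // ltW // ceil_lt_add1.
have e3 : (i%:R + 1) * E1 <= A%:R * s by apply: ler_pM => //; rewrite ?addr_ge0 ?(ltW E10).
have e4 : 0 <= i%:R * E1 by rewrite mulr_ge0 ?(ltW E10).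
rewrite mulrDl; rewrite mulrDl mul1r in e3; rewrite /c in e1 e2.
move: (A%:R * s) (i%:R * E1) ((a0 k)%:~R * E1) (k.+1%:R * F1) (sg * P2) hA2 e1 e2 e3 e4.
move=> As *; apply/andP; split; lra.
Qed.

(** Solving the two linear forms for [b], the second coordinate is
    proportional to [b] up to a smaller term; so [b] must not be small. *)
Let tr_lin2 (x : T) : (B <= 16 * x.1.+1)%N ->
  sg * P1 / 512 <= `|lin E2 F2 (tr x)| <= sg * P1.
Proof.
move=> hB; have := tr_lin1 x; case: x hB => [k [i j]] /= hB; set t := tr _.
set U1 := lin E1 F1 t; set U2 := lin E2 F2 t => /andP[l1' u1'].
have e : U2 * E1 = E2 * U1 + k.+1%:R * (E1 * F2 - E2 * F1).
  by rewrite /U2 /U1 /lin /t /tr /= -!pmulrn; ring.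
have U10 : 0 <= U1 by apply: le_trans l1'; rewrite divr_ge0 // mulr_ge0 // ltW.
have [_ b1 b2 _ _] := B_spec.
have hB' : B%:R <= 16 * k.+1%:R :> R by rewrite -natrM ler_nat.
have kB : k.+1%:R <= B%:R :> R by rewrite ler_nat.
have hy : 64 * 64 * (s * (sg * P2)) <= sg * P1 * s.
  have -> : 64 * 64 * (s * (sg * P2)) = sg * s * (64 * 64 * P2) by ring.
  have -> : sg * P1 * s = sg * s * P1 by ring.
  by rewrite ler_wpM2l // mulr_ge0 // ltW.
have [c1 c2] := arith_lin2 hy b1 b2 hB' kB.
have n1 : `|E2 * U1| <= s * (sg * P2).
  by rewrite normrM (ger0_norm U10); apply: ler_pM.
have n2 : `|k.+1%:R * (E1 * F2 - E2 * F1)| = k.+1%:R by rewrite normrM detEF mulr1 ger0_norm.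
have n3 : `|U2| * E1 = `|U2 * E1| by rewrite normrM (gtr0_norm E10).
apply/andP; split; rewrite -(ler_pM2r E10) n3 e.
  apply: (@le_trans _ _ (k.+1%:R - s * (sg * P2))).
    apply: le_trans c1; rewrite mulrAC ler_wpM2r ?invr_ge0 // ler_wpM2l //.
    by rewrite mulr_ge0 // ltW.
  have := lerB_normD (k.+1%:R * (E1 * F2 - E2 * F1)) (E2 * U1).
  by rewrite n2 [X in _ <= `|X| -> _]addrC; apply: le_trans; rewrite lerB.
apply: (@le_trans _ _ (k.+1%:R + s * (sg * P2))).
  by rewrite addrC; apply: le_trans (ler_normD _ _) _; rewrite n2 lerD.
apply: le_trans c2 _; rewrite ler_pdivrMr //.
have -> : sg * P1 * E1 * 4 = sg * P1 * (4 * E1) by ring.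
by rewrite ler_wpM2l // mulr_ge0 // ltW.
Qed.

Let D := 48 * sg * P1 / P2.
(** The moves that could have a companion with the same [b] in the same thin
    strip, at distance [r < Q] in [a] and [p] in [n]. *)
Let degenerate (t : move) : bool := `[< exists r (p : int), (0 < r < Q)%N /\
  `|lin E2 F2 t * (p%:~R + r%:R * te) - r%:R * E2 * ratio te tf t| <= D >].

(** Degenerate moves are rare for each [b], by [near_rational_count]. The
    power of [l] in the definition of [Q] absorbs all the losses. *)
Let degenerate_fibre (k : 'I_B) : (B <= 16 * k.+1)%N ->
  32 * #|[pred y : 'I_A * 'I_M | degenerate (tr (k, y))]|%:R <= A%:R * M%:R :> R.
Proof.
move=> hk.
have u0 : 0 < sg * P1 / 512 by rewrite divr_gt0 ?mulr_gt0.
have D0 : 0 <= D by rewrite divr_ge0 ?(ltW P20) // !mulr_ge0 ?(ltW P10) ?(ltW sg0).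
have h := @near_rational_count R A M Q (a0 k) (fun i => n0 k i) E2 te (k.+1%:R * F2)
  (k.+1%:R * tf) (sg * P1 / 512) (2 * M%:R) D.
have {h} h : #|[pred y : 'I_A * 'I_M | degenerate (tr (k, y))]|%:R <= \sum_(1 <= r < Q)
   (2 * ((D + r%:R * `|E2| * (2 * M%:R)) / (sg * P1 / 512)) + 1) *
     ((2 * D / `|E2| + 1) * (A%:R / r%:R + 1)).
  apply: h => //; first by rewrite -normr_gt0.
  - by rewrite mulr_ge0 ?(ltW M0).
  - move=> i; have M0' : (0 < M)%N by rewrite -(@ltr_nat R).
    by have /andP[] := @tr_lin2 (k, (i, Ordinal M0')) hk.
  - move=> i j; have /andP[h1 h2] := tr_ratio (k, (i, j)).
    by rewrite ger0_norm //; apply: le_trans h1; exact: ltW.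
have [Apos _ _ _] := A_spec.
have [_ Ql _ QA] := Q_spec.
have hr r : (1 <= r < Q)%N -> (2 * ((D + r%:R * `|E2| * (2 * M%:R)) / (sg * P1 / 512)) + 1) *
     ((2 * D / `|E2| + 1) * (A%:R / r%:R + 1)) <= 2 * l ^+ 7 * P1 * A%:R.
  move=> /andP[r1 rQ].
  have rR : 1 <= r%:R :> R by rewrite ler1n.
  have r0 : 0 < r%:R :> R by rewrite ltr0n.
  have f1 := arith_window rR (pow_P2 (isT : 0 <= 20)%N) P10 l64 sg_l sg0.
  have {}f1 := f1 `|E2|; rewrite normr_ge0 (le_trans E2u s1) PM in f1.
  have {}f1 := f1 isT; rewrite -/D in f1.
  have P2P1' : P2 <= P1.
    by apply: le_trans P2P1; rewrite ler_peMl ?(ltW P20) // mulr_ege1 // ler1n.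
  have f2 := arith_strip P2P1' P20 l64 sg0 sg_s E20 E2l; rewrite -/D in f2.
  have x1 : 1 <= A%:R / r%:R :> R.
    rewrite ler_pdivlMr // mul1r ler_nat.
    by apply: leq_trans QA; exact: ltnW.
  have f3 : A%:R / r%:R + 1 <= 2 * (A%:R / r%:R) :> R.
    by move: (A%:R / r%:R : R) x1 => x; lra.
  have g1 : 0 <= 2 * ((D + r%:R * `|E2| * (2 * M%:R)) / (sg * P1 / 512)) + 1.
    apply: addr_ge0 => //; apply: mulr_ge0 => //; apply: divr_ge0 (ltW u0).
    by apply: addr_ge0 => //; apply: mulr_ge0; [exact: mulr_ge0 | rewrite mulr_ge0].
  have g2 : 0 <= 2 * D / `|E2| + 1 by apply: addr_ge0 => //; apply: divr_ge0 => //;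
    apply: mulr_ge0.
  have g3 : 0 <= A%:R / r%:R + 1 :> R by rewrite addr_ge0 // divr_ge0.
  apply: le_trans (ler_pM g1 (mulr_ge0 g2 g3) f1 (ler_pM g2 g3 f2 f3)) _.
  rewrite le_eqVlt; apply/orP; left; apply/eqP.
  by field; rewrite !gt_eqF.
have h2 : #|[pred y : 'I_A * 'I_M | degenerate (tr (k,
  y))]|%:R <= Q%:R * (2 * l ^+ 7 * P1 * A%:R).
  apply: le_trans h _; rewrite big_nat; apply: (@le_trans _ _ (\sum_(1 <= r < Q) (2 *
    l ^+ 7 * P1 * A%:R))).
    by rewrite [leRHS]big_nat; exact: ler_sum.
  rewrite sumr_const_nat -[_ *+ _]mulr_natl ler_wpM2r ?ler_nat ?leq_subr //.
  by rewrite !mulr_ge0 ?exprn_ge0 ?(ltW P10) ?(ltW l0).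
have h3 : Q%:R * (2 * l ^+ 7 * P1 * A%:R) * l <= 2 * A%:R * M%:R.
  have -> : Q%:R * (2 * l ^+ 7 * P1 * A%:R) * l = (Q%:R * l ^+ 8) * (2 * P1 * A%:R) by ring.
  have -> : 2 * A%:R * M%:R = P2 * (2 * P1 * A%:R) by rewrite -PM; ring.
  by rewrite ler_wpM2r // !mulr_ge0 ?(ltW P10).
have X0 : 0 <= Q%:R * (2 * l ^+ 7 * P1 * A%:R).
  by rewrite !mulr_ge0 ?exprn_ge0 ?(ltW P10) ?(ltW l0).
have h4 : Q%:R * (2 * l ^+ 7 * P1 * A%:R) * 64 <= 2 * A%:R * M%:R.
  by apply: le_trans h3; rewrite ler_wpM2l.
have {}h4 : Q%:R * (2 * l ^+ 7 * P1 * A%:R) * 64 <= 2 * (A%:R * M%:R) by rewrite [leRHS]mulrA.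
move: h2 h4.
move: (A%:R * M%:R : R) (Q%:R * (2 * l ^+ 7 * P1 * A%:R)) => x y.
by move: (#|_|%:R : R) => z; lra.
Qed.

(** The number 49/64 is 3/4 from the squares of the divisors, plus 1/64 for
    the rounding terms, which the harmonic sum controls. *)
Let noncop_card :
  64 * #|[pred x : 'I_B * 'I_A | ~~ coprimez (a0 x.1 + x.2%:Z) (x.1.+1)%:Z]|%:R
  <= 49 * (A%:R * B%:R) :> R.
Proof.
have := coprime_count A B a0; rewrite -(@ler_nat R) natr_sum => h.
have h1 : #|[pred x : 'I_B * 'I_A | ~~ coprimez (a0 x.1 + x.2%:Z) (x.1.+1)%:Z]|%:R <=
  A%:R * B%:R * (3 / 4) + B%:R * l ^+ 2.
  apply: le_trans h _.
  apply: (@le_trans _ _ (A%:R * B%:R * (\sum_(2 <= d < B.+1) (d%:R ^+ 2)^-1) +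
            B%:R * (\sum_(2 <= d < B.+1) (d%:R)^-1))).
    rewrite !big_distrr /= -big_split /= big_nat [leRHS]big_nat.
    apply: ler_sum => d /andP[d2 dB].
    have d0 : 0 < d%:R :> R by rewrite ltr0n (leq_trans _ d2).
    rewrite natrM -natr1.
    have -> : A%:R * B%:R / d%:R ^+ 2 + B%:R / d%:R = B%:R / d%:R * (A%:R / d%:R + 1) :> R.
      by field; rewrite gt_eqF.
    by apply: ler_pM => //; rewrite ?lerD2r ?truncn_div ?addr_ge0.
  have [_ _ _ _ BP] := B_spec.
  apply: lerD; rewrite ler_wpM2l ?mulr_ge0 //; first exact: sum_inv_sq.
  exact: harm.
have [_ _ hA _] := A_spec.
have h2 : 64 * l ^+ 2 <= A%:R.
  rewrite -(@ler_pM2l _ (4 * l)) ?mulr_gt0 //; apply: le_trans hA.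
  apply: le_trans (pow_P2 (isT : 5 <= 20)%N).
  have -> : l ^+ 5 = l ^+ 3 * (l * l) :> R by ring.
  have -> : 4 * l * (64 * l ^+ 2) = l ^+ 3 * (4 * 64) by ring.
  by rewrite ler_wpM2l ?exprn_ge0 ?(ltW l0) //; apply: ler_pM => //; apply: le_trans l64;
    rewrite ler_nat.
have h3 : 64 * (B%:R * l ^+ 2) <= A%:R * B%:R.
  by rewrite mulrCA mulrC ler_wpM2r.
move: h1 h3; move: (A%:R * B%:R) (B%:R * l ^+ 2) => x y; lra.
Qed.

Let good (x : T) := [&& (B <= 16 * x.1.+1)%N,
  coprimez (a0 x.1 + x.2.1%:Z) (x.1.+1)%:Z & ~~ degenerate (tr x)].

(** The excluded shares are at most 1/16 for small [b], 49/64 for common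
    factors and 1/32 for degenerate moves, which leaves more than 1/8. *)
Let good_card : A%:R * B%:R * M%:R <= 8 * #|[pred x | good x]|%:R :> R.
Proof.
pose small := [pred x : T | (16 * x.1.+1 < B)%N].
pose noncop := [pred x : T | ~~ coprimez (a0 x.1 + x.2.1%:Z) (x.1.+1)%:Z].
pose bad := [pred x : T | (B <= 16 * x.1.+1)%N && degenerate (tr x)].
have hcov : (#|{: T}| <= #|[pred x | good x]| + (#|small| + (#|noncop| + (#|bad| + 0))))%N.
  have := @card_union_bound T (pred T) predT [:: [pred x | good x] : pred T; small : pred T;
    noncop : pred T; bad : pred T] id.
  rewrite !big_cons big_nil; apply => x _.
  rewrite /= /good orbF; case: leqP => //= _.
  by case: (coprimez _ _) => //=; case: (degenerate _).
have hs : (16 * #|small| <= B * (A * M))%N.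
  have -> : #|small| = (\sum_(k < B) nat_of_bool (16 * k.+1 < B) * (A * M))%N.
    rewrite card_fibre; apply: eq_bigr => k _; rewrite /small /=.
    case: ltnP => _; last by rewrite eq_card0.
    by rewrite mul1n -[RHS](congr2 muln (card_ord A) (card_ord M)) -card_prod.
  rewrite -big_distrl /= mulnA leq_mul2r; apply/orP; right.
  have -> : (\sum_(k < B) (16 * k.+1 < B) = #|[pred k : 'I_B | (16 * k.+1 < B)%N]|)%N.
    by rewrite -sum1_card [RHS]big_mkcond; apply: eq_bigr => k _; rewrite inE; case: ifP.
  apply: (@leq_trans (16 * (B %/ 16))%N); last by rewrite mulnC leq_trunc_div.
  rewrite leq_mul2l /=; apply: leq_trans (card_ord_small B (B %/ 16)).
  apply: subset_leq_card; apply/fintype.subsetP => k; rewrite !inE => hk.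
  by rewrite leq_divRL // mulnC ltnW.
have hn : #|noncop| = (#|[pred x : 'I_B * 'I_A | ~~ coprimez (a0 x.1 +
  x.2%:Z) (x.1.+1)%:Z]| * M)%N.
  rewrite !card_fibre big_distrl /=; apply: eq_bigr => k _.
  rewrite -[X in (_ * X)%N]card_ord -cardX; apply: eq_card => -[i j].
  by rewrite !inE andbT.
have hb : 32 * #|bad|%:R <= B%:R * (A%:R * M%:R) :> R.
  rewrite card_fibre natr_sum big_distrr /=.
  apply: (@le_trans _ _ (\sum_(k < B) (A%:R * M%:R))); last first.
    by rewrite sumr_const card_ord -[leLHS]mulr_natl.
  apply: ler_sum => k _; rewrite /bad /=.
  have [hk|hk] := leqP B (16 * k.+1)%N; first exact: degenerate_fibre.
  by rewrite eq_card0 ?mulr0 ?mulr_ge0.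
have hn' := noncop_card.
move: hcov hs; rewrite -!(@ler_nat R) card_prod card_prod !card_ord !natrD !natrM => hcov hs.
have {}hn' : 64 * #|noncop|%:R <= 49 * (B%:R * (A%:R * M%:R)) :> R.
  rewrite hn natrM mulrA; apply: (@le_trans _ _ (49 * (A%:R * B%:R) * M%:R)).
    by rewrite ler_wpM2r.
  by rewrite le_eqVlt; apply/orP; left; apply/eqP; ring.
have -> : A%:R * B%:R * M%:R = B%:R * (A%:R * M%:R) :> R by ring.
have : 0 <= B%:R * (A%:R * M%:R) :> R by rewrite !mulr_ge0.
move: hcov hs hn' hb; move: (B%:R * _ : R) (#|small|%:R : R) (#|noncop|%:R : R) (#|bad|%:R : R).
by move: (#|_|%:R : R) => g y z t u *; lra.
Qed.

(** Two moves with the same [b] in the same thin strip: the difference of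
    their positions, multiplied by the ratios, is exactly the form that
    defines degeneracy. *)
Let cross (x x' : T) y : x.1 = x'.1 ->
  `|lin E2 F2 (tr x) / ratio te tf (tr x) - y| <= 6 * sg / (M%:R * P2 ^+ 2) ->
  `|lin E2 F2 (tr x') / ratio te tf (tr x') - y| <= 6 * sg / (M%:R * P2 ^+ 2) ->
  `|lin E2 F2 (tr x) * (((tr x').2 - (tr x).2)%:~R + (x'.2.1%:Z - x.2.1%:Z)%:~R * te)
     - (x'.2.1%:Z - x.2.1%:Z)%:~R * E2 * ratio te tf (tr x)| <= D.
Proof.
move: x x' => [k [i j]] [k' [i' j']] ek; have {}ek : k = k' := ek; subst k'.
set x := (k, (i, j)); set x' := (k, (i', j')) => h1 h2.
have /andP[ml mu] := tr_ratio x; have /andP[ml' mu'] := tr_ratio x'.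
set p := ((tr x').2 - (tr x).2); set r := (x'.2.1%:Z - x.2.1%:Z).
have eU : lin E2 F2 (tr x') = lin E2 F2 (tr x) + r%:~R * E2.
  by rewrite /lin /x /x' /tr /r /= !(intrD, intrB); ring.
have em : ratio te tf (tr x') = ratio te tf (tr x) + p%:~R + r%:~R * te.
  by rewrite /ratio /p /x /x' /tr /r /= !(intrD, intrB); ring.
move: eU em ml mu ml' mu' h1 h2.
set U := lin _ _ (tr x); set U' := lin _ _ (tr x'); set m := ratio _ _ (tr x);
  set m' := ratio _ _ (tr x').
move=> eU em ml mu ml' mu' h1 h2.
have m0 : 0 < m by apply: lt_le_trans ml.
have m0' : 0 < m' by apply: lt_le_trans ml'.
have -> : U * (p%:~R + r%:~R * te) - r%:~R * E2 * m = (m * m') * (U / m - U' / m').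
  have -> : (m * m') * (U / m - U' / m') = U * m' - U' * m by field; rewrite !gt_eqF.
  by rewrite eU em; ring.
rewrite normrM ger0_norm ?mulr_ge0 ?(ltW m0) ?(ltW m0') //.
have h3 : `|U / m - U' / m'| <= 2 * (6 * sg / (M%:R * P2 ^+ 2)).
  rewrite mulr_natl mulr2n -(subrK y (U / m)) -addrA; apply: le_trans (ler_normD _ _) _.
  by apply: lerD => //; rewrite distrC.
have -> : D = (2 * M%:R * (2 * M%:R)) * (2 * (6 * sg / (M%:R * P2 ^+ 2))).
  by rewrite /D -PM; field; rewrite !gt_eqF.
by apply: ler_pM => //; rewrite ?mulr_ge0 ?(ltW m0) ?(ltW m0') //; apply: ler_pM => //;
  exact: ltW.
Qed.

(** For fixed [b], moves in the strip have entries [a] at distance at least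
    [Q], since otherwise the smaller one would be degenerate; and each [a]
    occurs with one [n] only. *)
Let strip_fibre (k : 'I_B) y :
  (#|[pred z : 'I_A * 'I_M | good (k, z) &&
     (`|lin E2 F2 (tr (k, z)) / ratio te tf (tr (k, z)) - y| <= 6 * sg / (M%:R * P2 ^+ 2))%R]|
   <= (A %/ Q).+1)%N.
Proof.
have [Q0 _ _ _] := Q_spec.
rewrite -[X in (_ <= X)%N]card_ord.
apply: (@leq_card_inj_in _ _ (fun z : 'I_A * 'I_M => inord (z.1 %/ Q) : 'I_(A %/ Q).+1)).
move=> [i j] [i' j'] /andP[/= g1 h1] /andP[/= g2 h2].
move/(congr1 val); rewrite /= !inordK ?ltnS ?leq_div2r ?(ltnW (ltn_ord _)) // => e.
have sepi (a b : 'I_A) (c d : 'I_M) : (a %/ Q = b %/ Q)%N -> good (k, (a, c)) -> (a < b)%N ->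
   `|lin E2 F2 (tr (k, (a, c))) / ratio te tf (tr (k, (a,
     c))) - y| <= 6 * sg / (M%:R * P2 ^+ 2) ->
   `|lin E2 F2 (tr (k, (b, d))) / ratio te tf (tr (k, (b,
     d))) - y| <= 6 * sg / (M%:R * P2 ^+ 2) -> False.
  move=> eq /and3P[_ _ /asboolPn ng] ab ha hb; apply: ng.
  have := @cross (k, (a, c)) (k, (b, d)) y erefl ha hb; set p := (_ - _ : int) => hc.
  exists (b - a)%N, p; split; last first.
    have -> : (b - a)%:R = (b%:Z - a%:Z)%:~R :> R by rewrite subzn ?(ltnW ab).
    exact: hc.
  rewrite subn_gt0 ab /= ltn_subLR ?(ltnW ab) //.
  rewrite (divn_eq a Q) (divn_eq b Q) eq -addnA ltn_add2l.
  by apply: leq_trans (ltn_pmod b Q0) _; rewrite leq_addl.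
have ii : i = i'.
  case: (ltngtP i i') => [lt|gt|/val_inj //]; first by case: (sepi _ _ _ _ e g1 lt h1 h2).
  by case: (sepi _ _ _ _ (esym e) g2 gt h2 h1).
subst i'.
have := @cross (k, (i, j)) (k, (i, j')) y erefl h1 h2;
  rewrite subrr mul0r !addr0 mul0r mul0r subr0.
move=> hD; have /and3P[gb _ _] := g1; have /andP[lo _] := tr_lin2 gb.
have u0 : 0 < sg * P1 / 512 by rewrite divr_gt0 ?mulr_gt0.
have : `|((tr (k, (i, j'))).2 - (tr (k, (i, j))).2)%:~R : R| < 1.
  rewrite -(ltr_pM2l u0) mulr1; apply: (@le_lt_trans _ _ D).
    by apply: le_trans hD; rewrite normrM ler_wpM2r.
  rewrite /D ltr_pdivrMr // -[48 * sg * P1]mulrA [48 * _]mulrC -!(mulrA (sg * P1)).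
  rewrite ltr_pM2l ?mulr_gt0 // mulrC ltr_pdivlMr //.
  apply: lt_le_trans (pow_P2 (isT : 3 <= 20)%N).
  apply: (@lt_le_trans _ _ (64 * (64 * 64))).
    by apply: (@lt_trans _ _ (48 * (64 * 64)));
      rewrite ?ltr_pM2l ?ltr_pM2r ?mulr_gt0 ?ltr_nat // -natrM ltr_nat.
  by rewrite !exprS expr0 mulr1; apply: ler_pM => //; [rewrite mulr_ge0 | apply: ler_pM].
move/int_norm_lt1/eqP; rewrite subr_eq0 /= => /eqP/addrI[] /val_inj ->.
by [].
Qed.

(** The last clause is what makes the dimension larger than what separation
    alone would give: a strip of the height of a box in the second direction,
    where boxes are wider, contains, up to powers of [l], at most one move
    for each of the [P1] values of [b]. *)
Lemma moves_exist : exists S : seq move,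
  [/\ uniq S, M%:R ^+ 2 <= l ^+ 10 * (size S)%:R,
      (forall t, t \in S -> good_move t) &
      forall y, (count (fun t => `|lin E2 F2 t / ratio te tf t - y|
         <= 6 * sg / (M%:R * P2 ^+ 2)) S)%:R <= l ^+ 10 * P1].
Proof.
exists [seq tr x | x <- enum [pred x | good x]].
have [A0 _ A1 A2] := A_spec; have [_ _ _ B1 B2] := B_spec.
have [Q0 _ Q1 QA] := Q_spec.
split.
- by rewrite map_inj_uniq ?enum_uniq //; exact: tr_inj.
- rewrite size_map -cardE; have hc := good_card.
  have h1 : P1 * P2 <= 64 * l ^+ 3 * (A%:R * B%:R).
    have -> : 64 * l ^+ 3 * (A%:R * B%:R) = (16 * l ^+ 2 * B%:R) * (4 * l * A%:R) by ring.
    by apply: ler_pM => //; exact: ltW.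
  have h2 : M%:R ^+ 2 <= 64 * l ^+ 3 * (A%:R * B%:R * M%:R).
    by rewrite expr2 [leRHS]mulrA ler_wpM2r // -PM.
  apply: le_trans h2 _; apply: (@le_trans _ _ (64 * l ^+ 3 * (8 * #|[pred x | good x]|%:R))).
    by rewrite ler_wpM2l // mulr_ge0 ?exprn_ge0 ?(ltW l0).
  rewrite mulrA ler_wpM2r //; apply: (@le_trans _ _ (l ^+ 3 * (l * l))).
    have -> : 64 * l ^+ 3 * 8 = l ^+ 3 * (64 * 8) by ring.
    by rewrite ler_wpM2l ?exprn_ge0 ?(ltW l0) // ler_pM // (le_trans _ l64) // ler_nat.
  have -> : l ^+ 3 * (l * l) = l ^+ 5 by ring.
  exact: pow_le.
- move=> t /mapP[x]; rewrite mem_enum inE => /and3P[g1 g2 _] ->.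
  by split; [exact: g2 | | exact: tr_ratio | exact: tr_lin1 | exact: tr_lin2].
- move=> y; rewrite count_map.
  set P := (X in count X _).
  have -> : count P (enum [pred x | good x]) = #|[pred x | good x && P x]|.
    by rewrite -size_filter -filter_predI cardE /enum_mem; congr size; apply: eq_filter => x;
      rewrite !inE andbC.
  rewrite card_fibre natr_sum.
  apply: (@le_trans _ _ (\sum_(k < B) ((A %/ Q).+1)%:R)).
    by apply: ler_sum => k _; rewrite ler_nat; exact: strip_fibre.
  rewrite sumr_const card_ord -[leLHS]mulr_natl mulrC ler_pM //.
  have q0 : 0 < Q%:R :> R by rewrite ltr0n.
  rewrite -natr1; apply: (@le_trans _ _ (A%:R / Q%:R + 1)); first by rewrite lerD2r truncn_div.
  have h : A%:R / Q%:R <= 2 * l ^+ 8.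
    by rewrite ler_pdivrMr //; apply: le_trans A2 _.
  apply: (@le_trans _ _ (l ^+ 8 * (l * l))); last first.
    by rewrite le_eqVlt; apply/orP; left; apply/eqP; ring.
  apply: (@le_trans _ _ (2 * l ^+ 8 + l ^+ 8)); first by apply: lerD => //; exact: pow_l.
  have -> : 2 * l ^+ 8 + l ^+ 8 = l ^+ 8 * 3 by ring.
  rewrite ler_wpM2l ?exprn_ge0 ?(ltW l0) //; apply: (@le_trans _ _ l).
    by apply: le_trans l64; rewrite ler_nat.
  by rewrite ler_peMl ?(ltW l0).
Qed.
End Step.

(** * Branches of a tree that avoid a cover *)

Section Tree.
Variables (R : realType) (V : eqType) (ch : nat -> V -> seq V).
Variable valid : nat -> V -> Prop.
Hypothesis ch_size : forall k z, valid k z -> (0 < size (ch k z))%N.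
Hypothesis ch_valid : forall k z c, valid k z -> c \in ch k z -> valid k.+1 c.

(** The part of the mass of [z] that sits on the descendants [d] levels below
    which satisfy [F], when every node shares its mass equally among its
    children. *)
Fixpoint mass (F : pred V) (d k : nat) (z : V) : R :=
  if d is d'.+1 then
    (\sum_(c <- ch k z) mass F d' k.+1 c) / (size (ch k z))%:R
  else (F z)%:R.

Lemma mass_ge0 F d k z : 0 <= mass F d k z.
Proof.
elim: d k z => [|d IH] k z //=.
by rewrite divr_ge0 // sumr_ge0.
Qed.

(** The total mass of the bad sets at a node is the average of the totals at
    its children, so that some child has total at most [t]. Along the branch
    chosen in this way the set of index [i] has mass 0 or 1 at level [lev i],
    and 1 is excluded. As the sum over [i] is infinite, the invariant bounds
    all its partial sums at once. *)
Lemma branch_avoid (F : nat -> pred V) (lev : nat -> nat) (root : V) (t : R) :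
  valid 0 root -> t < 1 ->
  (forall n, \sum_(i < n) mass (F i) (lev i) 0 root <= t) ->
  exists z : nat -> V, [/\ z 0%N = root, (forall k, valid k (z k)),
    (forall k, z k.+1 \in ch k (z k)) & (forall i, ~~ F i (z (lev i)))].
Proof.
move=> vr t1 hm.
pose m i k z : R := if (k <= lev i)%N then mass (F i) (lev i - k) k z else 0.
have m0 i k z : 0 <= m i k z by rewrite /m; case: ifP => // _; exact: mass_ge0.
(* Levels beyond lev i do not count the set of index i any more. *)
pose inv k z := valid k z /\ forall n, \sum_(i < n) m i k z <= t.
have avg i k z : valid k z -> \sum_(c <- ch k z) m i k.+1 c <= (size (ch k z))%:R * m i k z.
  move=> v; rewrite /m; have [lt|ge] := ltnP k (lev i); last first.
    by rewrite big1 // mulr_ge0 //; exact: m0.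
  have -> : (k <= lev i)%N by exact: ltnW.
  rewrite -(subnSK lt) /= mulrC divfK // pnatr_eq0 -lt0n; exact: ch_size.
have step (kz : nat * V) : exists c, inv kz.1 kz.2 ->
    c \in ch kz.1 kz.2 /\ inv kz.1.+1 c.
  case: kz => k z /=; have [[v hz]|ni] := pselect (inv k z); last by exists z.
  suff [c ci hc] : exists2 c, c \in ch k z & forall n, \sum_(i < n) m i k.+1 c <= t.
    by exists c => _; do !split=> //; exact: ch_valid ci.
  apply: contrapT => nex.
  have bad c : exists n, c \in ch k z -> t < \sum_(i < n) m i k.+1 c.
    have [ci|nci] := boolP (c \in ch k z); last by exists 0%N.
    apply: contrapT => nn; apply: nex; exists c => // n.
    rewrite leNgt; apply/negP => lt; apply: nn; by exists n.
  have [nb hnb] := choice bad.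
  pose n := (\max_(c <- ch k z) nb c)%N.
  have big c : c \in ch k z -> t < \sum_(i < n) m i k.+1 c.
    move=> ci; apply: lt_le_trans (hnb c ci) _.
    have le : (nb c <= n)%N by rewrite /n; apply: leq_bigmax_seq.
    rewrite -!(big_mkord predT (fun i => m i k.+1 c)) (big_cat_nat (leq0n _) le) //=.
    by rewrite lerDl sumr_ge0.
  have sz0 : 0 < (size (ch k z))%:R :> R by rewrite ltr0n ch_size.
  have : \sum_(c <- ch k z) \sum_(i < n) m i k.+1 c <= (size (ch k z))%:R * t.
    rewrite exchange_big /=; apply: (@le_trans _ _ (\sum_(i < n) (size (ch k z))%:R * m i k z)).
      by apply: ler_sum => i _; exact: avg.
    by rewrite -big_distrr /= ler_pM2l //; exact: hz.
  apply/negP; rewrite -ltNge.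
  have -> : (size (ch k z))%:R * t = \sum_(c <- ch k z) t.
    by rewrite big_const_seq count_predT iter_addr addr0 mulr_natl.
  rewrite big_seq [ltRHS]big_seq; apply: ltr_sum => //.
  have := ch_size v; case: (ch k z) => [|c s] // _.
  by apply/hasP; exists c; rewrite inE eqxx.
have [f hf] := choice step.
pose z := fix z k := if k is k'.+1 then f (k', z k') else root.
have invz k : inv k (z k).
  elim: k => [|k IH] /=; last by have [] := hf (k, z k) IH.
  split=> // n; apply: le_trans (hm n); apply: ler_sum => i _.
  by rewrite /m /= subn0.
exists z; split=> // [k|k|i]; first by have [] := invz k.
  by have [] := hf (k, z k) (invz k).
have [_ /(_ i.+1)] := invz (lev i).
rewrite big_ord_recr /= {2}/m leqnn subnn /=; case: (F i _) => //= h.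
have : 0 <= \sum_(j < i) m j (lev i) (z (lev i)) by exact: sumr_ge0.
lra.
Qed.

(** By nesting, the nodes of level [K] that meet a set descend from nodes of
    each lower level that meet it. *)
Lemma mass_le (N : nat -> nat) (b : nat -> R) (meets : nat -> pred V) (K : nat) :
  (forall k, 0 <= b k) ->
  (forall k z, valid k z -> size (ch k z) = N k) ->
  (forall k z c, valid k z -> c \in ch k z -> meets k.+1 c -> meets k z) ->
  (forall k z, (k < K)%N -> valid k z -> (count (meets k.+1) (ch k z))%:R <= b k) ->
  forall d k z, (k + d = K)%N -> valid k z ->
  mass (meets K) d k z <= (meets k z)%:R * \prod_(k <= j < K) (b j / (N j)%:R).
Proof.
move=> b0 hN nest hc; elim=> [|d IH] k z.
  by rewrite addn0 => -> v /=; rewrite big_geq // mulr1.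
move=> kd v /=; have kK : (k < K)%N by rewrite -kd -addSnnS leq_addr.
have pr0 : 0 <= \prod_(k.+1 <= j < K) (b j / (N j)%:R) by apply: prodr_ge0 => j _;
  rewrite divr_ge0.
have h : \sum_(c <- ch k z) mass (meets K) d k.+1 c <=
    (count (meets k.+1) (ch k z))%:R * \prod_(k.+1 <= j < K) (b j / (N j)%:R).
  rewrite -sum1_count natr_sum [X in _ <= X * _]big_mkcond /= big_distrl /= big_seq
    [leRHS]big_seq.
  apply: ler_sum => c ci; apply: le_trans (IH k.+1 c _ (ch_valid v ci)) _;
    first by rewrite addSnnS.
  by case: (meets k.+1 c).
rewrite hN //; have [mz|nmz] := boolP (meets k z).
  rewrite mul1r (big_ltn kK) mulrAC.
  rewrite ler_wpM2r ?invr_ge0 //; apply: le_trans h _.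
  by rewrite ler_wpM2r // hc.
rewrite mul0r; have -> : \sum_(c <- ch k z) mass (meets K) d k.+1 c = 0; last by rewrite mul0r.
apply/eqP; rewrite eq_le sumr_ge0 ?andbT; last by move=> *; exact: mass_ge0.
apply: le_trans h _; have -> : count (meets k.+1) (ch k z) = 0%N; last by rewrite mul0r.
apply/eqP; rewrite -leqn0 leqNgt -has_count; apply/hasPn => c ci.
by apply: contra nmz; exact: nest.
Qed.
End Tree.

From mathcomp Require Import all_analysis.

(** * Lattice bases and the boxes around their rational points *)

Lemma ord2_neq0 (i : 'I_2) : i != 0 -> i = 1.
Proof. by move=> i0; apply: val_inj; case: i i0 => -[|[|]]. Qed.

Lemma forall_ord2 (P : 'I_2 -> Prop) : P 0 -> P 1 -> forall i, P i.
Proof. by move=> h0 h1 i; case: (altP (i =P 0)) => [->|/ord2_neq0 ->]. Qed.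

(** Coordinates of the plane are indexed by ['I_2], so that both weights are
    treated by one argument. *)
Definition wt (R : realType) (w1 w2 : R) (i : 'I_2) : R := if i == 0 then w1 else w2.
Definition den (R : realType) (v : 'cV[R]_3) : R := v (rshift 2 (0 : 'I_1)) 0.
Definition hor (R : realType) (v : 'cV[R]_3) (i : 'I_2) : R := v (lshift 1 i) 0.
(** The point [x] for which [h(x) v] is a multiple of the last basis
    vector. *)
Definition center (R : realType) (v : 'cV[R]_3) (i : 'I_2) : R := - hor v i / den v.

Definition node (R : realType) := ('cV[R]_3 * 'cV[R]_3 * 'cV[R]_3)%type.
Definition vert (R : realType) (z : node R) := z.1.1.
Definition edge (R : realType) (z : node R) := z.1.2.
Definition third (R : realType) (z : node R) := z.2.

(** The displacement of [u] relative to the line through [v], in the units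
    that the flow attaches to denominator [den v]. *)
Definition scaled (R : realType) (w1 w2 : R) (v u : 'cV[R]_3) (i : 'I_2) : R :=
  den v `^ wt w1 w2 i * (hor u i - hor v i * den u / den v).

(** The determinant of the matrix with columns [v], [e], [f], expanded so that
    ring identities apply to it. *)
Definition det3 (R : realType) (v e f : 'cV[R]_3) : R :=
  den v * (hor e 0 * hor f 1 - hor e 1 * hor f 0)
  - den e * (hor v 0 * hor f 1 - hor v 1 * hor f 0)
  + den f * (hor v 0 * hor e 1 - hor v 1 * hor e 0).

Definition comb (R : realType) (a b c : int) (u v w : 'cV[R]_3) : 'cV[R]_3 :=
  a%:~R *: u + b%:~R *: v + c%:~R *: w.

Definition move_vec (R : realType) (z : node R) (t : move) : 'cV[R]_3 :=
  comb t.2 t.1.1 t.1.2 (vert z) (edge z) (third z).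

(** The third vector completes the new vertex and edge to a basis, by Bezout
    coefficients for the coprime pair [(a, b)]. *)
Definition child (R : realType) (z : node R) (t : move) : node R :=
  let uv := egcdz t.1.1 t.1.2 in
  (move_vec z t, - vert z, comb 0 (- uv.2) uv.1 (vert z) (edge z) (third z)).

Lemma den_comb (R : realType) a b c (u v w : 'cV[R]_3) :
  den (comb a b c u v w) = a%:~R * den u + b%:~R * den v + c%:~R * den w.
Proof. by rewrite /den !mxE. Qed.

Lemma hor_comb (R : realType) a b c (u v w : 'cV[R]_3) i :
  hor (comb a b c u v w) i = a%:~R * hor u i + b%:~R * hor v i + c%:~R * hor w i.
Proof. by rewrite /hor !mxE. Qed.

Lemma denN (R : realType) (u : 'cV[R]_3) : den (- u) = - den u.
Proof. by rewrite /den !mxE. Qed.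

Lemma horN (R : realType) (u : 'cV[R]_3) i : hor (- u) i = - hor u i.
Proof. by rewrite /hor !mxE. Qed.

Section Geometry.
Variables (R : realType) (w1 w2 : R).
Hypothesis w12 : w1 + w2 = 1.
Implicit Types (z : node R) (t : move) (i : 'I_2).

Definition edge_sc z i := scaled w1 w2 (vert z) (edge z) i.
Definition third_sc z i := scaled w1 w2 (vert z) (third z) i.
Definition edge_den z := den (edge z) / den (vert z).
Definition third_den z := den (third z) / den (vert z).
Definition move_sc z t i := lin (edge_sc z i) (third_sc z i) t.
Definition move_den z t := ratio (edge_den z) (third_den z) t.

Lemma den_move_vec z t : den (vert z) != 0 ->
  den (move_vec z t) = den (vert z) * move_den z t.
Proof.
move=> q0; rewrite /move_vec den_comb /move_den /ratio /edge_den /third_den.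
by field.
Qed.

(** The displacement of the center depends only on the scaled data of the
    node and on the denominator of its vertex; this is why children are chosen
    by a statement on real numbers alone. *)
Lemma center_move_vec z t i : 0 < den (vert z) -> 0 < move_den z t ->
  center (move_vec z t) i = center (vert z) i -
    move_sc z t i / move_den z t / (den (vert z) * den (vert z) `^ wt w1 w2 i).
Proof.
move=> q0 m0; rewrite /center den_move_vec ?gt_eqF //.
have p0 : 0 < den (vert z) `^ wt w1 w2 i by rewrite powR_gt0.
rewrite /move_sc /lin /edge_sc /third_sc /scaled /move_vec hor_comb.
have e : t.2%:~R = move_den z t - t.1.1%:~R * edge_den z - t.1.2%:~R * third_den z.
  by rewrite /move_den /ratio; ring.
rewrite e /edge_den /third_den; move: (move_den z t) m0 => m m0.
by field; rewrite !gt_eqF.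
Qed.

(** The new edge is the old vertex, whose displacement seen from the new
    vertex is, up to the change of scale, that of the new vertex seen from the
    old one. *)
Lemma edge_sc_child z t i : 0 < den (vert z) -> 0 < move_den z t ->
  edge_sc (child z t) i = move_sc z t i * move_den z t `^ wt w1 w2 i / move_den z t.
Proof.
move=> q0 m0; rewrite /edge_sc /scaled /= den_move_vec ?gt_eqF // powRM ?ltW //.
have := center_move_vec i q0 m0; rewrite /center den_move_vec ?gt_eqF // /vert /= denN horN
  -/(vert z).
have p0 : 0 < den (vert z) `^ wt w1 w2 i by rewrite powR_gt0.
move: (move_sc z t i) (hor (move_vec z t) i) (hor (vert z) i) (den (vert z)) (move_den z t) q0 m0
  p0 => x y u q m q0 m0.
move: (m `^ _) => mw; move: (q `^ _) => qw qw0 h.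
have ey : y = (u / q + x / m / (q * qw)) * (q * m).
  have {}h : y / (q * m) = u / q + x / m / (q * qw).
    by apply: oppr_inj; rewrite -mulNr h; field; rewrite !gt_eqF.
  by rewrite -h divfK // mulf_neq0 ?gt_eqF.
by rewrite ey; field; rewrite !gt_eqF.
Qed.

Lemma det3_child z t : coprimez t.1.1 t.1.2 ->
  det3 (move_vec z t) (- vert z) (third (child z t)) = det3 (vert z) (edge z) (third z).
Proof.
move=> cop; rewrite /det3 /third /= /move_vec !den_comb !hor_comb !denN !horN.
have e : (egcdz t.1.1 t.1.2).1%:~R * t.1.1%:~R + (egcdz t.1.1 t.1.2).2%:~R * t.1.2%:~R = 1 :> R.
  rewrite -!intrM -intrD; case: egcdzP => u v /= -> _.
  by move: cop; rewrite /coprimez => /eqP ->.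
rewrite rmorphN /=; move: ((egcdz t.1.1 t.1.2).1%:~R : R) ((egcdz t.1.1 t.1.2).2%:~R : R) e => x
  y e.
move: (t.1.1%:~R : R) (t.1.2%:~R : R) e => a b e.
transitivity ((x * a + y * b) * det3 (vert z) (edge z) (third z)); last by rewrite e mul1r.
by rewrite /det3 /third; ring.
Qed.

Lemma det_edge_third_sc z : 0 < den (vert z) ->
  edge_sc z 0 * third_sc z 1 - edge_sc z 1 * third_sc z 0 = det3 (vert z) (edge z) (third z).
Proof.
move=> q0; rewrite /edge_sc /third_sc /scaled /wt /= /det3.
have e : den (vert z) `^ w1 * den (vert z) `^ w2 = den (vert z).
  by rewrite -powRD ?w12 ?powRr1 ?ltW // gt_eqF ?implybT.
set a := _ `^ w1 in e *; set b := _ `^ w2 in e *; set q := den (vert z) in e q0 *.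
transitivity (a * b * ((hor (edge z) 0 - hor (vert z) 0 * den (edge z) / q) *
  (hor (third z) 1 - hor (vert z) 1 * den (third z) / q) - (hor (edge z) 1 -
  hor (vert z) 1 * den (edge z) / q) * (hor (third z) 0 - hor (vert z) 0 * den (third z) / q))).
  by ring.
by rewrite e; field; rewrite gt_eqF.
Qed.

End Geometry.

Lemma powR_double (R : realType) (w x : R) : 0 <= w <= 1 -> 0 <= x ->
  (2 * x) `^ w <= 2 * x `^ w.
Proof.
move=> /andP[w0 w1] x0; rewrite powRM // ler_wpM2r ?powR_ge0 //.
by apply: ler1_powR => //; rewrite ler1n.
Qed.

Lemma powR_mono (R : realType) (w x y : R) : 0 <= w -> 0 <= x -> x <= y -> x `^ w <= y `^ w.
Proof. by move=> w0 x0 xy; apply: ge0_ler_powR; rewrite ?nnegrE //; exact: le_trans xy. Qed.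

Lemma count_le1 (T : eqType) (S : seq T) (P : pred T) : uniq S ->
  (forall t t', t \in S -> t' \in S -> P t -> P t' -> t = t') -> (count P S <= 1)%N.
Proof.
move=> uS h; rewrite -size_filter.
have : uniq (seq.filter P S) by exact: filter_uniq.
case e : (seq.filter P S) => [|a [|b r]] //= /andP[].
have : a \in seq.filter P S by rewrite e mem_head.
have : b \in seq.filter P S by rewrite e !inE eqxx orbT.
rewrite !mem_filter => /andP[Pb bS] /andP[Pa aS].
by rewrite (h a b) // inE eqxx.
Qed.

Lemma le_scaled_div (R : realType) (c s P X m : R) : 0 < c -> 0 <= s -> 0 < m -> m <= 2 * P ->
  s * P / c <= X -> s <= 2 * c * (X / m).
Proof.
move=> c0 s0 m0 mP h; rewrite mulrA ler_pdivlMr //.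
apply: (@le_trans _ _ (s * (2 * P))); first by rewrite ler_wpM2l.
rewrite ler_pdivrMr // in h.
have -> : s * (2 * P) = 2 * (s * P) by ring.
have -> : 2 * c * X = 2 * (X * c) by ring.
by rewrite ler_wpM2l.
Qed.

Section Nodes.
Variables (R : realType) (w1 w2 : R).
Hypothesis w12 : w1 + w2 = 1.
Hypothesis w10 : 0 < w1.
Hypothesis w20 : 0 < w2.
Variable L : set 'cV[R]_3.
Hypothesis Lcomb : forall a b c u v w, L u -> L v -> L w -> L (comb a b c u v w).
Variables (M : nat -> nat) (l s qmax : nat -> R).
Let w := wt w1 w2.
Let P k i := (M k)%:R `^ w i.
Hypothesis l64 : forall k, 64 <= l k.
Hypothesis Pl : forall k, l k ^+ 20 <= P k 1.
Hypothesis PP : forall k, l k ^+ 2 * P k 1 <= P k 0.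
Hypothesis ls : forall k, 1 <= l k * s k.+1.
Hypothesis s_dec : forall k, s k.+1 <= s k.
Hypothesis s1 : forall k, s k <= 1.
Hypothesis harm : forall k n, n%:R <= P k 0 ->
  \sum_(2 <= d < n.+1) (d%:R)^-1 <= l k ^+ 2.
Hypothesis M_inc : forall k, (M k <= M k.+1)%N.
Hypothesis qmaxS : forall k, qmax k.+1 = 2 * (M k)%:R * qmax k.

(** The edge must have scaled coordinates of order [s k] in both directions.
    The first one is kept positive, which is a choice of sign for the edge;
    the constants only need to be those that a child reproduces. *)
Definition valid k (z : node R) : Prop :=
  [/\ [/\ L (vert z), L (edge z) & L (third z)],
      [/\ 1 <= den (vert z), den (vert z) <= qmax k &
          `|det3 (vert z) (edge z) (third z)| = 1] &
      [/\ s k <= 4 * edge_sc w1 w2 z 0, edge_sc w1 w2 z 0 <= s k,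
          s k <= 2 * 512 * `|edge_sc w1 w2 z 1| & `|edge_sc w1 w2 z 1| <= s k]].

(** The size for which the scaled coordinate of [h(x) (vert z)] is at most of
    order [s k.+1] at the time when the denominator has been multiplied by
    [M k]. *)
Definition radius k (z : node R) (i : 'I_2) : R :=
  2 * s k.+1 / (((M k)%:R * den (vert z)) `^ w i * den (vert z)).
Definition in_box k z (x : 'cV[R]_2) := forall i, `|x i 0 - center (vert z) i| <= radius k z i.
(** A lower bound for [radius] that is uniform over the level, obtained from
    the largest possible denominator [qmax k]. *)
Definition min_radius k (i : 'I_2) : R :=
  2 * s k.+1 / (((M k)%:R * qmax k) `^ w i * qmax k).

Let l1 k : 1 <= l k. Proof. by apply: le_trans (l64 k); rewrite ler1n. Qed.
Let l0 k : 0 < l k. Proof. exact: lt_le_trans (l1 k). Qed.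
Let P_ge1 k : 1 <= P k 1.
Proof. by apply: le_trans (Pl k); rewrite exprn_ege1. Qed.
Let w_ge0 i : 0 <= w i. Proof. by rewrite /w /wt; case: ifP; rewrite ltW. Qed.
Let w_le1 i : w i <= 1.
Proof. by rewrite /w /wt; case: ifP => _; have := w10; have := w20; have := w12; lra. Qed.
Let M0 k : (0 < M k)%N.
Proof.
rewrite lt0n; apply/eqP => e; have := Pl k; rewrite /P /w /wt /= e powR0 ?gt_eqF //.
by apply/negP; rewrite -ltNge exprn_gt0.
Qed.
Let MR0 k : 0 < (M k)%:R :> R. Proof. by rewrite ltr0n. Qed.
Let MR1 k : 1 <= (M k)%:R :> R. Proof. by rewrite ler1n. Qed.
Let P0 k i : 0 < P k i. Proof. exact: powR_gt0. Qed.
Let PM k : P k 0 * P k 1 = (M k)%:R.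
Proof. by rewrite /P /w /wt /= -powRD ?w12 ?powRr1 // gt_eqF ?implybT. Qed.
Let s0 k : 0 < s k.+1.
Proof. by rewrite -(pmulr_rgt0 _ (l0 k)); apply: lt_le_trans (ls k). Qed.
Let M64 k : 64 <= (M k)%:R :> R.
Proof.
rewrite -PM; apply: le_trans (l64 k) _; rewrite -[leLHS]mul1r.
apply: (@le_trans _ _ (1 * P k 1)); last first.
  rewrite ler_pM2r //; apply: le_trans (PP k).
  by rewrite -[leLHS]mul1r ler_pM // exprn_ege1.
rewrite !mul1r; apply: le_trans (Pl k); rewrite -[leLHS]expr1; exact: ler_weXn2l.
Qed.

Definition allowed k z (t : move) := good_move (P k 0) (P k 1) (s k.+1)
  (edge_sc w1 w2 z 0) (edge_sc w1 w2 z 1) (third_sc w1 w2 z 0) (third_sc w1 w2 z 1) (edge_den z)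
    (third_den z) (M k) t.

Lemma valid_det k z : valid k z ->
  `|edge_sc w1 w2 z 0 * third_sc w1 w2 z 1 - edge_sc w1 w2 z 1 * third_sc w1 w2 z 0| = 1.
Proof.
move=> [_ [q1 _ d] _]; rewrite det_edge_third_sc //.
by apply: lt_le_trans q1.
Qed.

Lemma allowed_ratio k z t : allowed k z t -> (M k)%:R <= move_den z t <= 2 * (M k)%:R.
Proof. by case. Qed.

Lemma allowed_ratio_gt0 k z t : allowed k z t -> 0 < move_den z t.
Proof. by move=> /allowed_ratio /andP[h _]; apply: lt_le_trans h. Qed.

Lemma allowed_lin k z t i : allowed k z t -> `|move_sc w1 w2 z t i| <= s k.+1 * (M k)%:R / P k i.
Proof.
move=> [_ _ _ /andP[h0 h1] /andP[_ h2]]; rewrite -PM.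
case: (altP (i =P 0)) => [->|i0].
  have -> : s k.+1 * (P k 0 * P k 1) / P k 0 = s k.+1 * P k 1 by field; rewrite gt_eqF.
  rewrite ger0_norm //.
  by apply: le_trans h0; rewrite divr_ge0 // mulr_ge0 ?ltW.
rewrite (ord2_neq0 i0).
by rewrite !mulrA mulfK ?gt_eqF.
Qed.

Lemma allowed_den k z t : valid k z -> allowed k z t ->
  (M k)%:R * den (vert z) <= den (move_vec z t) <= 2 * (M k)%:R * den (vert z).
Proof.
move=> [_ [q1 _ _] _] g; have q0 : 0 < den (vert z) by apply: lt_le_trans q1.
rewrite den_move_vec ?gt_eqF //; have /andP[h1 h2] := allowed_ratio g.
by apply/andP; split; [rewrite [leLHS]mulrC | rewrite [leRHS]mulrC]; rewrite ler_pM2l.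
Qed.

(** The windows of [good_move] are chosen for this: passing to the new
    scale divides a coordinate by the ratio to the power of the other weight,
    which brings both back to order [s k.+1]. *)
Lemma valid_child k z t : valid k z -> allowed k z t -> valid k.+1 (child z t).
Proof.
move=> v g; have [[La Lb Lc] [q1 q2 d] _] := v.
have q0 : 0 < den (vert z) by apply: lt_le_trans q1.
have /andP[dl du] := allowed_den v g.
have m0 := allowed_ratio_gt0 g; have /andP[ml mu] := allowed_ratio g.
have Mq : 1 <= (M k)%:R * den (vert z) by rewrite mulr_ege1.
split; first split.
- exact: Lcomb.
- have -> : edge (child z t) = comb (-1) 0 0 (vert z) (vert z) (vert z).
    by rewrite /edge /comb /= !scale0r !addr0 scaleN1r.
  exact: Lcomb.
- exact: Lcomb.
- split; rewrite ?(le_trans Mq dl) //.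
    by rewrite qmaxS; apply: le_trans du _; rewrite ler_wpM2l // mulr_ge0.
  by case: g => cop _ _ _ _; rewrite -d det3_child.
have [_ _ _ /andP[h0 h1] /andP[h2 h3]] := g.
have rat i : move_den z t `^ w i / move_den z t = (move_den z t `^ (1 - w i))^-1.
  rewrite powRB; last by rewrite (gt_eqF m0) implybT.
  by rewrite powRr1 ?(ltW m0) // invf_div.
have r0 : move_den z t `^ w 0 / move_den z t = (move_den z t `^ w2)^-1.
  by rewrite rat (_ : 1 - w 0 = w2) // /w /wt /= -w12 addrC addKr.
have r1 : move_den z t `^ w 1 / move_den z t = (move_den z t `^ w1)^-1.
  by rewrite rat (_ : 1 - w 1 = w1) // /w /wt /= -w12 addrK.
have bnd i : P k i <= move_den z t `^ w i <= 2 * P k i.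
  apply/andP; split; first exact: powR_mono.
  apply: (@le_trans _ _ ((2 * (M k)%:R) `^ w i)); first exact: (powR_mono _ (ltW m0)).
  by apply: powR_double; rewrite ?w_ge0 ?w_le1.
have /andP[b1l b1u] := bnd 1; have /andP[b0l b0u] := bnd 0.
have mw1 : 0 < move_den z t `^ w1 by rewrite powR_gt0.
have mw2 : 0 < move_den z t `^ w2 by rewrite powR_gt0.
have e0 : edge_sc w1 w2 (child z t) 0 = move_sc w1 w2 z t 0 / move_den z t `^ w2.
  by rewrite edge_sc_child // -mulrA r0.
have e1 : `|edge_sc w1 w2 (child z t) 1| = `|move_sc w1 w2 z t 1| / move_den z t `^ w1.
  by rewrite edge_sc_child // -mulrA r1 normrM normfV (gtr0_norm mw1).
have h0' : s k.+1 * P k 1 / 2 <= move_sc w1 w2 z t 0 := h0.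
have h1' : move_sc w1 w2 z t 0 <= s k.+1 * P k 1 := h1.
have h2' : s k.+1 * P k 0 / 512 <= `|move_sc w1 w2 z t 1| := h2.
have h3' : `|move_sc w1 w2 z t 1| <= s k.+1 * P k 0 := h3.
have t4 : 4 = 2 * 2 :> R by rewrite -natrM.
rewrite e0 e1; split.
- rewrite t4; exact: (@le_scaled_div R 2 _ _ _ _ (ltr0n R 2) (ltW (s0 k)) mw2 b1u h0').
- rewrite ler_pdivrMr //; apply: le_trans h1' _.
  by rewrite ler_pM2l.
- exact: (@le_scaled_div R 512 _ _ _ _ (ltr0n R 512) (ltW (s0 k)) mw1 b0u h2').
- rewrite ler_pdivrMr //; apply: le_trans h3' _.
  by rewrite ler_pM2l.
Qed.


Lemma min_radius_le k z i : valid k.+1 z -> min_radius k.+1 i <= radius k.+1 z i.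
Proof.
move=> [_ [q1 q2 _] _]; rewrite /min_radius /radius.
have q0 : 0 < den (vert z) by apply: lt_le_trans q1.
have qh : 0 < qmax k.+1 by apply: lt_le_trans q2.
rewrite ler_pM2l ?mulr_gt0 // lef_pV2 ?posrE ?mulr_gt0 ?powR_gt0 ?mulr_gt0 //.
apply: ler_pM; rewrite ?powR_ge0 ?(ltW q0) //; apply: powR_mono => //.
  by rewrite mulr_ge0 ?(ltW q0).
by rewrite ler_wpM2l.
Qed.

Lemma radius_child k z t i : valid k z -> allowed k z t ->
  radius k.+1 (child z t) i <=
  2 * s k.+1 / (P k i ^+ 2 * (M k)%:R) / (den (vert z) * den (vert z) `^ w i).
Proof.
move=> v g; have /andP[dl _] := allowed_den v g; have [_ [q1 _ _] _] := v.
have q0 : 0 < den (vert z) by apply: lt_le_trans q1.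
have q0' : 0 < den (move_vec z t) by apply: lt_le_trans dl; rewrite mulr_gt0.
have qw0 : 0 < den (vert z) `^ w i by rewrite powR_gt0.
rewrite /radius; have -> : 2 * s k.+1 / (P k i ^+ 2 * (M k)%:R) / (den (vert z) *
  den (vert z) `^ w i) =
  2 * s k.+1 / (((M k)%:R * ((M k)%:R * den (vert z))) `^ w i * ((M k)%:R * den (vert z))).
  rewrite !powRM ?mulr_ge0 ?(ltW q0) // -/(P k i).
  by field; rewrite !gt_eqF.
have MMq : 0 < (M k)%:R * ((M k)%:R * den (vert z)) by rewrite !mulr_gt0.
apply: ler_pM; rewrite ?invr_ge0 ?mulr_ge0 ?powR_ge0 ?(ltW q0') ?(ltW (s0 _)) //.
  by rewrite ler_pM2l.
rewrite lef_pV2 ?posrE ?mulr_gt0 ?powR_gt0 ?mulr_gt0 //; last first.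
apply: ler_pM; rewrite ?powR_ge0 ?mulr_ge0 ?(ltW q0) //; apply: powR_mono => //.
  exact: ltW.
by apply: ler_pM; rewrite ?mulr_ge0 ?(ltW q0) // ler_nat.
Qed.

(** The center moves by at most half of the radius, and the radius of the
    child is at most the other half. *)
Lemma in_box_child k z t x : valid k z -> allowed k z t ->
  in_box k.+1 (child z t) x -> in_box k z x.
Proof.
move=> v g bx i; have [_ [q1 _ _] _] := v.
have q0 : 0 < den (vert z) by apply: lt_le_trans q1.
have qw0 : 0 < den (vert z) `^ w i by rewrite powR_gt0.
have m0 := allowed_ratio_gt0 g; have /andP[ml mu] := allowed_ratio g.
set q := den (vert z) in q0 qw0 q1 *; set qw := q `^ w i in qw0 *.
have er : radius k z i = 2 * (s k.+1 / P k i / (q * qw)).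
  by rewrite /radius powRM ?(ltW q0) // -/(P k i) -/q -/qw; field; rewrite !gt_eqF.
have h1 : radius k.+1 (child z t) i <= s k.+1 / P k i / (q * qw).
  apply: le_trans (radius_child i v g) _; rewrite -/q -/qw.
  rewrite ler_pM2r ?invr_gt0 ?mulr_gt0 //.
  have -> : 2 * s k.+1 / (P k i ^+ 2 * (M k)%:R) = s k.+1 / P k i * (2 / (P k i * (M k)%:R)).
    by field; rewrite !gt_eqF.
  rewrite ler_piMr ?divr_ge0 ?(ltW (s0 _)) ?(ltW (P0 _ _)) //.
  rewrite ler_pdivrMr ?mulr_gt0 // mul1r.
  apply: (@le_trans _ _ (1 * (M k)%:R)); first by rewrite mul1r (le_trans _ (M64 k)) // ler_nat.
  rewrite ler_pM2r //; apply: (@le_trans _ _ (1 `^ w i)); first by rewrite powR1.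
  by apply: powR_mono.
have h2 : `|center (move_vec z t) i - center (vert z) i| <= s k.+1 / P k i / (q * qw).
  rewrite (center_move_vec w1 w2) // -/w -/q -/qw addrC addKr normrN normrM [X in _ *
    X]ger0_norm; last first.
    by rewrite invr_ge0 mulr_ge0 // ltW.
  rewrite ler_pM2r ?invr_gt0 ?mulr_gt0 // normrM normfV (gtr0_norm m0).
  rewrite ler_pdivrMr //; apply: le_trans (allowed_lin i g) _.
  by rewrite -mulrA [_ / P k i]mulrC mulrA ler_wpM2l // divr_ge0 ?(ltW (s0 _)) ?(ltW (P0 _ _)).
rewrite er mulr_natl mulr2n -(subrK (center (move_vec z t) i) (x i 0)) -addrA.
apply: le_trans (ler_normD _ _) _; apply: lerD h2.
by apply: le_trans h1; exact: bx.
Qed.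

(** Translates proximity of two points of the plane, each in the box of a
    child, into proximity of the positions in the scaled picture. *)
Lemma box_close k z t t' x x' i : valid k z -> allowed k z t -> allowed k z t' ->
  in_box k.+1 (child z t) x -> in_box k.+1 (child z t') x' ->
  `|x i 0 - x' i 0| <= min_radius k.+1 i ->
  `|move_sc w1 w2 z t i / move_den z t - move_sc w1 w2 z t' i / move_den z t'|
    <= 6 * s k.+1 / ((M k)%:R * P k i ^+ 2).
Proof.
move=> v g g' bx bx' hx; have [_ [q1 _ _] _] := v.
have q0 : 0 < den (vert z) by apply: lt_le_trans q1.
have qw0 : 0 < den (vert z) `^ w i by rewrite powR_gt0.
have m0 := allowed_ratio_gt0 g; have m0' := allowed_ratio_gt0 g'.
have u1 := radius_child i v g; have u2 := radius_child i v g'.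
have {}hx := le_trans hx (le_trans (min_radius_le i (valid_child v g)) u1).
have {}bx := le_trans (bx i) u1; have {}bx' := le_trans (bx' i) u2.
set U := _ / (den _ * _) in hx bx bx'.
have : `|center (move_vec z t) i - center (move_vec z t') i| <= 3 * U.
  have -> : center (move_vec z t) i - center (move_vec z t') i =
     - (x i 0 - center (move_vec z t) i) + (x i 0 - x' i 0) + (x' i 0 -
       center (move_vec z t') i) by ring.
  apply: le_trans (ler_normD _ _) _; apply: (@le_trans _ _ (U + U + U));
    last by rewrite le_eqVlt; apply/orP; left; apply/eqP; ring.
  apply: lerD => //; apply: le_trans (ler_normD _ _) _; apply: lerD => //.
  by rewrite normrN.
rewrite !(center_move_vec w1 w2) // -/w.
set q := den (vert z) in q0 qw0 q1 U hx bx bx' *; set qw := q `^ w i in qw0 U hx bx bx' *.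
set y := _ / move_den z t; set y' := _ / move_den z t'.
have -> : center (vert z) i - y / (q * qw) - (center (vert z) i - y' / (q * qw)) = - ((y -
  y') / (q * qw)) by ring.
rewrite normrN normrM [X in _ * X]ger0_norm; last by rewrite invr_ge0 mulr_ge0 // ltW.
rewrite ler_pdivrMr ?mulr_gt0 // => /le_trans; apply.
by rewrite /U le_eqVlt; apply/orP; left; apply/eqP; field; rewrite !gt_eqF.
Qed.

Definition meets k (A : set 'cV[R]_2) : pred (node R) :=
  fun z => `[< exists2 x, A x & in_box k z x >].

Definition nchild k := Num.truncn ((M k)%:R ^+ 2 / l k ^+ 10).

(** The transfer of [moves_exist] to nodes: when a set is too small to separate
    points in some direction, the boxes that it meets come from moves with
    close positions in that direction. *)
Lemma children_exist k z : valid k z -> exists cs : seq (node R),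
  [/\ size cs = nchild k,
      (forall c, c \in cs -> exists2 t, allowed k z t & c = child z t),
      (forall A : set 'cV[R]_2,
        (forall x x' i, A x -> A x' -> `|x i 0 - x' i 0| <= min_radius k.+1 i) ->
        (count (meets k.+1 A) cs <= 1)%N) &
      (forall A : set 'cV[R]_2,
        (forall x x', A x -> A x' -> `|x 1 0 - x' 1 0| <= min_radius k.+1 1) ->
        (count (meets k.+1 A) cs)%:R <= l k ^+ 10 * P k 0)].
Proof.
move=> v; have dEF := valid_det v.
have [[La Lb Lc] [q1 _ _] [e1 e2 e3 e4]] := v.
have [S [uS sS gS cS]] := moves_exist (edge_den z) (third_den z) (PM k) (l64 k) (Pl k) (PP k) (ls
  k)
  (s_dec k) (s1 k) e1 e2 e3 e4 (@harm k) dEF.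
have NS : (nchild k <= size S)%N.
  rewrite -(@ler_nat R); apply: (@le_trans _ _ ((M k)%:R ^+ 2 / l k ^+ 10)).
    by rewrite truncn_le divr_ge0 // exprn_ge0 // ltW.
  by rewrite ler_pdivrMr ?exprn_gt0 // mulrC.
have gT t : t \in take (nchild k) S -> allowed k z t by move=> /mem_take; exact: gS.
exists [seq child z t | t <- take (nchild k) S]; split.
- by rewrite size_map size_takel.
- by move=> c /mapP[t tS ->]; exists t => //; exact: gT.
- move=> A hA; rewrite count_map; apply: count_le1; first exact: take_uniq.
  move=> t t' /gT g /gT g' /asboolP[x Ax bx] /asboolP[x' Ax' bx'].
  by apply: (move_sep (PM k) (l64 k) (Pl k) (PP k) (ls k) (s_dec k) (s1 k) dEF g g');
    apply: box_close bx bx' _ => //; exact: hA.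
- move=> A hA; rewrite count_map.
  have [/hasP[t0 t0S Pt0]|] := boolP (has (preim (child z) (meets k.+1 A)) (take (nchild k) S));
    last first.
    rewrite has_count -leqNgt leqn0 => /eqP ->.
    by rewrite mulr_ge0 ?exprn_ge0 // ltW.
  apply: le_trans (cS (move_sc w1 w2 z t0 1 / move_den z t0)); rewrite ler_nat.
  apply: (@leq_trans (count (fun t => `|move_sc w1 w2 z t 1 / move_den z t -
    move_sc w1 w2 z t0 1 / move_den z t0|
       <= 6 * s k.+1 / ((M k)%:R * P k 1 ^+ 2)) (take (nchild k) S))).
    rewrite -!size_filter; have -> : seq.filter (preim (child z) (meets k.+1 A)) (take (nchild k)
      S) =
      seq.filter (preim (child z) (meets k.+1 A)) (seq.filter (fun t =>
        `|move_sc w1 w2 z t 1 / move_den z t - move_sc w1 w2 z t0 1 / move_den z t0|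
       <= 6 * s k.+1 / ((M k)%:R * P k 1 ^+ 2)) (take (nchild k) S)).
      rewrite -filter_predI; apply: eq_in_filter => t /gT g /=.
      case: (boolP (meets _ _ _)) => //= /asboolP[x Ax bx].
      move: Pt0 => /asboolP[x0 Ax0 bx0]; apply/esym.
      by apply: box_close bx bx0 _ => //; [exact: gT | exact: hA].
    by rewrite size_filter count_size.
  rewrite -[X in (_ <= count _ X)%N](cat_take_drop (nchild k)) count_cat.
  exact: leq_addr.
Qed.

End Nodes.

(** * Growth of the parameters and mass of small sets *)

Lemma harmonic_le_ln (R : realType) n : (0 < n)%N ->
  \sum_(2 <= d < n.+1) (d%:R)^-1 <= ln n%:R :> R.
Proof.
case: n => // n _; elim: n => [|n IH]; first by rewrite big_geq // ln1.
rewrite big_nat_recr //=; have n0 : 0 < n.+1%:R :> R by [].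
have n1 : 0 < n.+2%:R :> R by [].
have h : (n.+2%:R)^-1 <= ln n.+2%:R - ln n.+1%:R :> R.
  have e : ln n.+2%:R - ln n.+1%:R = - ln (1 + - (n.+2%:R)^-1) :> R.
    rewrite -ln_div ?posrE // -lnV ?posrE; last first.
      by rewrite subr_gt0 invf_lt1 // ltr1n.
    congr ln; rewrite -[n.+2%:R]natr1; move: (n.+1%:R) n0 => x x0.
    have x1 : 0 < x + 1 by lra.
    have -> : 1 + - (x + 1)^-1 = x / (x + 1) by field; rewrite gt_eqF.
    by rewrite invf_div.
  rewrite e lerNr; apply: le_ln1Dx.
  by rewrite ltrN2 invf_lt1 // ltr1n.
by apply: le_trans (lerD IH h) _; rewrite addrC subrK.
Qed.

(** Bernoulli's inequality for the [(p+1)]-st root of 2. *)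
Lemma poly_le_exp (R : realType) (K p : nat) :
  exists2 C : R, 0 < C & forall k, (k + K)%:R ^+ p <= C * 2 ^+ k.
Proof.
pose b : R := 2 `^ (p.+1%:R)^-1.
have b0 : 0 < b by rewrite powR_gt0.
have b1 : 1 < b.
  have e1 : 1 `^ (p.+1%:R)^-1 = 1 :> R by rewrite powR1.
  rewrite /b -[ltLHS]e1.
  by apply: gt0_ltr_powR; rewrite ?nnegrE ?invr_gt0 // ltr1n.
have bp : b ^+ p.+1 = 2.
  by rewrite /b -powR_mulrn ?powR_ge0 // -powRrM mulVf // powRr1.
have bern k : 1 + k%:R * (b - 1) <= b ^+ k.
  elim: k => [|k IH]; first by rewrite mul0r addr0 expr0.
  rewrite exprS; apply: (@le_trans _ _ (b * (1 + k%:R * (b - 1)))); last by rewrite ler_pM2l.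
  have h : 0 <= k%:R * (b - 1) * (b - 1) by rewrite !mulr_ge0 ?subr_ge0 // ltW.
  rewrite -natr1; move: (k%:R : R) h => x h; rewrite -subr_ge0.
  by have -> : b * (1 + x * (b - 1)) - (1 + (x + 1) * (b - 1)) = x * (b - 1) * (b - 1) by ring.
pose c : R := K%:R + 1 + (b - 1)^-1.
have bb : 0 < b - 1 by rewrite subr_gt0.
have c0 : 0 < c by rewrite ltr_wpDl ?invr_gt0 // addr_ge0.
have lin k : (k + K)%:R <= c * b ^+ k.
  have bk : 1 <= b ^+ k by rewrite exprn_ege1 // ltW.
  have h1 : k%:R <= (b - 1)^-1 * b ^+ k.
    rewrite mulrC ler_pdivlMr //; have := bern k; move: (k%:R * _) => x; lra.
  rewrite natrD /c mulrDl [leLHS]addrC; apply: lerD => //.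
  apply: (@le_trans _ _ (K%:R + 1)); first by rewrite lerDl.
  by rewrite ler_peMr // addr_ge0.
exists (c ^+ p.+1 + 1) => [|k]; first by rewrite ltr_wpDl // exprn_ge0 // ltW.
have [e0|pos] := posnP (k + K)%N.
  rewrite e0; apply: (@le_trans _ _ 1); first by rewrite expr0n; case: (p == 0%N).
  by rewrite mulr_ege1 ?exprn_ege1 ?ler1n // lerDr exprn_ge0 // ltW.
apply: (@le_trans _ _ ((k + K)%:R ^+ p.+1)); first by rewrite exprS ler_peMl ?exprn_ge0 // ler1n.
apply: (@le_trans _ _ ((c * b ^+ k) ^+ p.+1));
  first by rewrite lerXn2r ?nnegrE ?mulr_ge0 ?exprn_ge0 ?(ltW c0) ?(ltW b0).
rewrite exprMn -exprM mulnC exprM bp ler_wpM2r ?exprn_ge0 // lerDl //.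
Qed.

Lemma prod_powR (R : realType) (I : Type) (r : seq I) (F : I -> R) x :
  (forall i, 0 <= F i) -> \prod_(i <- r) (F i `^ x) = (\prod_(i <- r) F i) `^ x.
Proof.
move=> F0; elim: r => [|i r IH]; first by rewrite !big_nil powR1.
by rewrite !big_cons IH powRM // prodr_ge0.
Qed.

Lemma exponent_split n : (3 * n.+1)%N = (n + n.+1 * 2).+1.
Proof. lia. Qed.

Lemma succ_sq_le_pow4 n : (3 <= n)%N -> (n.+1 ^ 2 <= n ^ 4)%N.
Proof. by move=> h; nia. Qed.

Section Params.
Variables (R : realType) (w1 w2 : R).
Hypothesis w12 : w1 + w2 = 1.
Hypothesis w10 : 0 < w1.
Hypothesis w20 : 0 < w2.
Hypothesis w21 : w2 < w1.
Variables (J K : nat) (q0 : R).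
Hypothesis Jw2 : 21 <= J%:R * w2.
Hypothesis Jw12 : 2 <= J%:R * (w1 - w2).
Hypothesis K3 : (3 <= K)%N.
Hypothesis KJ : (J <= K)%N.
Hypothesis q01 : 1 <= q0.

(** The fourth power dominates the inverse square of [shape]. Polynomial growth
    is slow enough for one term to be negligible against the product of the
    terms before it. *)
Definition slack (k : nat) : R := ((k + K) ^ 4)%N%:R.
Definition growth (k : nat) : nat := (((k + K) ^ 4) ^ J)%N.
Definition shape (k : nat) : R := ((k + K)%:R ^+ 2)^-1.
Definition den_max (k : nat) : R := q0 * \prod_(0 <= j < k) (2 * (growth j)%:R).
Definition slack_prod (k : nat) : R := \prod_(0 <= j < k) slack j.
Let P k i : R := (growth k)%:R `^ wt w1 w2 i.

Lemma slack_ge64 k : 64 <= slack k.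
Proof.
have h : (3 <= k + K)%N by apply: leq_trans K3 (leq_addl _ _).
rewrite /slack ler_nat !expnS expn0 muln1.
by move: (k + K)%N h => n h; apply: (@leq_trans (3 * (3 * (3 * 3)))%N); rewrite // !leq_mul.
Qed.
Let l0 k : 0 < slack k. Proof. exact: lt_le_trans (slack_ge64 k). Qed.
Let l1 k : 1 <= slack k. Proof. by apply: le_trans (slack_ge64 k); rewrite ler1n. Qed.

Lemma growth_powR k : (growth k)%:R = slack k `^ J%:R.
Proof. by rewrite powR_mulrn ?(ltW (l0 k)) // /growth /slack -natrX. Qed.

Lemma growth_wt_powR k i : P k i = slack k `^ (J%:R * wt w1 w2 i).
Proof. by rewrite /P growth_powR powRrM. Qed.

Lemma growth_wt2_ge k : slack k ^+ 20 <= P k 1.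
Proof.
rewrite growth_wt_powR -powR_mulrn ?(ltW (l0 k)) //; apply: ler_powR => //.
by apply: le_trans Jw2; rewrite ler_nat.
Qed.

Lemma growth_wt_sep k : slack k ^+ 2 * P k 1 <= P k 0.
Proof.
rewrite !growth_wt_powR -powR_mulrn ?(ltW (l0 k)) // -powRD ?(gt_eqF (l0 k)) ?implybT //.
apply: ler_powR => //; have := Jw12; rewrite /wt /= mulrBr; lra.
Qed.

Let kK0 k : 0 < (k + K)%:R :> R.
Proof. by rewrite ltr0n addn_gt0 (leq_trans _ K3) ?orbT. Qed.

Lemma slackE k : slack k = (k + K)%:R ^+ 4.
Proof. by rewrite /slack natrX. Qed.

Lemma slack_inc k : slack k <= slack k.+1.
Proof. by rewrite !slackE lerXn2r ?nnegrE // ler_nat addSn. Qed.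

Lemma shape_gt0 k : 0 < shape k.
Proof. by rewrite invr_gt0 exprn_gt0. Qed.

Lemma slack_shape_ge1 k : 1 <= slack k * shape k.+1.
Proof.
rewrite /shape ler_pdivlMr ?exprn_gt0 // mul1r /slack -natrX ler_nat addSn.
by apply: succ_sq_le_pow4; rewrite (leq_trans K3) // leq_addl.
Qed.

Lemma shape_dec k : shape k.+1 <= shape k.
Proof.
rewrite /shape lef_pV2 ?posrE ?exprn_gt0 // lerXn2r ?nnegrE //.
by rewrite ler_nat addSn.
Qed.

Lemma shape_le1 k : shape k <= 1.
Proof. by rewrite invf_le1 ?exprn_gt0 // exprn_ege1 // ler1n -(@ltr_nat R). Qed.

Lemma growth_inc k : (growth k <= growth k.+1)%N.
Proof.
rewrite /growth -!expnM; case: (posnP (4 * J)) => [->|h]; first by rewrite !expn0.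
by rewrite leq_exp2r // addSn leqnSn.
Qed.

Let growth_gt0 k : (0 < growth k)%N.
Proof. by rewrite /growth !expn_gt0 -(@ltr_nat R) kK0. Qed.
Let growth_ge1 k : 1 <= (growth k)%:R :> R. Proof. by rewrite ler1n. Qed.

(** The sum is at most [ln (l^J) = J ln l], and [J <= l] by the choice of the
    first level. *)
Lemma harmonic_le_slack k n : n%:R <= P k 0 -> \sum_(2 <= d < n.+1) (d%:R)^-1 <= slack k ^+ 2.
Proof.
move=> hn; have [->|n0] := posnP n; first by rewrite big_geq // exprn_ge0 // ltW.
apply: le_trans (harmonic_le_ln _ n0) _.
have nM : n%:R <= (growth k)%:R :> R.
  apply: le_trans hn _; apply: ler1_powR => //; rewrite /wt /=.
  by move: w12 w20; lra.
apply: (@le_trans _ _ (ln (growth k)%:R)); first by rewrite ler_ln ?posrE ?ltr0n.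
rewrite growth_powR ln_powR expr2; apply: ler_pM => //; first by rewrite ln_ge0.
  rewrite /slack ler_nat; apply: (leq_trans KJ); apply: leq_trans (leq_addl k K) _.
  by rewrite -[X in (X <= _)%N]expn1 leq_pexp2l // -(@ltr_nat R).
apply: le_trans (le_ln1Dx (_ : -1 < slack k)) => //.
  by rewrite ler_ln ?posrE ?addr_gt0 // lerDr.
exact: lt_trans (l0 k).
Qed.

Lemma den_maxS k : den_max k.+1 = 2 * (growth k)%:R * den_max k.
Proof. by rewrite /den_max big_nat_recr //= [q0 * (_ * _)]mulrA [RHS]mulrC. Qed.

Lemma slack_prod_ge1 k : 1 <= slack_prod k.
Proof. by rewrite /slack_prod; elim/big_ind: _ => // x y; exact: mulr_ege1. Qed.
Let G0 k : 0 < slack_prod k. Proof. exact: lt_le_trans (slack_prod_ge1 k). Qed.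

Lemma slack_prod_ge_exp2 k : 2 ^+ k <= slack_prod k.
Proof.
elim: k => [|k IH]; first by rewrite expr0 slack_prod_ge1.
rewrite /slack_prod big_nat_recr //= exprS mulrC; apply: ler_pM => //; rewrite ?exprn_ge0 //.
by apply: le_trans (slack_ge64 k); rewrite ler_nat.
Qed.

Lemma den_max_ge1 k : 1 <= den_max k.
Proof.
apply: mulr_ege1 => //; elim/big_ind: _ => // [x y|j _]; first exact: mulr_ege1.
by apply: mulr_ege1 => //; rewrite ler1n.
Qed.

(** Denominators are measured on the scale of [slack_prod], to which widths of
    boxes and numbers of children are also reduced. *)
Lemma den_max_le k : den_max k <= q0 * slack_prod k ^+ J.+1.
Proof.
rewrite /den_max ler_wpM2l ?(le_trans _ q01) // /slack_prod -prodrXl.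
apply: ler_prod => j _; rewrite mulr_ge0 //= exprS growth_powR powR_mulrn ?(ltW (l0 j)) //.
rewrite ler_wpM2r ?exprn_ge0 ?(ltW (l0 j)) //.
by apply: le_trans (slack_ge64 j); rewrite ler_nat.
Qed.

Let wt_ge0 i : 0 <= wt w1 w2 i. Proof. by rewrite /wt; case: ifP; rewrite ltW. Qed.
Let wt_le1 i : wt w1 w2 i <= 1.
Proof. by rewrite /wt; case: ifP => _; move: w12 w10 w20; lra. Qed.

(** Up to a constant, [min_radius] in direction [i] is at least [slack_prod]
    to the power [- theta i]. The ideal value would be [J (1 + w_i)]; the
    excess absorbs factors of slack. *)
Definition theta (i : 'I_2) : R := J.+1%:R * (1 + wt w1 w2 i) + 1.

Lemma theta_gt0 i : 0 < theta i.
Proof. by rewrite /theta ltr_wpDl // mulr_ge0 // addr_ge0. Qed.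

(** Polynomial factors in the level are absorbed by one factor [slack_prod],
    which is at least exponential. *)
Lemma min_radius_ge : exists2 C : R, 0 < C &
  forall k i, (C * slack_prod k `^ theta i)^-1 <= min_radius w1 w2 growth shape den_max k.+1 i.
Proof.
have [C0 C00 hC] := poly_le_exp R K.+1 (12 * J.+1).
exists (C0 * q0 ^+ 2); first by rewrite mulr_gt0 ?exprn_gt0 // (lt_le_trans _ q01).
move=> k i; set G := slack_prod k; set lk := slack k; set lk' := slack k.+1.
have q00 : 0 < q0 by apply: lt_le_trans q01.
set w := wt w1 w2 i.
set q := den_max k.+1; have q1 : 1 <= q := den_max_ge1 _.
have qpos : 0 < q by apply: lt_le_trans q1.
have hq : q <= q0 * (G * lk) ^+ J.+1.
  by apply: le_trans (den_max_le _) _; rewrite /slack_prod big_nat_recr.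
have hden : ((growth k.+1)%:R * q) `^ w * q <=
    lk' ^+ J * (q0 ^+ 2 * (lk ^+ J.+1) ^+ 2 * (G ^+ J.+1) `^ (1 + w)).
  apply: (@le_trans _ _ ((growth k.+1)%:R * q `^ (1 + w))).
    rewrite powRM ?(ltW qpos) // powRD ?(gt_eqF qpos) ?implybT // powRr1 ?(ltW qpos) //.
    have -> : (growth k.+1)%:R * (q * q `^ w) = (growth k.+1)%:R * q `^ w * q by ring.
    rewrite ler_wpM2r ?(ltW qpos) // ler_wpM2r ?powR_ge0 //.
    by apply: ler1_powR; rewrite ?growth_ge1 ?wt_le1.
  rewrite growth_powR powR_mulrn ?(ltW (l0 _)) //; apply: ler_pM;
    rewrite ?exprn_ge0 ?powR_ge0 ?(ltW (l0 _)) //.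
  apply: (@le_trans _ _ ((q0 * lk ^+ J.+1 * G ^+ J.+1) `^ (1 + w))).
    apply: powR_mono; rewrite ?addr_ge0 ?wt_ge0 ?(ltW qpos) //.
    by apply: le_trans hq _; rewrite le_eqVlt; apply/orP; left; apply/eqP; rewrite exprMn; ring.
  have x1 : 1 <= q0 * lk ^+ J.+1 by rewrite mulr_ege1 // exprn_ege1 // l1.
  rewrite powRM ?exprn_ge0 ?(ltW (G0 k)) ?(le_trans _ x1) //.
  rewrite ler_wpM2r ?powR_ge0 // -exprMn -[leRHS]powR_mulrn ?(le_trans _ x1) //.
  by apply: ler_powR => //; move: (wt_le1 i); rewrite -/w; lra.
have hs : 1 <= lk' * shape k.+2 := slack_shape_ge1 k.+1.
have hl : lk' ^+ J * (lk ^+ J.+1) ^+ 2 * lk' <= C0 * G.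
  apply: (@le_trans _ _ (C0 * 2 ^+ k)); last by rewrite ler_pM2l // slack_prod_ge_exp2.
  apply: le_trans (hC k).
  have -> : (k + K.+1)%:R ^+ (12 * J.+1) = lk' ^+ (3 * J.+1).
    by rewrite /lk' slackE addSn -addnS -exprM mulnA.
  have ll : lk <= lk' := slack_inc k.
  have -> : lk' ^+ (3 * J.+1) = lk' ^+ J * (lk' ^+ J.+1) ^+ 2 * lk'.
    by rewrite -exprM -exprD -exprSr exponent_split.
  rewrite ler_pM2r ?l0 // ler_wpM2l ?exprn_ge0 ?(ltW (l0 _)) //.
  by rewrite lerXn2r ?nnegrE ?exprn_ge0 ?(ltW (l0 _)) // lerXn2r ?nnegrE ?(ltW (l0 _)).
have Gw : (G ^+ J.+1) `^ (1 + w) * G = G `^ theta i.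
  rewrite -powR_mulrn ?(ltW (G0 k)) // -powRrM -[X in _ * X](powRr1 (ltW (G0 k))) -powRD //.
  by rewrite (gt_eqF (G0 k)) implybT.
have den0 : 0 < ((growth k.+1)%:R * q) `^ w * q.
  by rewrite mulr_gt0 // powR_gt0 // mulr_gt0 // ltr0n.
have Gth : 0 < G `^ theta i by rewrite powR_gt0 // G0.
rewrite /min_radius -/w -/q ler_pdivlMr // mulrC ler_pdivrMr ?mulr_gt0 ?exprn_gt0 //.
apply: le_trans hden _.
have hl' : lk' ^+ J * (lk ^+ J.+1) ^+ 2 <= shape k.+2 * (C0 * G).
  have h2 := ler_wpM2r (ltW (shape_gt0 k.+2)) hl.
  rewrite [leRHS]mulrC; apply: le_trans h2.
  set X := lk' ^+ J * _; have X0 : 0 <= X by rewrite mulr_ge0 ?exprn_ge0 // ltW.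
  by rewrite -mulrA ler_peMr.
have X0 : 0 <= q0 ^+ 2 * (G ^+ J.+1) `^ (1 + w).
  by rewrite mulr_ge0 ?exprn_ge0 ?powR_ge0 // ltW.
have := ler_wpM2r X0 hl'.
have -> : lk' ^+ J * (lk ^+ J.+1) ^+ 2 * (q0 ^+ 2 * (G ^+ J.+1) `^ (1 + w)) =
  lk' ^+ J * (q0 ^+ 2 * (lk ^+ J.+1) ^+ 2 * (G ^+ J.+1) `^ (1 + w)) by ring.
move/le_trans; apply.
have -> : shape k.+2 * (C0 * G) * (q0 ^+ 2 * (G ^+ J.+1) `^ (1 + w)) =
  shape k.+2 * (C0 * q0 ^+ 2 * ((G ^+ J.+1) `^ (1 + w) * G)) by ring.
rewrite Gw -[leRHS]mulrA ler_peMl ?ler1n //.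
by rewrite !mulr_ge0 ?exprn_ge0 ?(ltW Gth) ?(ltW (shape_gt0 _)) // ltW.
Qed.

Lemma nchild_ge k : (growth k)%:R ^+ 2 <= slack k ^+ 11 * (nchild growth slack k)%:R.
Proof.
have J21 : (21 <= J)%N.
  rewrite -(@ler_nat R); apply: le_trans Jw2 _; rewrite ler_piMr //.
  by move: w12 w10; lra.
have h1 : 1 <= (growth k)%:R ^+ 2 / slack k ^+ 10.
  rewrite ler_pdivlMr ?exprn_gt0 // mul1r growth_powR powR_mulrn ?(ltW (l0 k)) // -exprM.
  by apply: ler_weXn2l => //; rewrite muln2 -addnn; apply: leq_trans (leq_addr _ _);
    apply: leq_trans J21.
have [_ _ h] := truncn_half h1; rewrite -/(nchild growth slack k) in h.
rewrite ler_pdivrMr ?exprn_gt0 // in h; apply: le_trans h _.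
rewrite mulrAC ler_wpM2r // [leRHS]exprS ler_wpM2r ?exprn_ge0 ?(ltW (l0 k)) //.
by apply: le_trans (slack_ge64 k); rewrite ler_nat.
Qed.

Lemma nchild_gt0 k : (0 < nchild growth slack k)%N.
Proof.
rewrite -(@ltr_nat R) -(pmulr_rgt0 _ (exprn_gt0 11 (l0 k))).
by apply: lt_le_trans (nchild_ge k); rewrite exprn_gt0 // ltr0n.
Qed.

Let l_exp k n : slack k ^+ n = slack k `^ n%:R. Proof. by rewrite powR_mulrn // ltW. Qed.

Lemma inv_nchild_le k : ((nchild growth slack k)%:R)^-1 <= slack k `^ (11 - 2 * J%:R).
Proof.
have N0 : 0 < (nchild growth slack k)%:R :> R by rewrite ltr0n nchild_gt0.
have e2 : (growth k)%:R ^+ 2 = slack k `^ (J%:R * 2).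
  by rewrite growth_powR powRrM [RHS]powR_mulrn ?powR_ge0.
have := nchild_ge k; rewrite e2 l_exp => h.
rewrite powRB ?(gt_eqF (l0 k)) ?implybT // ler_pdivlMr ?powR_gt0 // mulrC [2 * _]mulrC.
by rewrite ler_pdivrMr.
Qed.

(** The exponent gained from the levels where only the second direction
    separates: [M^2] children against [M^w_1] met, with losses of slack. *)
Definition beta : R := J%:R * (1 + w2) - 21.

(** How many children of a node of level [j] a set can meet, if it is smaller
    than the boxes in both directions before level [k0], and in the second
    direction only from [k0] on. *)
Definition branching (k0 j : nat) : R := if (j < k0)%N then 1 else slack j ^+ 10 * P j 0.

Lemma branching_ge0 k0 j : 0 <= branching k0 j.
Proof. by rewrite /branching; case: ifP => // _;
  rewrite mulr_ge0 ?exprn_ge0 ?powR_ge0 // ltW. Qed.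

Lemma branching_prod k0 m : (k0 <= m)%N ->
  \prod_(0 <= j < m) (branching k0 j / (nchild growth slack j)%:R) <=
  slack_prod k0 `^ (- (J%:R * w1)) * slack_prod m `^ (- beta).
Proof.
move=> km; rewrite (big_cat_nat (leq0n _) km) /=.
have h1 : \prod_(0 <= j < k0) (branching k0 j / (nchild growth slack j)%:R) <= slack_prod k0 `^
  (11 - 2 * J%:R).
  rewrite /slack_prod -prod_powR; last by move=> j; exact: ltW.
  rewrite big_nat [leRHS]big_nat; apply: ler_prod => j /andP[_ jk].
  by rewrite /branching jk mul1r invr_ge0 ler0n inv_nchild_le.
have h2 : \prod_(k0 <= j < m) (branching k0 j / (nchild growth slack j)%:R) <=
    (\prod_(k0 <= j < m) slack j) `^ (- beta).
  rewrite -prod_powR; last by move=> j; exact: ltW.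
  rewrite big_nat [leRHS]big_nat; apply: ler_prod => j /andP[kj _].
  rewrite divr_ge0 ?branching_ge0 //= /branching ltnNge kj /=.
  apply: (@le_trans _ _ (slack j ^+ 10 * P j 0 * slack j `^ (11 - 2 * J%:R))).
    by rewrite ler_wpM2l ?inv_nchild_le // mulr_ge0 ?exprn_ge0 ?powR_ge0 // ltW.
  rewrite growth_wt_powR l_exp -!powRD ?(gt_eqF (l0 j)) ?implybT //; apply: ler_powR => //.
  rewrite /beta /wt /=; have -> : w1 = 1 - w2 by rewrite -w12 addrK.
  by rewrite mulrBr mulrDr mulr1; lra.
set H := \prod_(k0 <= j < m) slack j in h2 *.
have H1 : 1 <= H by rewrite /H; elim/big_ind: _ => // x y; exact: mulr_ege1.
have eG : slack_prod m = slack_prod k0 * H by rewrite /slack_prod (big_cat_nat (leq0n _) km).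
have G1 := slack_prod_ge1 k0; have Gk := G0 k0.
apply: (@le_trans _ _ (slack_prod k0 `^ (11 - 2 * J%:R) * H `^ (- beta))).
  apply: ler_pM => //; apply: prodr_ge0 => j _; exact: divr_ge0 (branching_ge0 _ _) (ler0n _ _).
rewrite eG powRM ?(ltW Gk) ?(le_trans _ H1) // mulrA ler_wpM2r ?powR_ge0 //.
rewrite -powRD ?(gt_eqF Gk) ?implybT //; apply: ler_powR => //.
rewrite /beta; have -> : w1 = 1 - w2 by rewrite -w12 addrK.
by rewrite mulrBr mulrDr mulr1; lra.
Qed.

Lemma den_max_ge_exp2 k : 2 ^+ k <= den_max k.
Proof.
elim: k => [|k IH]; first by rewrite expr0 den_max_ge1.
rewrite den_maxS exprS; apply: ler_pM; rewrite ?exprn_ge0 //.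
by rewrite ler_peMr.
Qed.

Lemma min_radius_small (d : R) i : 0 < d -> exists k,
  min_radius w1 w2 growth shape den_max k.+1 i < d.
Proof.
move=> d0; pose k := Num.truncn (2 / d); exists k.
have q1 := den_max_ge1 k.+1; have qpos : 0 < den_max k.+1 by apply: lt_le_trans q1.
have kq : k.+1%:R <= den_max k.+1.
  apply: le_trans (den_max_ge_exp2 _); rewrite -natrX ler_nat; exact: ltnW (ltn_expl _ _).
have kd : 2 / d < k.+1%:R by exact: truncnS_gt.
rewrite /min_radius; set w := wt w1 w2 i.
have X1 : 1 <= ((growth k.+1)%:R * den_max k.+1) `^ w.
  apply: (@le_trans _ _ (1 `^ w)); first by rewrite powR1.
  by apply: powR_mono; [exact: wt_ge0 | exact: ler01 | exact: mulr_ege1].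
rewrite ltr_pdivrMr; last by apply: mulr_gt0 => //; apply: lt_le_trans X1.
apply: (@le_lt_trans _ _ (2 * 1)); first by rewrite ler_wpM2l // shape_le1.
rewrite mulr1; apply: (@lt_le_trans _ _ (d * k.+1%:R)); first by rewrite mulrC -ltr_pdivrMr.
rewrite ler_wpM2l ?(ltW d0) //; apply: le_trans kq _.
by rewrite ler_peMl // ltW.
Qed.

Lemma min_radius_first_le_second k : min_radius w1 w2 growth shape den_max k 0 <= min_radius w1
  w2 growth shape den_max k 1.
Proof.
have q1 := den_max_ge1 k; have qpos : 0 < den_max k by apply: lt_le_trans q1.
have X0 : 0 < (growth k)%:R * den_max k by rewrite mulr_gt0 // ltr0n.
rewrite /min_radius ler_pM2l; last by rewrite mulr_gt0 // shape_gt0.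
have D i : 0 < ((growth k)%:R * den_max k) `^ wt w1 w2 i * den_max k.
  by rewrite mulr_gt0 // powR_gt0.
rewrite lef_pV2 ?posrE ?D // ler_pM2r //.
apply: ler_powR; first by rewrite mulr_ege1.
by rewrite /wt /= ltW.
Qed.

Definition dim_exponent : R := J%:R * w1 / theta 0 + beta / theta 1.

Lemma beta_ge0 : 0 <= beta.
Proof. by rewrite /beta mulrDr mulr1; have := Jw2; have : 0 <= J%:R :> R by []; lra. Qed.

(** The levels [k0] and [m] are the first ones where the boxes become
    thinner than [d] in the first, respectively second, direction. *)
Lemma mass_scale : exists2 C : R, 0 < C & forall d : R, 0 < d -> exists k0 m,
  [/\ (forall j i, (j < k0)%N -> d <= min_radius w1 w2 growth shape den_max j.+1 i),
      (forall j, (j < m)%N -> d <= min_radius w1 w2 growth shape den_max j.+1 1) &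
      \prod_(0 <= j < m) (branching k0 j / (nchild growth slack j)%:R) <= (C *
        d) `^ dim_exponent].
Proof.
have [C C0 hC] := min_radius_ge; exists C => // d d0.
have scale k i x : 0 <= x -> min_radius w1 w2 growth shape den_max k.+1 i < d ->
    slack_prod k `^ (- x) <= (C * d) `^ (x / theta i).
  move=> x0 hr; have hd := le_lt_trans (hC k i) hr.
  have Gk := G0 k; have th := theta_gt0 i.
  have Gt : 0 < slack_prod k `^ theta i by rewrite powR_gt0.
  have h : slack_prod k `^ (- theta i) <= C * d.
    by rewrite powRN ltW // -ltr_pdivrMl // -invfM.
  have -> : - x = - theta i * (x / theta i) by field; rewrite gt_eqF.
  rewrite powRrM; apply: powR_mono => //; rewrite ?powR_ge0 //.
  by rewrite divr_ge0 // ltW.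
pose bad0 k := min_radius w1 w2 growth shape den_max k.+1 0 < d.
pose bad1 k := min_radius w1 w2 growth shape den_max k.+1 1 < d.
have ex0 : exists k, bad0 k by exact: min_radius_small.
have ex1 : exists k, bad1 k by exact: min_radius_small.
exists (ex_minn ex0), (ex_minn ex1).
case: ex_minnP => k0 b0 min0; case: ex_minnP => m b1 min1.
have km : (k0 <= m)%N by apply: min0; apply: le_lt_trans b1; exact: min_radius_first_le_second.
have g0 j : (j < k0)%N -> d <= min_radius w1 w2 growth shape den_max j.+1 0.
  by move=> jk; rewrite leNgt; apply/negP => /min0; rewrite leqNgt jk.
split.
- move=> j i jk; case: (altP (i =P 0)) => [->|i0]; first exact: g0.
  rewrite (ord2_neq0 i0).
  exact: le_trans (g0 j jk) (min_radius_first_le_second _).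
- by move=> j jm; rewrite leNgt; apply/negP => /min1; rewrite leqNgt jm.
apply: le_trans (branching_prod km) _.
have Jw1 : 0 <= J%:R * w1 by rewrite mulr_ge0 // ltW.
have h0 := scale k0 0 (J%:R * w1) Jw1 b0.
have h1 := scale m 1 beta beta_ge0 b1.
rewrite /dim_exponent powRD; last by rewrite (gt_eqF (mulr_gt0 C0 d0)) implybT.
by apply: ler_pM; rewrite ?powR_ge0.
Qed.

End Params.

(** * A root whose box lies in a given open set *)

(** Two consecutive integers are not both divisible by [p]. *)
Lemma coprime_shift (p : nat) (a : int) : prime p ->
  exists2 d : int, 0 <= d <= 1 & coprimez (a + d) p%:Z.
Proof.
move=> pp; have pick (u : int) : coprimez u p%:Z = ~~ (p%:Z %| u)%Z.
  by rewrite coprimez_sym /coprimez /gcdz /= dvdzE -prime_coprime.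
have [h|h] := boolP (p%:Z %| a)%Z; last by exists 0; rewrite ?addr0 ?pick.
exists 1 => //; rewrite pick; apply/negP => h1.
have : (p%:Z %| (a + 1) - a)%Z by exact: rpredB.
rewrite addrC addKr.
by rewrite dvdzE dvdn1 => /eqP /= e; move: pp; rewrite e.
Qed.

Lemma large_prime (R : realType) (X : R) : exists2 p, prime p & X <= p%:R.
Proof.
have [p hp pp] := prime_above (Num.truncn X); exists p => //.
by apply: (le_trans (ltW (truncnS_gt X))); rewrite ler_nat.
Qed.

Lemma powR_unbounded (R : realType) (c y : R) : 0 < c ->
  exists2 M0 : R, 1 <= M0 & forall M, M0 <= M -> y <= M `^ c.
Proof.
move=> c0; exists (Num.max 1 y `^ c^-1) => [|M hM].
  apply: (@le_trans _ _ (1 `^ c^-1)); first by rewrite powR1.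
  by apply: powR_mono; rewrite ?invr_ge0 ?(ltW c0) // le_max lexx.
have y1 : 0 <= Num.max 1 y by rewrite le_max ler01.
apply: (@le_trans _ _ ((Num.max 1 y `^ c^-1) `^ c)); last first.
  by apply: powR_mono; rewrite ?powR_ge0 // ltW.
by rewrite -powRrM mulVf ?gt_eqF // powRr1 // le_max lexx orbT.
Qed.

Lemma det3_swap (R : realType) (v e f : 'cV[R]_3) : det3 v f e = - det3 v e f.
Proof. by rewrite /det3; ring. Qed.

Section Init.
Variables (R : realType) (w1 w2 : R).
Hypothesis w12 : w1 + w2 = 1.
Hypothesis w10 : 0 < w1.
Hypothesis w20 : 0 < w2.
Hypothesis w21 : w2 < w1.
Variable L : set 'cV[R]_3.
Hypothesis Lcomb : forall a b c u v w, L u -> L v -> L w -> L (comb a b c u v w).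

Definition basis (z : node R) := [/\ L (vert z), L (edge z), L (third z),
  0 < den (vert z) & `|det3 (vert z) (edge z) (third z)| = 1].

Lemma child_basis z t : basis z -> coprimez t.1.1 t.1.2 -> 0 < move_den z t ->
  basis (child z t).
Proof.
move=> [La Lb Lc q0 d] cop m0; split.
- exact: Lcomb.
- have -> : edge (child z t) = comb (-1) 0 0 (vert z) (vert z) (vert z).
    by rewrite /edge /comb /= !scale0r !addr0 scaleN1r.
  exact: Lcomb.
- exact: Lcomb.
- by rewrite /vert /= den_move_vec ?gt_eqF // mulr_gt0.
- by rewrite -d det3_child.
Qed.

(** The vector from the center to [x], in scaled coordinates, is a real
    combination of edge and third vector, with coefficients [al] and [be]. A
    multiple [m] of it is approximated by an integer one; the error of the
    center is of order [1 / m]. Taking [m = p / |be|] for a prime [p] makes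
    the entry [b] exact and coprimality available at the price of shifting
    [a] by one. The last hypothesis says that [be] is nonzero. *)
Lemma steer_center z (x : 'cV[R]_2) r Q :
  basis z -> 0 < r ->
  x 0 0 != center (vert z) 0 ->
  edge_sc w1 w2 z 0 * ((center (vert z) 1 - x 1 0) * (den (vert z) * den (vert z) `^ w2)) !=
  edge_sc w1 w2 z 1 * ((center (vert z) 0 - x 0 0) * (den (vert z) * den (vert z) `^ w1)) ->
  exists z', [/\ basis z', Q <= den (vert z'), edge_sc w1 w2 z' 0 != 0 &
    forall i, `|center (vert z') i - x i 0| <= r].
Proof.
move=> bz r0 x0 nb; have [_ _ _ q0 d] := bz.
pose qw i := den (vert z) * den (vert z) `^ wt w1 w2 i.
have qw0 i : 0 < qw i by rewrite mulr_gt0 // powR_gt0.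
pose Y i := (center (vert z) i - x i 0) * qw i.
pose E := edge_sc w1 w2 z; pose F := third_sc w1 w2 z.
pose D := E 0 * F 1 - E 1 * F 0.
have D1 : `|D| = 1 by rewrite /D det_edge_third_sc.
have D0 : D != 0 by rewrite -normr_gt0 D1.
pose al := (Y 0 * F 1 - Y 1 * F 0) / D; pose be := (E 0 * Y 1 - E 1 * Y 0) / D.
have be0 : be != 0.
  rewrite mulf_neq0 ?invr_neq0 // subr_eq0; apply: contraNneq nb => e.
  by apply/eqP; exact: e.
have abs0 : 0 < `|be| by rewrite normr_gt0.
have eY : forall i, Y i = al * E i + be * F i.
  by apply: forall_ord2; rewrite /al /be /D; field; exact: D0.
pose S := `|E 0| + `|E 1| + `|Y 0| + `|Y 1|.
have Y0 : Y 0 != 0 by rewrite mulf_neq0 ?(gt_eqF (qw0 0)) // subr_eq0 eq_sym.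
have Yp : 0 < `|Y 0| by rewrite normr_gt0.
(* The scale m of the new denominator has to beat each of these thresholds. *)
pose X := 1 + S / `|Y 0| + S / (r * qw 0) + S / (r * qw 1) + `|Q| / den (vert z).
have S0 : 0 <= S by rewrite !addr_ge0.
have a1 : 0 <= S / `|Y 0| by apply: divr_ge0 (ltW Yp).
have a2 : 0 <= S / (r * qw 0) by apply: divr_ge0 => //; exact: ltW (mulr_gt0 r0 (qw0 0)).
have a3 : 0 <= S / (r * qw 1) by apply: divr_ge0 => //; exact: ltW (mulr_gt0 r0 (qw0 1)).
have a4 : 0 <= `|Q| / den (vert z) by apply: divr_ge0 (ltW q0).
have [p pp hp] := large_prime (X * `|be|).
pose m := p%:R / `|be|.
have mX : X <= m by rewrite ler_pdivlMr.
have [t1 t2 t3 t4] : [/\ S / `|Y 0| < m, S <= m * (r * qw 0),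
  S <= m * (r * qw 1) & Q <= den (vert z) * m].
  have [b1 b2 b3 b4] : [/\ S / `|Y 0| < m, S / (r * qw 0) <= m,
    S / (r * qw 1) <= m & `|Q| / den (vert z) <= m].
    by move: mX a1 a2 a3 a4; rewrite /X; move: (S / `|Y 0|) (S / (r * qw 0)) (S / (r *
      qw 1)) (`|Q| / den (vert z)) => *; split; lra.
  split=> //; first by rewrite -(ler_pdivrMr _ _ (mulr_gt0 r0 (qw0 0))).
    by rewrite -(ler_pdivrMr _ _ (mulr_gt0 r0 (qw0 1))).
  by apply: le_trans (ler_norm Q) _; rewrite mulrC -ler_pdivrMr.
have m1 : 1 <= m.
  apply: le_trans mX; rewrite /X; move: a1 a2 a3 a4.
  by move: (S / `|Y 0|) (S / (r * qw 0)) (S / (r * qw 1)) (`|Q| / den (vert z)) => *; lra.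
have m0 : 0 < m by apply: lt_le_trans m1.
pose b : int := if 0 < be then p%:Z else - p%:Z.
have eb : b%:~R = m * be.
  rewrite /b /m; case: ifP => h; first by rewrite gtr0_norm // divfK.
  rewrite intrN ltr0_norm; last by rewrite lt_neqAle be0 leNgt h.
  by rewrite -pmulrn; field.
have [dl /andP[dl0 dl1] cop] := coprime_shift (Num.floor (m * al)) pp.
set a := _ + dl in cop.
have ha : `|a%:~R - m * al| <= 1.
  have f1 : (Num.floor (m * al))%:~R <= m * al := floor_le_tmp _.
  have f2 : m * al < (Num.floor (m * al))%:~R + 1 by have := floorD1_gt (m * al); rewrite intrD.
  have d0 : 0 <= dl%:~R :> R by rewrite ler0z.
  have d1 : dl%:~R <= 1 :> R by rewrite lerz1.
  rewrite /a intrD ler_norml; apply/andP.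
  by move: ((Num.floor (m * al))%:~R : R) (m * al) (dl%:~R : R) f1 f2 d0 d1 => u v w *;
    split; lra.
pose n := Num.ceil (m - a%:~R * edge_den z - b%:~R * third_den z).
pose t : move := (a, b, n).
have [rl ru] : m <= move_den z t /\ move_den z t <= m + 1.
  rewrite /move_den /ratio /=.
  have c1 := ceil_ge (m - a%:~R * edge_den z - b%:~R * third_den z).
  have c2 := ceil_lt_add1 (m - a%:~R * edge_den z - b%:~R * third_den z).
  rewrite -/n in c1 c2; move: c1 c2.
  by move: (n%:~R : R) (a%:~R * edge_den z) (b%:~R * third_den z) => *; split; lra.
have mr0 : 0 < move_den z t by apply: lt_le_trans rl.
have cop' : coprimez t.1.1 t.1.2.
  rewrite /= /b; case: ifP => // _.
  by rewrite /coprimez gcdzN.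
have el i : move_sc w1 w2 z t i = m * Y i + (a%:~R - m * al) * E i.
  by rewrite /move_sc /lin /= eb eY /E /F; ring.
have hES i : `|E i| + `|Y i| <= S.
  move: i; apply: forall_ord2; rewrite /S.
    by move: (`|E 0|) (`|E 1|) (`|Y 0|) (`|Y 1|) (normr_ge0 (E 1)) (normr_ge0 (Y 1)) => *; lra.
  by move: (`|E 0|) (`|E 1|) (`|Y 0|) (`|Y 1|) (normr_ge0 (E 0)) (normr_ge0 (Y 0)) => *; lra.
exists (child z t); split; first exact: child_basis.
- rewrite /vert /= den_move_vec ?gt_eqF //; apply: le_trans t4 _.
  by rewrite ler_pM2l.
- rewrite edge_sc_child // mulf_neq0 ?invr_neq0 ?(gt_eqF mr0) // mulf_neq0 //; last first.
    by rewrite gt_eqF // powR_gt0.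
  rewrite el -normr_gt0; apply: lt_le_trans (lerB_normD _ _).
  rewrite subr_gt0 [ltRHS]normrM (gtr0_norm m0).
  apply: (@le_lt_trans _ _ (1 * `|E 0|)).
    by rewrite normrM ler_wpM2r.
  rewrite mul1r; move: t1; rewrite ltr_pdivrMr //; apply: le_lt_trans.
  by apply: le_trans (hES 0); rewrite lerDl.
- move=> i; rewrite /vert /= (center_move_vec w1 w2) // -/(qw i) -/(vert z).
  have -> : center (vert z) i - move_sc w1 w2 z t i / move_den z t / qw i - x i 0 =
     ((move_den z t - m) * Y i - (a%:~R - m * al) * E i) / (move_den z t * qw i).
    rewrite el; have -> : center (vert z) i = x i 0 + Y i / qw i.
      by rewrite /Y mulfK ?gt_eqF // addrC subrK.
    by field; rewrite !gt_eqF.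
  rewrite normrM normfV (gtr0_norm (mulr_gt0 mr0 (qw0 i))).
  rewrite ler_pdivrMr; last exact: mulr_gt0 mr0 (qw0 i).
  apply: (@le_trans _ _ S).
    apply: le_trans (ler_normB _ _) _; rewrite (normrM (move_den z t - m)) (normrM (a%:~R -
      m * al)).
    apply: le_trans (hES i); rewrite [leRHS]addrC; apply: lerD; rewrite ler_piMl //.
    rewrite ger0_norm ?subr_ge0 //; lra.
  apply: (@le_trans _ _ (m * (r * qw i))); first by move: i; apply: forall_ord2.
  rewrite mulrCA ler_wpM2l ?(ltW r0) // ler_wpM2r // ltW //.
Qed.

End Init.

Lemma inv_512_le (R : realType) : 512^-1 <= 4^-1 :> R.
Proof. lra. Qed.

(** Any scale [sg] can be reached in one step, because the scaled coordinates
    of the edge of a child are its displacements over powers of the ratio.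
    The prime [p] is the entry [b], and fixes the second coordinate; [a] then
    fixes the first one. *)
Lemma shape_edge_pos (R : realType) (w1 w2 : R) (L : set 'cV[R]_3) z sg r Q :
  w1 + w2 = 1 -> 0 < w1 -> 0 < w2 -> w2 < w1 ->
  (forall a b c u v w, L u -> L v -> L w -> L (comb a b c u v w)) ->
  basis L z -> 0 < edge_sc w1 w2 z 0 -> 0 < sg <= 1 -> 0 < r ->
  exists z', [/\ basis L z', Q <= den (vert z'),
    [/\ sg <= 4 * edge_sc w1 w2 z' 0, edge_sc w1 w2 z' 0 <= sg,
        sg <= 2 * 512 * `|edge_sc w1 w2 z' 1| & `|edge_sc w1 w2 z' 1| <= sg] &
    forall i, `|center (vert z') i - center (vert z) i| <= r].
Proof.
move=> w12 w10 w20 w21 Lcomb bz E0 /andP[sg0 sg1] r0; have [_ _ _ q0 d] := bz.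
pose qw i := den (vert z) * den (vert z) `^ wt w1 w2 i.
have qw0 i : 0 < qw i by rewrite mulr_gt0 // powR_gt0.
have D1 : `|edge_sc w1 w2 z 0 * third_sc w1 w2 z 1 -
  edge_sc w1 w2 z 1 * third_sc w1 w2 z 0| = 1 by rewrite det_edge_third_sc.
set E := edge_sc w1 w2 z 0 in E0 D1 *; set e := edge_sc w1 w2 z 1 in D1 *.
have w120 : 0 < w1 - w2 by rewrite subr_gt0.
have [A1 A11 hA1] := powR_unbounded (4 * E / sg) w20.
have [A2 A21 hA2] := powR_unbounded (4 * `|e| / E) w120.
have [A3 A31 hA3] := powR_unbounded (r * qw 0)^-1 w10.
have [A4 A41 hA4] := powR_unbounded (r * qw 1)^-1 w20.
pose M0 := A1 + A2 + A3 + A4 + `|Q| / den (vert z).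
have [p pp hp] := large_prime (M0 `^ w1 * (E * sg / 2)).
have c0 : 0 < E * sg / 2 by rewrite divr_gt0 // mulr_gt0.
(* M is chosen so that p has exactly the size that the window for the second
   coordinate requires. *)
pose P1 := p%:R / (E * sg / 2); pose M := P1 `^ w1^-1; pose P2 := M `^ w2.
have a4 : 0 <= `|Q| / den (vert z) by apply: divr_ge0 (ltW q0).
have M00 : 0 <= M0 by rewrite !addr_ge0 // (le_trans ler01).
have hP1 : M0 `^ w1 <= P1 by rewrite ler_pdivlMr.
have P1pos : 0 < P1 by rewrite divr_gt0 // ltr0n prime_gt0.
have MM0 : M0 <= M.
  have := powR_mono (_ : 0 <= w1^-1) (powR_ge0 _ _) hP1;
    rewrite -powRrM divff ?gt_eqF // powRr1 //.
  by apply; rewrite invr_ge0 ltW.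
have eP1 : M `^ w1 = P1 by rewrite /M -powRrM mulVf ?gt_eqF // powRr1 // ltW.
have [M1 [k1 k2 k3 k4 k5]] : 1 <= M /\ [/\ A1 <= M, A2 <= M, A3 <= M,
  A4 <= M & `|Q| / den (vert z) <= M].
  clear -A11 A21 A31 A41 a4 MM0; move: MM0; rewrite /M0.
  by move: (`|Q| / den (vert z)) a4 => x x0 h; split; [|split]; lra.
have Mpos : 0 < M by apply: lt_le_trans M1.
have P2pos : 0 < P2 by rewrite powR_gt0.
have P12 : P1 * P2 = M by rewrite -eP1 /P2 -powRD ?w12 ?powRr1 ?(ltW Mpos) // (gt_eqF Mpos)
  implybT.
have {}hA1 : 4 * E <= sg * P2.
  by have := hA1 M k1; rewrite ler_pdivrMr // [X in _ <= X -> _]mulrC.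
have {}hA2 : 4 * (`|e| * P2) <= E * P1.
  have := hA2 M k2; rewrite powRB; last by rewrite (gt_eqF Mpos) implybT.
  rewrite eP1 -/P2 ler_pdivrMr // mulrAC ler_pdivlMr //.
  by rewrite -mulrA [P1 * E]mulrC.
have {}hA3 : 1 <= P1 * (r * qw 0).
  by have := hA3 M k3; rewrite eP1 -[_^-1]mul1r ler_pdivrMr // mulr_gt0.
have {}hA4 : 1 <= P2 * (r * qw 1).
  by have := hA4 M k4; rewrite -/P2 -[_^-1]mul1r ler_pdivrMr // mulr_gt0.
pose F i := third_sc w1 w2 z i.
have [dl /andP[dl0 dl1] cop] := coprime_shift (Num.ceil ((sg * P2 / 2 - p%:R * F 0) / E)) pp.
set a := _ + dl in cop.
pose n := Num.ceil (M - a%:~R * edge_den z - p%:R * third_den z).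
pose t : move := (a, p%:Z, n).
have U0 : sg * P2 / 2 <= move_sc w1 w2 z t 0 <= sg * P2.
  rewrite /move_sc /lin /= -/E -/(F 0) -pmulrn /a intrD.
  set c := Num.ceil _.
  have f1 : sg * P2 / 2 - p%:R * F 0 <= c%:~R * E by rewrite -ler_pdivrMr // ceil_ge.
  have f2 : c%:~R * E <= sg * P2 / 2 - p%:R * F 0 + E.
    rewrite -[leRHS](divfK (lt0r_neq0 E0)) ler_wpM2r ?(ltW E0) //.
    by rewrite mulrDl divff ?(gt_eqF E0) // ltW // ceil_lt_add1.
  have f3 : 0 <= dl%:~R * E by rewrite mulr_ge0 ?(ltW E0) // ler0z.
  have f4 : dl%:~R * E <= E by rewrite ler_piMl ?(ltW E0) // lerz1.
  rewrite mulrDl; clear -f1 f2 f3 f4 hA1.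
  by move: (c%:~R * E) (dl%:~R * E) (p%:R * F 0) (sg * P2) f1 f2 f3 f4 hA1 => *; apply/andP;
    split; lra.
have [rl ru] : M <= move_den z t /\ move_den z t <= 2 * M.
  rewrite /move_den /ratio /= -pmulrn.
  have c1 := ceil_ge (M - a%:~R * edge_den z - p%:R * third_den z).
  have c2 := ceil_lt_add1 (M - a%:~R * edge_den z - p%:R * third_den z).
  rewrite -/n in c1 c2; clear -c1 c2 M1; move: c1 c2.
  by move: (n%:~R : R) (a%:~R * edge_den z) (p%:R * third_den z) => *; split; lra.
have mr0 : 0 < move_den z t by apply: lt_le_trans rl.
have /andP[u1 u2] := U0.
have U00 : 0 <= move_sc w1 w2 z t 0 by apply: le_trans u1; rewrite divr_ge0 // mulr_ge0 // ltW.
have eU1 : move_sc w1 w2 z t 1 * E = e * move_sc w1 w2 z t 0 +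
  p%:R * (E * third_sc w1 w2 z 1 - e * third_sc w1 w2 z 0).
  by rewrite /move_sc /lin /= -/E -/e -pmulrn; ring.
have eP : p%:R = sg * P1 / 2 * E by rewrite /P1; field; rewrite !gt_eqF.
have [v1 v2] : sg * P1 / 4 <= `|move_sc w1 w2 z t 1| /\ `|move_sc w1 w2 z t 1| <= sg * P1.
  have g1 : `|move_sc w1 w2 z t 1| * E = `|move_sc w1 w2 z t 1 *
    E| by rewrite normrM (gtr0_norm E0).
  have g2 : `|e * move_sc w1 w2 z t 0| <= sg * P1 / 4 * E.
    rewrite normrM (ger0_norm U00); apply: (@le_trans _ _ (`|e| * (sg * P2)));
      first by rewrite ler_wpM2l.
    have := ler_wpM2l (ltW sg0) hA2.
    have -> : sg * (4 * (`|e| * P2)) = `|e| * (sg * P2) * 4 by ring.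
    have -> : sg * (E * P1) = sg * P1 / 4 * E * 4 by field.
    by rewrite ler_pM2r.
  have g3 : `|p%:R * (E * third_sc w1 w2 z 1 - e * third_sc w1 w2 z 0)| = sg * P1 / 2 * E.
    by rewrite normrM D1 mulr1 -eP ger0_norm.
  have h1 := ler_normD (e * move_sc w1 w2 z t 0) (p%:R * (E * third_sc w1 w2 z 1 -
    e * third_sc w1 w2 z 0)).
  have h2 := lerB_normD (p%:R * (E * third_sc w1 w2 z 1 -
    e * third_sc w1 w2 z 0)) (e * move_sc w1 w2 z t 0).
  rewrite [X in _ <= `|X|]addrC -eU1 g3 in h2; rewrite -eU1 g3 in h1.
  have k : 0 <= sg * P1 * E by apply: mulr_ge0 (ltW E0); apply: mulr_ge0; exact: ltW.
  split; rewrite -(ler_pM2r E0) g1; clear -h1 h2 g2 k; move: h1 h2 g2 k.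
    by move: (`|e * _|) (`|move_sc w1 w2 z t 1 * E|) => x y; lra.
  by move: (`|e * _|) (`|move_sc w1 w2 z t 1 * E|) => x y; lra.
have cop' : coprimez t.1.1 t.1.2 by [].
have w1le : 0 <= w1 <= 1 by rewrite ltW //=; clear -w12 w20; lra.
have w2le : 0 <= w2 <= 1 by rewrite ltW //=; clear -w12 w10; lra.
have pw (w : R) : 0 <= w <= 1 -> M `^ w <= move_den z t `^ w /\ move_den z t `^ w <= 2 * M `^ w.
  move=> hw; have /andP[w0 _] := hw; split; first by apply: powR_mono => //; exact: ltW.
  by apply: (le_trans (powR_mono w0 (ltW mr0) ru)); exact: powR_double hw (ltW Mpos).
have [b2l b2u] := pw _ w2le; have [b1l b1u] := pw _ w1le; rewrite -/P2 eP1 in b1l b1u b2l b2u.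
have mw1 : 0 < move_den z t `^ w1 by rewrite powR_gt0.
have mw2 : 0 < move_den z t `^ w2 by rewrite powR_gt0.
have mm : move_den z t `^ w1 * move_den z t `^ w2 = move_den z t.
  by rewrite -powRD ?w12 ?powRr1 ?(ltW mr0) // (gt_eqF mr0) implybT.
have e0 : edge_sc w1 w2 (child z t) 0 = move_sc w1 w2 z t 0 / move_den z t `^ w2.
  rewrite edge_sc_child // /wt /= -[in X in _ / X]mm.
  by field; rewrite !gt_eqF.
have e1 : `|edge_sc w1 w2 (child z t) 1| = `|move_sc w1 w2 z t 1| / move_den z t `^ w1.
  rewrite edge_sc_child // /wt /= -[in X in _ / X]mm.
  have -> : move_sc w1 w2 z t 1 * move_den z t `^ w2 / (move_den z t `^ w1 * move_den z t `^ w2) =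
    move_sc w1 w2 z t 1 / move_den z t `^ w1 by field; rewrite !gt_eqF.
  by rewrite normrM normfV (gtr0_norm mw1).
exists (child z t); split; first exact: child_basis.
- rewrite /vert /= den_move_vec ?(gt_eqF q0) // mulrC -ler_pdivrMr //.
  apply: le_trans rl; apply: le_trans k5.
  by rewrite ler_pM2r ?invr_gt0 // ler_norm.
- rewrite e0 e1; split.
  + rewrite (_ : 4 = 2 * 2); last by rewrite -natrM.
    exact: (@le_scaled_div R 2 _ _ _ _ (ltr0n R 2) (ltW sg0) mw2 b2u u1).
  + by rewrite ler_pdivrMr //; apply: le_trans u2 _; rewrite ler_pM2l.
  + apply: (@le_scaled_div R 512 _ _ _ _ (ltr0n R 512) (ltW sg0) mw1 b1u).
    apply: le_trans v1; apply: ler_wpM2l; first exact: mulr_ge0 (ltW sg0) (ltW P1pos).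
    exact: inv_512_le.
  + by rewrite ler_pdivrMr //; apply: le_trans v2 _; rewrite ler_pM2l.
- move=> i; rewrite /vert /= (center_move_vec w1 w2) // -/(qw i) -/(vert z) addrC addKr normrN.
  rewrite normrM [X in _ * X]ger0_norm ?invr_ge0 ?(ltW (qw0 i)) //.
  rewrite ler_pdivrMr // normrM normfV (gtr0_norm mr0) ler_pdivrMr //.
  have P20 := ltW P2pos; have P10 := ltW P1pos.
  have sgM : sg * M <= move_den z t by apply: le_trans rl; rewrite ler_piMl // ltW.
  case: (altP (i =P 0)) => [->|i0].
    rewrite (ger0_norm U00); apply: (le_trans u2).
    apply: (@le_trans _ _ (r * qw 0 * (sg * M))); last by rewrite ler_wpM2l // ltW // mulr_gt0.
    have -> : r * qw 0 * (sg * M) = sg * P2 * (P1 * (r * qw 0)) by rewrite -P12; ring.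
    by rewrite ler_peMr // mulr_ge0 // ltW.
  rewrite (ord2_neq0 i0).
  apply: (le_trans v2).
  apply: (@le_trans _ _ (r * qw 1 * (sg * M))); last by rewrite ler_wpM2l // ltW // mulr_gt0.
  have -> : r * qw 1 * (sg * M) = sg * P1 * (P2 * (r * qw 1)) by rewrite -P12; ring.
  by rewrite ler_peMr // mulr_ge0 // ltW.
Qed.

Import numFieldNormedType.Exports.

Local Open Scope classical_set_scope.
Local Open Scope ring_scope.

Lemma det_2 (R : realType) (A : 'M[R]_2) : \det A = A 0 0 * A 1 1 - A 0 1 * A 1 0.
Proof.
rewrite (expand_det_row A 0) !big_ord_recl big_ord0 addr0 /cofactor !det_mx11 !mxE /=.
have -> : lift 0 0 = 1 :> 'I_2 by apply: val_inj.
have -> : lift 1 0 = 0 :> 'I_2 by apply: val_inj.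
by rewrite expr0 expr1; ring.
Qed.

Lemma det_det3 (R : realType) (A : 'M[R]_3) :
  \det A = det3 (col 0 A) (col 1 A) (col 2 A).
Proof.
rewrite (expand_det_row A 2) !big_ord_recl big_ord0 addr0 /cofactor !det_2 !mxE /det3 /den /hor
  !mxE.
pose o (n : nat) (h : (n < 3)%N) : 'I_3 := Ordinal h.
have e0 (h : (0 < 3)%N) : Ordinal h = 0 by apply: val_inj.
have e1 (h : (1 < 3)%N) : Ordinal h = 1 by apply: val_inj.
have e2 (h : (2 < 3)%N) : Ordinal h = 2 by apply: val_inj.
have r2 : rshift 2 (0 : 'I_1) = 2 :> 'I_3 by apply: val_inj.
have l0 : lshift 1 (0 : 'I_2) = 0 :> 'I_3 by apply: val_inj.
have l1 : lshift 1 (1 : 'I_2) = 1 :> 'I_3 by apply: val_inj.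
have a20 : lift 2 0 = 0 :> 'I_3 by apply: val_inj.
have a21 : lift 2 1 = 1 :> 'I_3 by apply: val_inj.
have a00 : lift 0 0 = 1 :> 'I_3 by apply: val_inj.
have a01 : lift 0 1 = 2 :> 'I_3 by apply: val_inj.
have a10 : lift 1 0 = 0 :> 'I_3 by apply: val_inj.
have a11 : lift 1 1 = 2 :> 'I_3 by apply: val_inj.
have b0 : lift 0 (0 : 'I_2) = 1 :> 'I_3 by apply: val_inj.
have b1 : lift 0 (lift 0 (0 : 'I_1)) = 2 :> 'I_3 by apply: val_inj.
rewrite ?r2 ?l0 ?l1 ?b1 ?b0 ?a20 ?a21 ?a00 ?a01 ?a10 ?a11 /=.
by rewrite /bump /=; ring.
Qed.

Section Root.
Variables (R : realType) (L : lattice R).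

Lemma lattice_comb a b c (u v w : 'cV[R]_3) : (L : set _) u -> (L : set _) v ->
  (L : set _) w -> (L : set _) (comb a b c u v w).
Proof.
have [g _ ->] := latticeP L => -[x _ <-] [y _ <-] [t _ <-].
exists (a *: x + b *: y + c *: t) => //.
by rewrite /comb !map_mxD !map_mxZ !mulmxDr -!scalemxAr.
Qed.

(** Some basis vector has nonzero last coordinate, since the determinant does
    not vanish; a permutation and a change of sign put it first. *)
Lemma lattice_basis : exists z : node R, basis (L : set _) z.
Proof.
have [g dg eL] := latticeP L.
have Lcol j : (L : set _) (col j g).
  rewrite eL; exists (delta_mx j 0) => //; rewrite colE; congr (_ *m _).
  by apply/matrixP => a b; rewrite !mxE; case: (_ && _).
have D1 : `|det3 (col 0 g) (col 1 g) (col 2 g)| = 1 by rewrite -det_det3.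
suff key u v w : (L : set _) u -> (L : set _) v -> (L : set _) w -> `|det3 u v w| = 1 ->
    den u != 0 -> exists z : node R, basis (L : set _) z.
  have [d0|d0] := eqVneq (den (col 0 g)) 0; last exact: (key _ _ _ (Lcol 0) (Lcol 1) (Lcol 2) D1
    d0).
  have [d1|d1] := eqVneq (den (col 1 g)) 0; last first.
    apply: (key _ _ _ (Lcol 1) (Lcol 2) (Lcol 0) _ d1).
    by rewrite -D1; congr (`| _ |); rewrite /det3; ring.
  have [d2|d2] := eqVneq (den (col 2 g)) 0; last first.
    apply: (key _ _ _ (Lcol 2) (Lcol 0) (Lcol 1) _ d2).
    by rewrite -D1; congr (`| _ |); rewrite /det3; ring.
  move: D1; rewrite /det3 d0 d1 d2 !mul0r subrr addr0 normr0 => /eqP.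
  by rewrite eq_sym oner_eq0.
move=> Lu Lv Lw d u0; have [pos|neg] := ltP 0 (den u).
  by exists (u, v, w).
exists (- u, v, w); split=> //.
- have -> : vert (- u, v, w) = comb (-1) 0 0 u u u.
    by rewrite /vert /comb /= !scale0r !addr0 scaleN1r.
  exact: lattice_comb.
- by rewrite /vert /= denN oppr_gt0 lt_neqAle u0.
- rewrite /vert /edge /third /= -d -normrN; congr (`| _ |).
  by rewrite /det3 denN !horN; ring.
Qed.

(** Two steps. Steering moves the center close to a given point and makes the
    first scaled coordinate of the edge nonzero; a further step, which hardly
    moves the center, corrects the shape. If the edge cannot serve for
    steering, the third vector can, as they are independent. *)
Lemma root_exists (w1 w2 sg : R) (U : set 'cV[R]_2) :
  w1 + w2 = 1 -> 0 < w1 -> 0 < w2 -> w2 < w1 -> 0 < sg <= 1 ->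
  open U -> U !=set0 ->
  exists z : node R, [/\ basis (L : set _) z, 1 <= den (vert z),
    [/\ sg <= 4 * edge_sc w1 w2 z 0, edge_sc w1 w2 z 0 <= sg,
        sg <= 2 * 512 * `|edge_sc w1 w2 z 1| & `|edge_sc w1 w2 z 1| <= sg] &
    forall x : 'cV[R]_2, (forall i, `|x i 0 - center (vert z) i| <= 2 / den (vert z)) -> U x].
Proof.
move=> w12 w10 w20 w21 hsg oU [c Uc].
have [r r0 hr] : exists2 r : R, 0 < r & forall x : 'cV[R]_2, (forall i,
  `|x i 0 - c i 0| < r) -> U x.
  have : nbhs c U by apply: open_nbhs_nbhs.
  move=> /nbhs_ballP[r /= r0 hb]; exists r => // x hx; apply: hb; split=> // i j.
  by rewrite ord1 /ball /= distrC.
have [z0 bz0] := lattice_basis.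
have r4 : 0 < r / 8 by rewrite divr_gt0.
(* The target must differ from the base point in its first coordinate for
   steering. *)
have [x xc x0] : exists2 x : 'cV[R]_2, forall i,
  `|x i 0 - c i 0| <= r / 8 & x 0 0 != center (vert z0) 0.
  have [e|ne] := eqVneq (c 0 0) (center (vert z0) 0); last first.
    by exists c => // i; rewrite subrr normr0 ltW.
  exists (\col_i (c i 0 + r / 8)) => [i|]; first by rewrite mxE addrC addKr ger0_norm // ltW.
  by rewrite mxE -e -subr_eq0 addrC addKr gt_eqF.
have Lc := lattice_comb.
have [z1 [bz1 _ E1 c1]] : exists z', [/\ basis (L : set _) z', 1 <= den (vert z'),
  edge_sc w1 w2 z' 0 != 0 &
    forall i, `|center (vert z') i - x i 0| <= r / 8].
  have [_ _ _ q0 d] := bz0.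
  set Y := fun i => (center (vert z0) i - x i 0) * (den (vert z0) * den (vert z0) `^ wt w1 w2 i).
  have [e1|ne1] := eqVneq (edge_sc w1 w2 z0 0 * Y 1) (edge_sc w1 w2 z0 1 * Y 0); last first.
    exact: (steer_center w12 Lc _ bz0 r4 x0 ne1).
  pose z0' : node R := (vert z0, third z0, edge z0).
  have bz0' : basis (L : set _) z0'.
    have [La Lb Le _ _] := bz0; split=> //.
    by rewrite /z0' /vert /edge /third /= det3_swap normrN.
  have [e2|ne2] := eqVneq (edge_sc w1 w2 z0' 0 * Y 1) (edge_sc w1 w2 z0' 1 * Y 0); last first.
    exact: (steer_center w12 Lc _ bz0' r4 x0 ne2).
  have := d; rewrite -(det_edge_third_sc w12 q0).
  have Y0 : Y 0 != 0.
    have qw0 : 0 < den (vert z0) * den (vert z0) `^ wt w1 w2 0 by rewrite mulr_gt0 // powR_gt0.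
    by rewrite /Y mulf_neq0 ?(gt_eqF qw0) // subr_eq0 eq_sym.
  suff -> : edge_sc w1 w2 z0 0 * third_sc w1 w2 z0 1 -
    edge_sc w1 w2 z0 1 * third_sc w1 w2 z0 0 = 0.
    by rewrite normr0 => /eqP; rewrite eq_sym oner_eq0.
  apply: (mulIf Y0); rewrite mul0r.
  transitivity (third_sc w1 w2 z0 0 * (edge_sc w1 w2 z0 0 * Y 1 - edge_sc w1 w2 z0 1 * Y 0)
    - edge_sc w1 w2 z0 0 * (third_sc w1 w2 z0 0 * Y 1 - third_sc w1 w2 z0 1 * Y 0));
      first by ring.
  have e2' : third_sc w1 w2 z0 0 * Y 1 = third_sc w1 w2 z0 1 * Y 0 := e2.
  by rewrite e1 e2' !subrr !mulr0 subrr.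
pose Q : R := Num.max 1 (16 / r).
have [z [bz hQ hs hor]] : exists z', [/\ basis (L : set _) z', Q <= den (vert z'),
    [/\ sg <= 4 * edge_sc w1 w2 z' 0, edge_sc w1 w2 z' 0 <= sg,
        sg <= 2 * 512 * `|edge_sc w1 w2 z' 1| & `|edge_sc w1 w2 z' 1| <= sg] &
    forall i, `|center (vert z') i - center (vert z1) i| <= r / 8].
  have [pos|neg] := ltP 0 (edge_sc w1 w2 z1 0).
    exact: (shape_edge_pos Q w12 w10 w20 w21 Lc bz1 pos hsg r4).
  pose z1' : node R := (vert z1, - edge z1, third z1).
  have [La Lb Le q1 d1] := bz1.
  have bz1' : basis (L : set _) z1'.
    split=> //.
      have -> : edge z1' = comb (-1) 0 0 (edge z1) (edge z1) (edge z1).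
        by rewrite /edge /comb /= !scale0r !addr0 scaleN1r.
      exact: lattice_comb.
    rewrite -d1 -normrN; congr (`| _ |).
    by rewrite /det3 /vert /edge /third /= denN !horN; ring.
  have pos : 0 < edge_sc w1 w2 z1' 0.
    have -> : edge_sc w1 w2 z1' 0 = - edge_sc w1 w2 z1 0.
      by rewrite /edge_sc /scaled /vert /edge /= denN horN; ring.
    by rewrite oppr_gt0 lt_neqAle E1.
  exact: (shape_edge_pos Q w12 w10 w20 w21 Lc bz1' pos hsg r4).
have [Q1 Q2] : 1 <= den (vert z) /\ 16 / r <= den (vert z).
  by split; apply: le_trans hQ; rewrite le_max lexx ?orbT.
exists z; split=> // y hy; apply: hr => i.
have hq : 2 / den (vert z) <= r / 8.
  have q0 : 0 < den (vert z) by apply: lt_le_trans Q1.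
  rewrite ler_pdivrMr // mulrAC ler_pdivlMr //; move: Q2; rewrite ler_pdivrMr // => h.
  by rewrite -natrM mulrC.
have -> : y i 0 - c i 0 = (y i 0 - center (vert z) i) + (center (vert z) i - center (vert z1) i)
   + (center (vert z1) i - x i 0) + (x i 0 - c i 0) by ring.
apply: (@le_lt_trans _ _ (r / 8 + r / 8 + r / 8 + r / 8)).
  apply: le_trans (ler_normD _ _) _; apply: lerD => //.
  apply: le_trans (ler_normD _ _) _; apply: lerD => //.
  apply: le_trans (ler_normD _ _) _; apply: lerD => //.
  exact: le_trans (hy i) hq.
by clear -r0; lra.
Qed.
End Root.

From mathcomp Require Import all_fingroup.

(** * Short vectors and divergence *)

Lemma norm_det_le (R : realType) n (A : 'M[R]_n) (c : R) :
  (forall i j, `|A i j| <= c) -> `|\det A| <= (n`!)%:R * c ^+ n.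
Proof.
move=> h; apply: le_trans (ler_norm_sum _ _ _) _.
apply: (@le_trans _ _ (\sum_(s : 'S_n) c ^+ n)).
  apply: ler_sum => s _; rewrite normrM normr_sign mul1r normr_prod.
  apply: (@le_trans _ _ (\prod_(i < n) c)); first by apply: ler_prod => i _; rewrite normr_ge0 h.
  by rewrite prodr_const card_ord.
by rewrite sumr_const card_Sn mulr_natl.
Qed.

(** Cramer's rule: a nonzero coordinate of [z] is an integer, and it is a
    combination of the coordinates of [g z] with cofactors as
    coefficients. *)
Lemma bounded_basis_short_vector (R : realType) (g : 'M[R]_3) (n : R) (z : 'cV[int]_3) :
  \det g = 1 -> (forall i j, `|g i j| < n) -> z != 0 ->
  exists i, (6 * n ^+ 2)^-1 <= `|(g *m map_mx intr z) i 0|.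
Proof.
move=> dg hn z0.
have n0 : 0 < n by apply: le_lt_trans (hn 0 0).
have [j zj] : exists j, z j 0 != 0.
  apply/existsP; apply: contraNT z0; rewrite negb_exists => /forallP h.
  by apply/eqP/matrixP => i k; rewrite mxE ord1; apply/eqP; rewrite -[_ == _]negbK.
apply: contrapT => /forallNP h.
have {}h i : `|(g *m map_mx intr z) i 0| < (6 * n ^+ 2)^-1.
  by rewrite ltNge; apply/negP; exact: h.
have e : (z j 0)%:~R = \sum_i adjugate g j i * (g *m map_mx intr z) i 0 :> R.
  have := congr1 (fun A : 'M[R]_3 => A *m map_mx intr z) (mul_adj_mx g).
  rewrite dg mul1mx -mulmxA => /(congr1 (fun A : 'cV[R]_3 => A j 0)).
  by rewrite mxE => ->; rewrite mxE.
have hadj i : `|adjugate g j i| <= 2 * n ^+ 2.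
  rewrite mxE /cofactor normrM normr_sign mul1r.
  by apply: norm_det_le => a b; rewrite !mxE ltW.
have : 1 <= `|(z j 0)%:~R : R|.
  by rewrite -intr_norm ler1z; move: zj; lia.
apply/negP; rewrite -ltNge e; apply: le_lt_trans (ler_norm_sum _ _ _) _.
have n2 : 0 < n ^+ 2 by rewrite exprn_gt0.
have e1 : 1 = \sum_(i < 3) (2 * n ^+ 2) * (6 * n ^+ 2)^-1 :> R.
  by rewrite !big_ord_recl big_ord0; field; rewrite gt_eqF.
rewrite [ltRHS]e1; apply: ltr_sum; first by apply/hasP; exists ord0; rewrite ?mem_index_enum.
move=> i _; rewrite normrM; apply: (@le_lt_trans _ _ (2 * n ^+ 2 * `|(g *m map_mx intr z) i 0|)).
  by apply: ler_wpM2r.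
by rewrite ltr_pM2l // mulr_gt0.
Qed.

Lemma open_bounded_mul (R : realType) (T : 'M[R]_3) (n : R) :
  open [set A : 'M[R]_3 | forall i j, `|(A *m T) i j| < n].
Proof.
rewrite openE => A hA /=.
have h (i j : 'I_3) : \forall B \near A, `|(B *m T) i j| < n.
  have cf : (fun B : 'M[R]_3 => (B *m T) i j) @ A --> (A *m T) i j.
    have -> : (fun B : 'M[R]_3 => (B *m T) i j) = (fun B : 'M[R]_3 =>
       B i 0 * T 0 j + (B i 1 * T 1 j + (B i 2 * T 2 j))).
      apply/funext => B; rewrite mxE !big_ord_recl big_ord0 addr0.
      by congr (_ * _ + (_ * _ + _ * _)); congr (_ _ _); apply: val_inj.
    have -> : (A *m T) i j = A i 0 * T 0 j + (A i 1 * T 1 j + (A i 2 * T 2 j)).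
      rewrite mxE !big_ord_recl big_ord0 addr0.
      by congr (_ * _ + (_ * _ + _ * _)); congr (_ _ _); apply: val_inj.
    have c (k : 'I_3) : (fun B : 'M[R]_3 => B i k * T k j) @ A --> A i k * T k j.
      exact: cvgMr_tmp (@coord_continuous R 3 3 i k A).
    exact: (cvgD (c 0) (cvgD (c 1) (c 2))).
  have H := cvgr_norm_lt _ cf _ (hA i j).
  exact: H.
have : \forall B \near A, forall ij : 'I_3 * 'I_3, `|(B *m T) ij.1 ij.2| < n.
  exact: (@filter_forall _ _ (fun (ij : 'I_3 * 'I_3) B => `|(B *m T) ij.1 ij.2| < n)
    (nbhs A) _ (fun ij => h ij.1 ij.2)).
by apply: filterS => B hB i j; exact: (hB (i, j)).
Qed.

Lemma intr_mulmx (R : realType) m n p (A : 'M[int]_(m, n)) (B : 'M[int]_(n, p)) :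
  map_mx intr (A *m B) = map_mx intr A *m map_mx intr B :> 'M[R]_(m, p).
Proof. exact: map_mxM. Qed.

Lemma Zspan_sub_factor (R : realType) (g h : 'M[R]_3) : Zspan h `<=` Zspan g ->
  exists T : 'M[int]_3, h = g *m map_mx intr T.
Proof.
move=> hg; have /choice[f hf] : forall j : 'I_3, exists z : 'cV[int]_3,
  col j h = g *m map_mx intr z.
  move=> j; have [|z _ <-] := hg (col j h); last by exists z.
  exists (delta_mx j 0) => //; rewrite colE; congr (_ *m _).
  by apply/matrixP => a b; rewrite !mxE; case: (_ && _).
exists (\matrix_(i, j) f j i 0); apply/matrixP => i j.
have /matrixP/(_ i 0) := hf j; rewrite !mxE => ->.
by apply: eq_bigr => k _; rewrite !mxE.
Qed.

Lemma Zspan_mul_unimod (R : realType) (g : 'M[R]_3) (T S : 'M[int]_3) :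
  map_mx intr T *m map_mx intr S = 1%:M :> 'M[R]_3 ->
  Zspan (g *m map_mx intr T) = Zspan g.
Proof.
move=> TS; apply/seteqP; split=> _ [z _ <-].
  by exists (T *m z) => //; rewrite intr_mulmx mulmxA.
by exists (S *m z) => //; rewrite intr_mulmx -mulmxA [X in _ *m X]mulmxA TS mul1mx.
Qed.

(** Openness in the quotient means openness of the preimage, and the preimage
    consists of the [g] for which some unimodular change of basis bounds the
    entries; each change of basis gives an open condition. *)
Lemma open_bounded_lattices (R : realType) (n : R) :
  open (@SL3_lattice R @` [set g | forall i j, `|SL3_mx g i j| < n]).
Proof.
apply/open_latticeP; rewrite openE => g [h hh egh] /=.
have eL : Zspan (SL3_mx h) = Zspan (SL3_mx g).
  by have : lattice_set (SL3_lattice h) = lattice_set (SL3_lattice g) by rewrite egh.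
have [T eT] : exists T : 'M[int]_3, SL3_mx h = SL3_mx g *m map_mx intr T.
  by apply: Zspan_sub_factor; rewrite eL.
have [S eS] : exists T : 'M[int]_3, SL3_mx g = SL3_mx h *m map_mx intr T.
  by apply: Zspan_sub_factor; rewrite eL.
have ug : SL3_mx g \in unitmx by rewrite unitmxE det_SL3 unitr1.
have TS : map_mx intr T *m map_mx intr S = 1%:M :> 'M[R]_3.
  have : SL3_mx g *m (map_mx intr T *m map_mx intr S) = SL3_mx g *m 1%:M.
    by rewrite mulmxA -eT -eS mulmx1.
  by move/(congr1 (mulmx (invmx (SL3_mx g)))); rewrite !mulmxA mulVmx // !mul1mx.
have dT : \det (map_mx intr T : 'M[R]_3) = 1.
  by have := congr1 determinant eT; rewrite det_mulmx !det_SL3 mul1r.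
have oW := @open_bounded_mul R (map_mx intr T) n.
have : nbhs g (@set_val _ [set g : 'M[R]_3 | \det g = 1] @^-1`
   [set A : 'M[R]_3 | forall i j, `|(A *m map_mx intr T) i j| < n]).
  apply: open_nbhs_nbhs; split; last by rewrite /= -eT.
  by apply: open_comp => // x _; exact: initial_continuous.
apply: filterS => g' hg' /=.
have d' : \det (SL3_mx g' *m map_mx intr T) = 1 by rewrite det_mulmx det_SL3 dT mulr1.
exists (mk_SL3 d') => //; apply: lattice_eq => /=.
exact: Zspan_mul_unimod TS.
Qed.

(** The lattices with a basis of entries less than [n] form an increasing
    open cover, as [n] varies. *)
Lemma compact_lattices_no_short_vector (R : realType) (K : set (lattice R)) : compact K ->
  exists2 c : R, 0 < c & forall L, K L -> forall v, (L : set 'cV[R]_3) v -> v != 0 ->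
    exists i, c <= `|v i 0|.
Proof.
move=> cK; pose W (n : nat) := @SL3_lattice R @` [set g | forall i j, `|SL3_mx g i j| < n%:R].
have : \forall n \near \oo, K `<=` W n.
  move/compact_near_coveringP : cK; apply => L _.
  have [g eg] := SL3_lattice_surj L.
  pose m : R := \sum_i \sum_j `|SL3_mx g i j|.
  have WL : nbhs L (W (Num.truncn m).+1).
    apply: open_nbhs_nbhs; split; first exact: open_bounded_lattices.
    exists g => // i j.
    apply: le_lt_trans (truncnS_gt m); rewrite /m (bigD1 i) //= (bigD1 j) //= -addrA lerDl.
    by rewrite addr_ge0 // ?sumr_ge0 // => *; rewrite sumr_ge0.
  exists (W (Num.truncn m).+1, [set n | ((Num.truncn m).+1 <= n)%N]) => /=.
    by split=> //; exists (Num.truncn m).+1.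
  move=> [M n] /= [[h hh <-] hn]; exists h => // i j.
  by apply: lt_le_trans (hh i j) _; rewrite ler_nat.
move=> [N _ /(_ N.+1 (leqnSn N)) KW].
have N0 : 0 < N.+1%:R :> R by [].
exists (6 * N.+1%:R ^+ 2)^-1; first by rewrite invr_gt0 mulr_gt0 ?exprn_gt0.
move=> L /KW[g hg <-] v [z _ <-] v0.
apply: bounded_basis_short_vector; [exact: det_SL3 | exact: hg |].
by apply: contra_neq v0 => ->; rewrite map_mx0 mulmx0.
Qed.

Lemma expR_powR (R : realType) (w t : R) : expR (w * t) = expR t `^ w.
Proof. by rewrite /powR gt_eqF ?expR_gt0 // expRK. Qed.

Lemma horo_mulE (R : realType) (x : 'cV[R]_2) (v : 'cV[R]_3) :
  (forall i, hor (horo_mx x *m v) i = hor v i + x i 0 * den v) /\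
  den (horo_mx x *m v) = den v.
Proof.
have e : horo_mx x *m v = col_mx (usubmx (v : 'cV_(2 + 1)) + x *m dsubmx (v : 'cV_(2 + 1)))
    (dsubmx (v : 'cV_(2 + 1))) :> 'cV_(2 + 1).
  rewrite -{1}(vsubmxK (v : 'cV_(2 + 1))) /horo_mx (@mul_block_col _ 2 1 2 1).
  by rewrite !mul1mx mul0mx add0r.
split=> [i|]; rewrite /hor /den e.
  by apply: etrans (@col_mxEu _ 2 1 1 _ _ i 0) _; rewrite !mxE big_ord1 !mxE.
by apply: etrans (@col_mxEd _ 2 1 1 _ _ 0 0) _; rewrite mxE.
Qed.

Lemma flow_mulE (R : realType) (w1 w2 t : R) (v : 'cV[R]_3) :
  (forall i, hor (flow_mx w1 w2 t *m v) i = expR t `^ wt w1 w2 i * hor v i) /\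
  den (flow_mx w1 w2 t *m v) = (expR t)^-1 * den v.
Proof.
split=> [i|]; rewrite /hor /den mul_diag_mx !mxE /=; last by rewrite expRN.
rewrite -expR_powR /wt; case: (altP (i =P 0)) => [->|i0] //=.
by rewrite (ord2_neq0 i0).
Qed.

Section Diverge.
Variables (R : realType) (w1 w2 : R).
Hypothesis w12 : w1 + w2 = 1.
Hypothesis w10 : 0 < w1.
Hypothesis w20 : 0 < w2.
Variables (J K : nat).
Hypothesis K3 : (3 <= K)%N.
Let M := growth J K.
Let s := shape R K.

(** The vector of [z k] is used for the times with [e^t] between
    [q k * (k + K)] and the same quantity at [k.+1]. From the lower end on its
    last coordinate is small; up to the upper end the expansion of the first
    two has not yet made up for the closeness of [x] to the center. *)
Lemma boxes_divergent (L : lattice R) (x : 'cV[R]_2) (z : nat -> node R) :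
  (forall k, (L : set _) (vert (z k))) -> (forall k, 1 <= den (vert (z k))) ->
  (forall k, (M k)%:R * den (vert (z k)) <= den (vert (z k.+1)) <=
     2 * (M k)%:R * den (vert (z k))) ->
  (forall k, in_box w1 w2 M s k (z k) x) ->
  divergent (flow w12) (lattice_act (horo x) L).
Proof.
move=> zL q1 qS zx C /compact_lattices_no_short_vector[c c0 hc0].
pose q k := den (vert (z k)).
pose a k : R := q k * (k + K)%:R.
have kK0 k : 0 < (k + K)%:R :> R by rewrite ltr0n addn_gt0 (leq_trans _ K3) ?orbT.
have M1 k : 1 <= (M k)%:R :> R.
  by rewrite ler1n /M /growth !expn_gt0 -(@ltr_nat R) kK0.
have q0 k : 0 < q k by apply: lt_le_trans (q1 k).
have q_inc k : q k <= q k.+1.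
  by have /andP[h _] := qS k; apply: le_trans h; rewrite ler_peMl // ltW.
have a_inc : {homo a : m n / (m <= n)%N >-> m <= n}.
  apply: homo_leq; [exact: lexx | exact: le_trans |] => k.
  by apply: ler_pM => //; [exact: ltW | rewrite ler_nat addSn].
have a_ge k : k%:R <= a k.
  apply: (@le_trans _ _ (k + K)%:R); first by rewrite ler_nat leq_addr.
  by rewrite /a ler_peMl ?ler0n //; exact: q1.
pose k1 := Num.truncn (4 / c).
have hk1 k : (k1 <= k)%N -> 4 / (k + K)%:R < c.
  move=> kk; rewrite ltr_pdivrMr // mulrC -ltr_pdivrMr //.
  apply: lt_le_trans (truncnS_gt _) _; rewrite ler_nat -/k1.
  by apply: (@leq_trans (k1 + K)); rewrite ?leq_add2r // -addn1 leq_add2l (leq_trans _ K3).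
exists (Num.max 1 (a k1)) => [|t]; first by rewrite lt_max ltr01.
rewrite ge_max => /andP[t1 ta].
have tT : t <= expR t by apply: le_trans (expR_ge1Dx _); rewrite lerDr.
set T := expR t in tT; have T0 : 0 < T by exact: expR_gt0.
have ex : exists k, T < a k.
  by exists (Num.truncn T).+1; apply: lt_le_trans (truncnS_gt _) (a_ge _).
have [k [kk aT Ta]] : exists k, [/\ (k1 <= k)%N, a k <= T & T < a k.+1].
  case: (ex_minnP ex) => -[|k] Tk mink.
    by have := le_lt_trans (le_trans ta tT) Tk; rewrite ltNge a_inc.
  exists k; split=> //.
    rewrite leqNgt; apply/negP => lt.
    by have := le_lt_trans (le_trans ta tT) Tk; rewrite ltNge a_inc.
  by rewrite leNgt; apply/negP => /mink; rewrite ltnn.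
have qk0 := q0 k; have H0 := kK0 k; have H1 := kK0 k.+1.
have xc := hk1 k kk; have xc' := hk1 k.+1 (leqW kk).
pose v := vert (z k); pose y := flow_mx w1 w2 t *m (horo_mx x *m v).
have [hy dy] := flow_mulE w1 w2 t (horo_mx x *m v).
have [hx dx] := horo_mulE x v.
have yL : (lattice_act (flow w12 t) (lattice_act (horo x) L) : set _) y.
  by exists (horo_mx x *m v) => //; exists v => //; exact: zL.
have dy' : den y = T^-1 * q k by rewrite /y dy dx.
move/hc0 => /(_ _ yL)[|i].
  have dy0 : den y != 0 by rewrite dy' gt_eqF // mulr_gt0 ?invr_gt0.
  by apply: contra_neq dy0 => ->; rewrite /den mxE.
apply/negP; rewrite -ltNge.
have w_ge0 j : 0 <= wt w1 w2 j by rewrite /wt; case: ifP; rewrite ltW.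
have w_le1 j : wt w1 w2 j <= 1 by rewrite /wt; case: ifP => _; move: w12 w10 w20; lra.
have [j ->|j ->] := @split_ordP 2 1 i; last first.
  have -> : y (rshift 2 j) 0 = den y by rewrite /den ord1.
  rewrite dy' ger0_norm ?mulr_ge0 ?invr_ge0 ?(ltW T0) ?(ltW qk0) //.
  apply: le_lt_trans xc; rewrite mulrC ler_pdivrMr // mulrAC ler_pdivlMr //.
  by rewrite -/(a k); apply: le_trans aT _; rewrite ler_peMl ?(ltW T0) // ler1n.
have -> : y (lshift 1 j) 0 = hor y j by [].
rewrite /y hy hx -/T.
set w := wt w1 w2 j.
have Mq0 : 0 < (M k)%:R * q k by rewrite mulr_gt0 // (lt_le_trans _ (M1 k)).
have e1 : `|hor v j + x j 0 * den v| <= 2 * s k.+1 / ((M k)%:R * q k) `^ w.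
  have -> : hor v j + x j 0 * den v = q k * (x j 0 - center v j).
    by rewrite /center -/(q k) /v; field; rewrite gt_eqF.
  rewrite normrM (gtr0_norm qk0); apply: (@le_trans _ _ (q k * radius w1 w2 M s k (z k) j)).
    by rewrite ler_pM2l //; exact: zx.
  rewrite /radius -/w -/(q k) le_eqVlt; apply/orP; left; apply/eqP; field.
  by rewrite !gt_eqF ?powR_gt0.
have e2 : T `^ w <= ((M k)%:R * q k) `^ w * (2 * (k.+1 + K)%:R).
  apply: (@le_trans _ _ (((M k)%:R * q k * (2 * (k.+1 + K)%:R)) `^ w)).
    apply: powR_mono; [exact: w_ge0 | exact: ltW |]; apply: (le_trans (ltW Ta)).
    have /andP[_ h] := qS k; rewrite /a; apply: (@le_trans _ _ (2 * (M k)%:R * q k * (k.+1 +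
      K)%:R)).
      by rewrite ler_pM2r.
    by rewrite le_eqVlt; apply/orP; left; apply/eqP; ring.
  rewrite powRM ?(ltW Mq0) ?mulr_ge0 // ler_pM2l ?powR_gt0 //.
  apply: ler1_powR; last exact: w_le1.
  by rewrite mulr_ege1 ?ler1n // -(@ltr_nat R).
rewrite normrM ger0_norm ?powR_ge0 //.
have Pw : 0 < ((M k)%:R * q k) `^ w by rewrite powR_gt0.
apply: le_lt_trans xc'.
apply: (@le_trans _ _ (((M k)%:R * q k) `^ w * (2 * (k.+1 +
  K)%:R) * (2 * s k.+1 / ((M k)%:R * q k) `^ w))).
  by apply: ler_pM; rewrite ?powR_ge0.
rewrite le_eqVlt; apply/orP; left; apply/eqP; rewrite /s /shape.
have -> : 4 = 2 * 2 :> R by rewrite -natrM.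
by field; rewrite !gt_eqF.
Qed.
End Diverge.

(** * Covers of null sets, and nested boxes *)

Lemma coord_le_euclid_dist (R : realType) n (x y : 'cV[R]_n) i :
  `|x i 0 - y i 0| <= euclid_dist x y.
Proof.
rewrite -sqrtr_sqr; apply: ler_wsqrtr; rewrite (bigD1 i) //= lerDl.
by apply: sumr_ge0 => j _; exact: sqr_ge0.
Qed.

Lemma diameter_set0 (R : realType) n : diameter (set0 : set 'cV[R]_n) = 0%E.
Proof.
apply/eqP; rewrite eq_le; apply/andP; split; last by apply: ereal_sup_ubound; left.
by apply: ge_ereal_sup => z [-> //|[x []]].
Qed.

Lemma hausdorff_weight_ge0 (R : realType) n s (A : set 'cV[R]_n) :
  (0 <= hausdorff_weight s A)%E.
Proof. by rewrite /hausdorff_weight; case: ifP => // _; exact: poweR_ge0. Qed.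

(** Real-valued data for a cover: only coordinatewise diameters are retained,
    and the weight is tied to the diameter for sets of positive diameter
    only. *)
Lemma hausdorff_null_cover (R : realType) n s (E : set 'cV[R]_n) (eps : R) :
  hausdorff_measure s E = 0%E -> 0 < eps ->
  exists (F : nat -> set 'cV[R]_n) (d w : nat -> R),
    [/\ E `<=` \bigcup_k F k,
        (forall k, 0 <= d k <= 1 /\ 0 <= w k),
        (forall k, 0 < d k -> w k = d k `^ s),
        (forall k x y i, F k x -> F k y -> `|x i 0 - y i 0| <= d k) &
        (forall m, \sum_(k < m) w k <= eps)].
Proof.
move=> H0 eps0.
have pre0 : (hausdorff_premeasure s 1 E < eps%:E)%E.
  apply: (@le_lt_trans _ _ (hausdorff_measure s E)); last by rewrite H0 lte_fin.
  by apply: ereal_sup_ubound; exists 1 => //=; exact: ltr01.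
have [_ [F [dF EF] <-] lt] := ereal_inf_lt pre0.
have diam0 k : (0%E <= diameter (F k))%E by apply: ereal_sup_ubound; left.
have diam_fin k : diameter (F k) \is a fin_num.
  by rewrite ge0_fin_numE // (le_lt_trans (dF k)) // ltry.
have w0 k : (0 <= hausdorff_weight s (F k))%E by exact: hausdorff_weight_ge0.
have w_lt k : (\sum_(0 <= i < k) hausdorff_weight s (F i) < eps%:E)%E.
  by apply: le_lt_trans lt; apply: nneseries_lim_ge => *; exact: w0.
have w_fin k : hausdorff_weight s (F k) \is a fin_num.
  rewrite ge0_fin_numE //; apply: lt_trans (ltry eps).
  apply: le_lt_trans (w_lt k.+1); rewrite big_nat_recr //=.
  by rewrite leeDr // sume_ge0.
exists F, (fun k => fine (diameter (F k))), (fun k => fine (hausdorff_weight s (F k)));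
  split=> //.
- move=> k; split; last exact: fine_ge0.
  by rewrite fine_ge0 //= -lee_fin fineK.
- move=> k d0; rewrite /hausdorff_weight; case: eqP => [e|_].
    by move: d0; rewrite e diameter_set0 ltxx.
  by rewrite -{1}(fineK (diam_fin k)).
- move=> k x y i Fx Fy; apply: le_trans (coord_le_euclid_dist x y i) _.
  rewrite -lee_fin fineK //; apply: ereal_sup_ubound; right.
  by exists x => //; exists y.
- move=> m; rewrite -lee_fin -sumEFin; apply: ltW; apply: le_lt_trans (w_lt m).
  rewrite big_mkord; apply: lee_sum => k _; by rewrite fineK.
Qed.

Lemma nested_boxes (R : realType) n (c r : nat -> 'I_n -> R) :
  (forall k i, 0 <= r k i) ->
  (forall k (x : 'cV[R]_n), (forall i, `|x i 0 - c k.+1 i| <= r k.+1 i) ->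
     forall i, `|x i 0 - c k i| <= r k i) ->
  exists x : 'cV[R]_n, forall k i, `|x i 0 - c k i| <= r k i.
Proof.
move=> r0 nest.
pose lo k i := c k i - r k i; pose hi k i := c k i + r k i.
have step k i : lo k i <= lo k.+1 i /\ hi k.+1 i <= hi k i.
  have corner (e : R) : `|e| <= 1 -> `|c k.+1 i + e * r k.+1 i - c k i| <= r k i.
    move=> e1; have := nest k (\col_j (c k.+1 j + e * r k.+1 j)) _ i.
    rewrite mxE; apply => j; rewrite mxE addrC addKr normrM (ger0_norm (r0 _ _)).
    by rewrite ler_piMl.
  have := corner 1; have := corner (-1); rewrite normrN normr1 lexx => /(_ isT) + /(_ isT).
  by rewrite !ler_norml mul1r mulN1r /lo /hi; move=> /andP[? ?] /andP[? ?]; split; lra.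
have lo_inc i : {homo lo^~ i : m k / (m <= k)%N >-> m <= k}.
  by apply: homo_leq; [exact: lexx | exact: le_trans |] => k; have [] := step k i.
have hi_dec i m k : (m <= k)%N -> hi k i <= hi m i.
  elim: k => [|k IH]; first by rewrite leqn0 => /eqP ->.
  rewrite leq_eqVlt => /predU1P[-> //|mk].
  by have [_ h] := step k i; apply: le_trans h (IH mk).
have lohi i m k : lo m i <= hi k i.
  have [mk|km] := leqP m k.
    by apply: le_trans (lo_inc i _ _ mk) _; rewrite /lo /hi; have := r0 k i; lra.
  apply: le_trans (hi_dec i _ _ (ltnW km)); rewrite /lo /hi; have := r0 m i; lra.
exists (\col_i sup (range (lo^~ i))) => k i; rewrite mxE.
have ne : range (lo^~ i) !=set0 by exists (lo 0%N i); exists 0%N.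
have h1 : lo k i <= sup (range (lo^~ i)).
  apply: ub_le_sup; last by exists k.
  by exists (hi 0%N i) => _ [m _ <-]; exact: lohi.
have h2 : sup (range (lo^~ i)) <= hi k i.
  by apply: ge_sup => // _ [m _ <-]; exact: lohi.
by rewrite ler_norml; move: h1 h2; rewrite /lo /hi; move: (sup _) => x *; apply/andP; split; lra.
Qed.

(** * The lower bound for the dimension *)

(** The exponent falls short of its limit by at most [27 / J]. *)
Lemma exponent_choice (R : realType) (w1 w2 s : R) : w1 + w2 = 1 -> 0 < w1 -> 0 < w2 ->
  w2 < w1 -> s < 2 - 1 / (1 + w1) ->
  exists J : nat, [/\ 21 <= J%:R * w2, 2 <= J%:R * (w1 - w2) & s < dim_exponent w1 w2 J].
Proof.
move=> w12 w10 w20 w21 hs.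
set e := 2 - 1 / (1 + w1) in hs.
pose X := 21 / w2 + 2 / (w1 - w2) + 27 / (e - s).
pose J := (Num.truncn X).+1; exists J.
have es : 0 < e - s by rewrite subr_gt0.
have d0 : 0 < w1 - w2 by rewrite subr_gt0.
have a1 : 0 < 21 / w2 by rewrite divr_gt0.
have a2 : 0 < 2 / (w1 - w2) by rewrite divr_gt0.
have a3 : 0 < 27 / (e - s) by rewrite divr_gt0.
have XJ : X < J%:R by exact: truncnS_gt.
have J0 : 0 < J%:R :> R by [].
have [b1 b2 b3] : [/\ 21 / w2 <= J%:R, 2 / (w1 - w2) <= J%:R & 27 / (e - s) < J%:R].
  by move: XJ; rewrite /X; move: (21 / w2) (2 / (w1 - w2)) (27 / (e - s)) a1 a2 a3 => *;
    split; lra.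
split; [by rewrite -ler_pdivrMr | by rewrite -ler_pdivrMr |].
have lt27 : 27 / J%:R < e - s by move: b3; rewrite !ltr_pdivrMr // mulrC.
have w1lt : w1 < 1 by move: w12 w20; lra.
have w2lt : w2 < 1 by move: w12 w10; lra.
rewrite /dim_exponent /beta /theta /wt /= -[J.+1%:R]natr1.
move: (J%:R : R) J0 lt27 => n n0 lt27.
have t0 : 0 < (n + 1) * (1 + w1) + 1 by rewrite addr_gt0 // mulr_gt0 // addr_gt0.
have t1 : 0 < (n + 1) * (1 + w2) + 1 by rewrite addr_gt0 // mulr_gt0 // addr_gt0.
have c1 : w1 / (1 + w1) - 3 / n <= n * w1 / ((n + 1) * (1 + w1) + 1).
  rewrite lerBlDr -subr_ge0.
  have -> : n * w1 / ((n + 1) * (1 + w1) + 1) + 3 / n - w1 / (1 + w1) =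
    (3 * ((n + 1) * (1 + w1) + 1) * (1 + w1) - w1 * (2 + w1) * n) /
    (n * ((n + 1) * (1 + w1) + 1) * (1 + w1)).
    by field; rewrite !gt_eqF // addr_gt0.
  apply: divr_ge0; last by rewrite !mulr_ge0 ?(ltW n0) ?(ltW t0) // addr_ge0 // ltW.
  have h1 : w1 * (2 + w1) * n <= 3 * n.
    rewrite ler_pM2r //; apply: (@le_trans _ _ (1 * 3)); last by rewrite mul1r.
    by apply: ler_pM; rewrite ?addr_ge0 ?ltW //; move: w1lt; lra.
  have h2 : 3 * n <= 3 * ((n + 1) * (1 + w1) + 1) * (1 + w1).
    rewrite -mulrA ler_wpM2l //; apply: (@le_trans _ _ ((n + 1) * (1 + w1) + 1)); last first.
      by rewrite ler_peMr ?(ltW t0) // lerDl ltW.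
    apply: (@le_trans _ _ (n + 1)); first by rewrite lerDl.
    by apply: (@le_trans _ _ ((n + 1) * (1 + w1)));
      rewrite ?lerDl // ler_peMr ?lerDl ?(ltW w10) // addr_ge0 // ltW.
  by rewrite subr_ge0 (le_trans h1 h2).
have c2 : 1 - 24 / n <= (n * (1 + w2) - 21) / ((n + 1) * (1 + w2) + 1).
  rewrite lerBlDr -subr_ge0.
  have -> : (n * (1 + w2) - 21) / ((n + 1) * (1 + w2) + 1) + 24 / n - 1 =
    (24 * ((n + 1) * (1 + w2) + 1) - (w2 + 23) * n) / (n * ((n + 1) * (1 + w2) + 1)).
    by field; rewrite !gt_eqF.
  apply: divr_ge0; last by rewrite mulr_ge0 ?ltW.
  have k1 : 0 <= n * w2 by rewrite mulr_ge0 ?ltW.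
  have -> : 24 * ((n + 1) * (1 + w2) + 1) - (w2 + 23) * n = 23 * (n * w2) + n + 24 * (1 +
    w2) + 24 by ring.
  by move: k1 n0 w20; lra.
have ee : e = w1 / (1 + w1) + 1 by rewrite /e; field; rewrite gt_eqF // addr_gt0.
have e27 : 27 / n = 3 / n + 24 / n by rewrite -mulrDl -natrD.
move: c1 c2 lt27; rewrite ee e27.
move: (w1 / (1 + w1)) (3 / n) (24 / n) (n * w1 / _) (_ / ((n + 1) * (1 + w2) + 1)) => *; lra.
Qed.

Section Cantor.
Variables (R : realType) (w1 w2 : R).
Hypothesis w12 : w1 + w2 = 1.
Hypothesis w10 : 0 < w1.
Hypothesis w20 : 0 < w2.
Hypothesis w21 : w2 < w1.
Variables (J K : nat).
Hypothesis Jw2 : 21 <= J%:R * w2.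
Hypothesis Jw12 : 2 <= J%:R * (w1 - w2).
Hypothesis K3 : (3 <= K)%N.
Hypothesis KJ : (J <= K)%N.
Variables (L : lattice R) (root : node R).
Hypothesis root_basis : basis (L : set _) root.
Hypothesis root_den : 1 <= den (vert root).
Hypothesis root_shape : [/\ shape R K 0 <= 4 * edge_sc w1 w2 root 0,
  edge_sc w1 w2 root 0 <= shape R K 0,
  shape R K 0 <= 2 * 512 * `|edge_sc w1 w2 root 1| & `|edge_sc w1 w2 root 1| <= shape R K 0].

Let M := growth J K.
Let l := slack R K.
Let s := shape R K.
Let qmax := den_max J K (den (vert root)).
Let Valid := valid w1 w2 (L : set _) s qmax.
Let Allowed := allowed w1 w2 M s.

Let root_valid : Valid 0%N root.
Proof.
have [La Lb Lc _ d] := root_basis; split=> //; split=> //.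
by rewrite /qmax /den_max big_geq // mulr1.
Qed.

Lemma children_choice : exists ch : nat -> node R -> seq (node R),
  forall k z, Valid k z ->
  [/\ size (ch k z) = nchild M l k,
      (forall c, c \in ch k z -> exists2 t, Allowed k z t & c = child z t),
      (forall A : set 'cV[R]_2,
        (forall x x' i, A x -> A x' -> `|x i 0 - x' i 0| <= min_radius w1 w2 M s qmax k.+1 i) ->
        (count (meets w1 w2 M s k.+1 A) (ch k z) <= 1)%N) &
      (forall A : set 'cV[R]_2,
        (forall x x', A x -> A x' -> `|x 1 0 - x' 1 0| <= min_radius w1 w2 M s qmax k.+1 1) ->
        (count (meets w1 w2 M s k.+1 A) (ch k z))%:R <= l k ^+ 10 * (M k)%:R `^ wt w1 w2 0)].
Proof.
have ex (kz : nat * node R) : exists cs : seq (node R), Valid kz.1 kz.2 ->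
  [/\ size cs = nchild M l kz.1,
      (forall c, c \in cs -> exists2 t, Allowed kz.1 kz.2 t & c = child kz.2 t),
      (forall A : set 'cV[R]_2,
        (forall x x' i, A x -> A x' -> `|x i 0 -
          x' i 0| <= min_radius w1 w2 M s qmax kz.1.+1 i) ->
        (count (meets w1 w2 M s kz.1.+1 A) cs <= 1)%N) &
      (forall A : set 'cV[R]_2,
        (forall x x', A x -> A x' -> `|x 1 0 - x' 1 0| <= min_radius w1 w2 M s qmax kz.1.+1 1) ->
        (count (meets w1 w2 M s kz.1.+1 A) cs)%:R <= l kz.1 ^+ 10 * (M kz.1)%:R `^ wt w1 w2 0)].
  case: kz => k z /=; have [v|nv] := pselect (Valid k z); last by exists [::].
  have [cs h] := children_exist w12 w10 w20 (@lattice_comb R L) (slack_ge64 R K3)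
    (growth_wt2_ge w1 Jw2 K3) (growth_wt_sep Jw12 K3) (slack_shape_ge1 R K3) (shape_dec R K3)
      (shape_le1 R K3)
    (@harmonic_le_slack R w1 w2 w12 w20 J K K3 KJ) (growth_inc J K) (den_maxS J K (den (vert
      root))) v.
  by exists cs.
have [f hf] := choice ex; exists (fun k z => f (k, z)) => k z v.
exact: (hf (k, z) v).
Qed.

Definition branch (z : nat -> node R) := [/\ z 0%N = root, forall k, Valid k (z k) &
  forall k, exists2 t, Allowed k (z k) t & z k.+1 = child (z k) t].

(** The mass of each set of the cover is evaluated at the level that
    [mass_scale] attaches to its diameter. *)
Lemma cover_avoid : exists2 C : R, 0 < C &
  forall (F : nat -> set 'cV[R]_2) (tau : nat -> R),
    (forall i, 0 < tau i) ->
    (forall i x x' j, F i x -> F i x' -> `|x j 0 - x' j 0| <= tau i) ->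
    (forall n, \sum_(i < n) (C * tau i) `^ dim_exponent w1 w2 J <= 3 / 4) ->
  exists2 z, branch z & forall i x, F i x -> exists k, ~ in_box w1 w2 M s k (z k) x.
Proof.
have [C C0 hC] := mass_scale w12 w10 w20 w21 Jw2 K3 root_den.
exists C => // F tau tau0 dF sF.
have [ch hch] := children_choice.
have chV k z c : Valid k z -> c \in ch k z -> Valid k.+1 c.
  move=> v cc; have [_ /(_ c cc)[t g ->] _ _] := hch k z v.
  exact: (valid_child w12 w10 w20 (@lattice_comb R L) (slack_ge64 R K3)
    (growth_wt2_ge w1 Jw2 K3) (slack_shape_ge1 R K3) (den_maxS J K (den (vert root))) v g).
have chN k z : Valid k z -> size (ch k z) = nchild M l k by case/hch.
have ch0 k z : Valid k z -> (0 < size (ch k z))%N.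
  by move=> /chN ->; exact: (nchild_gt0 w12 w10 Jw2 K3).
have nest A k z c : Valid k z -> c \in ch k z ->
    meets w1 w2 M s k.+1 A c -> meets w1 w2 M s k A z.
  move=> v cc /asboolP[x Ax bx]; apply/asboolP; exists x => //.
  have [_ /(_ c cc)[t g ec] _ _] := hch k z v; rewrite ec in bx.
  exact: (in_box_child w12 w10 w20 (slack_ge64 R K3) (growth_wt2_ge w1 Jw2 K3) (growth_wt_sep
    Jw12 K3)
    (slack_shape_ge1 R K3) (shape_dec R K3) (growth_inc J K) v g bx).
have level i : exists m,
    mass R ch (meets w1 w2 M s m (F i)) m 0 root <= (C * tau i) `^ dim_exponent w1 w2 J.
  have [k0 [m [h0 h1 h2]]] := hC _ (tau0 i); exists m.
  apply: le_trans h2.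
  apply: le_trans (mass_le chV (branching_ge0 w1 w2 J K k0) chN (nest (F i)) _ (add0n m)
    root_valid) _.
    move=> k z km v; have [_ _ c1 c2] := hch k z v; rewrite /branching; case: ifP => kk.
      by rewrite (ler_nat R _ 1); apply: c1 => x x' j Fx Fx'; apply: le_trans (h0 _ _ kk);
        exact: dF Fx Fx'.
    by apply: c2 => x x' Fx Fx'; apply: le_trans (h1 _ km); exact: dF Fx Fx'.
  rewrite ler_piMl ?lern1 ?leq_b1 //.
  by apply: prodr_ge0 => j _; rewrite divr_ge0 // branching_ge0.
have [lev hlev] := choice level.
have [||z [z0 zV zc zF]] := @branch_avoid R _ ch Valid ch0 chV
    (fun i => meets w1 w2 M s (lev i) (F i)) lev root (3 / 4) root_valid.
- by lra.
- by move=> n; apply: le_trans (sF n); apply: ler_sum => j _; exact: hlev.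
exists z; first split=> // k.
  by have [_ /(_ _ (zc k)) h _ _] := hch k _ (zV k).
move=> i x Fx; exists (lev i) => bx; move/negP: (zF i); apply.
by apply/asboolP; exists x.
Qed.

Lemma branch_point z : branch z ->
  exists x, forall k, in_box w1 w2 M s k (z k) x.
Proof.
move=> [z0 zV zc].
have s0 k : 0 <= s k by exact: ltW (shape_gt0 R K3 k).
apply: nested_boxes => [k i|k x].
  have [_ [q1 _ _] _] := zV k; have q0 : 0 <= den (vert (z k)) by apply: le_trans q1.
  by rewrite /radius divr_ge0 ?mulr_ge0 ?powR_ge0.
have [t g ->] := zc k; move=> bx.
exact: (in_box_child w12 w10 w20 (slack_ge64 R K3) (growth_wt2_ge w1 Jw2 K3) (growth_wt_sep Jw12
  K3)
    (slack_shape_ge1 R K3) (shape_dec R K3) (growth_inc J K) (zV k) g bx).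
Qed.

Lemma branch_divergent z x : branch z -> (forall k, in_box w1 w2 M s k (z k) x) ->
  divergent (flow w12) (lattice_act (horo x) L).
Proof.
move=> [z0 zV zc] bx; apply: (boxes_divergent w12 w10 w20 K3 _ _ _ bx).
- by move=> k; have [[h _ _] _ _] := zV k.
- by move=> k; have [_ [h _ _] _] := zV k.
- by move=> k; have [t g ->] := zc k; exact: allowed_den (zV k) g.
Qed.

Lemma branch_start z x : branch z -> (forall k, in_box w1 w2 M s k (z k) x) ->
  forall i, `|x i 0 - center (vert root) i| <= 2 / den (vert root).
Proof.
move=> [z0 _ _] bx i; have := bx 0%N; rewrite z0 => /(_ i) /le_trans; apply; rewrite /radius.
have q0 : 0 < den (vert root) by apply: lt_le_trans root_den.
have M1 : 1 <= (M 0)%:R :> R.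
  by rewrite ler1n /M /growth !expn_gt0 add0n (ltn_trans _ K3).
have X1 : 1 <= ((M 0)%:R * den (vert root)) `^ wt w1 w2 i.
  apply: (@le_trans _ _ (1 `^ wt w1 w2 i)); first by rewrite powR1.
  by apply: powR_mono; rewrite ?mulr_ege1 // /wt; case: ifP; rewrite ltW.
have X0 : 0 < ((M 0)%:R * den (vert root)) `^ wt w1 w2 i by apply: lt_le_trans X1.
apply: ler_pM; rewrite ?invr_ge0 ?mulr_ge0 ?(ltW X0) ?(ltW q0) ?(ltW (shape_gt0 R K3 1)) //.
  by rewrite ler_piMr // shape_le1.
by rewrite lef_pV2 ?posrE ?mulr_gt0 // ler_peMl // ltW.
Qed.

Lemma sum_geometric_le n : \sum_(i < n) (2^-1 : R) ^+ i.+2 <= 1 / 2.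
Proof.
suff -> : \sum_(i < n) (2^-1 : R) ^+ i.+2 = 1 / 2 - 2^-1 ^+ n.+1.
  by rewrite gerBl exprn_ge0 // invr_ge0.
elim: n => [|n IH]; first by rewrite big_ord0 expr1 mul1r subrr.
rewrite big_ord_recr /= IH [_ ^+ n.+2]exprS; set y := _ ^+ n.+1; lra.
Qed.

(** A set of the cover that has diameter 0 is treated as one of small positive
    diameter, chosen so that its mass is at most [2^-(i+2)]. Together these
    cost 1/2, and the others cost 1/4. *)
Lemma branches_not_null a (E : set 'cV[R]_2) : 0 <= a -> a < dim_exponent w1 w2 J ->
  (forall z x, branch z -> (forall k, in_box w1 w2 M s k (z k) x) -> E x) ->
  hausdorff_measure a E <> 0%E.
Proof.
move=> a0 aD hE E0; set D := dim_exponent w1 w2 J in aD *.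
have D0 : 0 < D by apply: le_lt_trans aD.
have [C C0 hC] := cover_avoid; have CD : 0 < C `^ D by rewrite powR_gt0.
have eps0 : 0 < (4 * C `^ D)^-1 by rewrite invr_gt0 mulr_gt0.
have [F [d [w [EF dw wd dF sw]]]] := hausdorff_null_cover E0 eps0.
pose half i : R := 2^-1 ^+ i.+2.
have h0 i : 0 < half i by rewrite exprn_gt0 // invr_gt0.
(* The exponent of half i is such that tau i contributes half i to the mass. *)
pose tau i := if 0 < d i then d i else half i `^ D^-1 / C.
have tau0 i : 0 < tau i.
  by rewrite /tau; case: ifP => // _; rewrite divr_gt0 // powR_gt0.
have dtau i : d i <= tau i.
  rewrite /tau; case: ifP => // /negbT; rewrite -leNgt => di.
  by apply: le_trans di _; rewrite divr_ge0 ?powR_ge0 // ltW.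
have mtau i : (C * tau i) `^ D <= C `^ D * w i + half i.
  have [/andP[d0 d1] w0] := dw i; rewrite /tau; case: ifP => di.
    apply: (@le_trans _ _ (C `^ D * w i)); last by rewrite lerDl ltW.
    rewrite powRM ?(ltW C0) // ler_pM2l // wd //.
    by apply: ger_powR; rewrite ?di // ltW.
  rewrite mulrC divfK ?(gt_eqF C0) // -powRrM mulVf ?(gt_eqF D0) // powRr1 ?(ltW (h0 i)) //.
  by rewrite lerDr mulr_ge0 // ltW.
have [|//|z zb zF] := hC F tau tau0.
- by move=> i x x' j Fx Fx'; apply: le_trans (dtau i); exact: dF.
- move=> n; apply: (@le_trans _ _ (\sum_(i < n) (C `^ D * w i + half i))).
    by apply: ler_sum => i _; exact: mtau.
  rewrite big_split /= -mulr_sumr.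
  have h1 : C `^ D * (\sum_(i < n) w i) <= 1 / 4.
    rewrite mulrC -ler_pdivlMr // mul1r -invfM; exact: sw.
  by have := sum_geometric_le n; rewrite -/half; lra.
have [x bx] := branch_point zb.
have [i _ Fx] := EF x (hE z x zb bx).
by have [k] := zF i x Fx; apply; exact: bx.
Qed.
End Cantor.

Theorem theorem1p5 (R : realType) (w1 w2 : R) (hw1 : 0 < w1) (hw2 : 0 < w2)
  (hw : w1 + w2 = 1) (hw12 : w2 < w1) (L : lattice R) (U : set 'cV[R]_2)
  (oU : open U) (U0 : U !=set0) :
  ((2 - 1 / (1 + w1))%:E <=
    hausdorff_dim [set x | U x /\
      divergent (flow hw) (lattice_act (horo x) L)])%E.
Proof.
apply: le_ereal_inf_tmp => _ [a [a0 aH] <-].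
rewrite lee_fin leNgt; apply/negP => alt.
have [J [J1 J2 J3]] := exponent_choice hw hw1 hw2 hw12 alt.
(* Levels are shifted by K, so that the slack of the first one is at least J and
   64. *)
pose K := (J + 3)%N; have K3 : (3 <= K)%N by rewrite leq_addl.
have KJ : (J <= K)%N by rewrite leq_addr.
have sg : 0 < shape R K 0 <= 1 by rewrite shape_gt0 //= shape_le1.
have [root [rb rd rs rU]] := root_exists L hw hw1 hw2 hw12 sg oU U0.
apply: (branches_not_null hw hw1 hw2 hw12 J1 J2 K3 KJ rb rd rs a0 J3 _ aH).
move=> z x zb bx; split; last exact: branch_divergent zb bx.
by apply: rU; exact: branch_start zb bx.
Qed.
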